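(* Let $n\ge0$ and $\varphi\in L^2(\mathbb R,\mathbb H)$. Then for all $y\in\mathbb R$ we have $$\varphi(y)=\frac1{\sqrt2}\int_{\mathbb R^2}e^{2\pi I\omega y}\,[\mathcal V_{\psi_n}\varphi(x,\omega)]\,\psi_n(x-y)\,dx\,d\omega .$$
   Context: $\mathbb H$ is the skew field of quaternions; fix an imaginary unit $I\in\mathbb H$, $I^2=-1$. $L^2(\mathbb R,\mathbb H)$ is the space of square integrable $\mathbb H$-valued functions on $\mathbb R$. $\psi_n=h_n/\|h_n\|_{L^2(\mathbb R)}$ with $h_n(t)=(-1)^ne^{\pi t^2}\frac{d^n}{dt^n}e^{-2\pi t^2}$ (normalized weighted Hermite functions, real-valued). The quaternionic Segal–Bargmann transform is $\mathcal B\varphi(q)=2^{3/4}\int_{\mathbb R}e^{-\pi(q^2+t^2)+2\pi\sqrt2\,qt}\varphi(t)\,dt$ (slice regular in $q\in\mathbb H$); the slice derivative is $\partial_sf(x+Jy)=\frac12(\partial_x-J\partial_y)f(x+Jy)$ for $J\in\mathbb H$, $J^2=-1$, $y\ne0$, and $\partial_sf(x)=\partial_xf(x)$ at real points. The true quaternionic polyanalytic Bargmann transform is $B^{n+1}\varphi(q)=(-1)^n\sqrt{\frac{1}{(2\pi)^nn!}}\sum_{k=0}^n\binom nk(-2\pi\bar q)^k\partial_s^{n-k}\mathcal B\varphi(q)$. With $q=x+I\omega$, the true-poly QSTFT (true polyanalytic quaternion short-time Fourier transform) with respect to $\psi_n$ is $\mathcal V_{\psi_n}\varphi(x,\omega)=e^{-I\pi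 x\omega}B^{n+1}(\varphi)\left(\frac{\bar q}{\sqrt2}\right)e^{-\frac{|q|^2\pi}{2}}$, $(x,\omega)\in\mathbb R^2$.
   Formalization: For general φ in L² the integral over R² need not exist and point values are ambiguous; so the formula is proved as an L²-limit over exhaustions of R², and literally for a.e. y, and for every y where φ is continuous, at which the integral exists. *)

(* Defs.v *)
From HB Require Import structures.
From mathcomp Require Import all_boot all_order all_algebra.
From mathcomp Require Import all_classical all_reals all_analysis.
From mathcomp Require Import ring.

Set Implicit Arguments.
Unset Strict Implicit.
Unset Printing Implicit Defensive.

Import Order.TTheory GRing.Theory Num.Theory.
Import numFieldNormedType.Exports.

Local Open Scope classical_set_scope.
Local Open Scope ring_scope.

(* Quat a b c d stands for a + b i + c j + d k. *)
Record quat (R : Type) := Quat { qre : R; qi : R; qj : R; qk : R }.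

Arguments qre {R} _.
Arguments qi {R} _.
Arguments qj {R} _.
Arguments qk {R} _.

Section QuatTuple.
Variable R : Type.
Definition quat_to_tuple (p : quat R) : R * R * R * R :=
  (qre p, qi p, qj p, qk p).
Definition quat_of_tuple (t : R * R * R * R) : quat R :=
  let: (a, b, c, d) := t in Quat a b c d.
Lemma quat_to_tupleK : cancel quat_to_tuple quat_of_tuple.
Proof. by case. Qed.
End QuatTuple.

HB.instance Definition _ (R : eqType) :=
  Equality.copy (quat R) (can_type (@quat_to_tupleK R)).
HB.instance Definition _ (R : choiceType) :=
  Choice.copy (quat R) (can_type (@quat_to_tupleK R)).

Section QuatRing.
Variable R : realType.
Implicit Types p q r : quat R.

Definition quat_add p q :=
  Quat (qre p + qre q) (qi p + qi q) (qj p + qj q) (qk p + qk q).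
Definition quat_opp p := Quat (- qre p) (- qi p) (- qj p) (- qk p).
Definition quat_mul p q :=
  Quat (qre p * qre q - qi p * qi q - qj p * qj q - qk p * qk q)
       (qre p * qi q + qi p * qre q + qj p * qk q - qk p * qj q)
       (qre p * qj q - qi p * qk q + qj p * qre q + qk p * qi q)
       (qre p * qk q + qi p * qj q - qj p * qi q + qk p * qre q).
Definition quat_scale (a : R) p :=
  Quat (a * qre p) (a * qi p) (a * qj p) (a * qk p).

Fact quat_addA : associative quat_add.
Proof. by case=> ? ? ? ? [? ? ? ?] [? ? ? ?]; rewrite /quat_add /= !addrA. Qed.
Fact quat_addC : commutative quat_add.
Proof.
by case=> a b c d [? ? ? ?]; rewrite /quat_add /=
  (addrC a) (addrC b) (addrC c) (addrC d).
Qed.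
Fact quat_add0 : left_id (Quat 0 0 0 0 : quat R) quat_add.
Proof. by case=> ? ? ? ?; rewrite /quat_add /= !add0r. Qed.
Fact quat_addN : left_inverse (Quat 0 0 0 0 : quat R) quat_opp quat_add.
Proof. by case=> ? ? ? ?; rewrite /quat_add /= !addNr. Qed.

HB.instance Definition _ := GRing.isZmodule.Build (quat R)
  quat_addA quat_addC quat_add0 quat_addN.

Fact quat_mulA : associative quat_mul.
Proof. by case=> ? ? ? ? [? ? ? ?] [? ? ? ?]; congr Quat => /=; ring. Qed.
Fact quat_mul1l : left_id (Quat 1 0 0 0 : quat R) quat_mul.
Proof. by case=> ? ? ? ?; congr Quat => /=; ring. Qed.
Fact quat_mul1r : right_id (Quat 1 0 0 0 : quat R) quat_mul.
Proof. by case=> ? ? ? ?; congr Quat => /=; ring. Qed.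
Fact quat_mulDl : left_distributive quat_mul +%R.
Proof. by case=> ? ? ? ? [? ? ? ?] [? ? ? ?]; congr Quat => /=; ring. Qed.
Fact quat_mulDr : right_distributive quat_mul +%R.
Proof. by case=> ? ? ? ? [? ? ? ?] [? ? ? ?]; congr Quat => /=; ring. Qed.
Fact quat_one_neq0 : (Quat 1 0 0 0 : quat R) != 0.
Proof. by apply/eqP => -[] /eqP; rewrite oner_eq0. Qed.

HB.instance Definition _ := GRing.Zmodule_isNzRing.Build (quat R)
  quat_mulA quat_mul1l quat_mul1r quat_mulDl quat_mulDr quat_one_neq0.

Fact quat_scaleA a b p : quat_scale a (quat_scale b p) = quat_scale (a * b) p.
Proof. by case: p => ? ? ? ?; rewrite /quat_scale /= !mulrA. Qed.
Fact quat_scale1 : left_id 1 quat_scale.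
Proof. by case=> ? ? ? ?; rewrite /quat_scale /= !mul1r. Qed.
Fact quat_scaleDr : right_distributive quat_scale +%R.
Proof. by move=> a [? ? ? ?] [? ? ? ?]; congr Quat => /=; ring. Qed.
Fact quat_scaleDl p : {morph quat_scale^~ p : a b / a + b}.
Proof. by case: p => ? ? ? ? a b; congr Quat => /=; ring. Qed.

HB.instance Definition _ := GRing.Zmodule_isLmodule.Build R (quat R)
  quat_scaleA quat_scale1 quat_scaleDr quat_scaleDl.

Fact quat_scaleAl (a : R) p q : a *: (p * q) = a *: p * q.
Proof. by case: p q => ? ? ? ? [? ? ? ?]; congr Quat => /=; ring. Qed.
Fact quat_scaleAr (a : R) p q : a *: (p * q) = p * (a *: q).
Proof. by case: p q => ? ? ? ? [? ? ? ?]; congr Quat => /=; ring. Qed.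

HB.instance Definition _ := GRing.Lmodule_isLalgebra.Build R (quat R)
  quat_scaleAl.
HB.instance Definition _ := GRing.Lalgebra_isAlgebra.Build R (quat R)
  quat_scaleAr.

Definition quat_conj q := Quat (qre q) (- qi q) (- qj q) (- qk q).
Definition quat_im q := Quat 0 (qi q) (qj q) (qk q).
Definition quat_norm q : R :=
  Num.sqrt (qre q ^+ 2 + qi q ^+ 2 + qj q ^+ 2 + qk q ^+ 2).

(* Applies an operator on real-valued functions (limit, derivative, integral)
   to the four real components of a quaternion-valued function. *)
Definition componentwise (X Y : Type) (F : (X -> R) -> Y -> R)
    (f : X -> quat R) (y : Y) : quat R :=
  Quat (F (qre \o f) y) (F (qi \o f) y) (F (qj \o f) y) (F (qk \o f) y).

Definition all_components (X : Type) (P : (X -> R) -> Prop)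
    (f : X -> quat R) : Prop :=
  [/\ P (qre \o f), P (qi \o f), P (qj \o f) & P (qk \o f)].

Definition quat_lim (u : nat -> quat R) : quat R :=
  componentwise (fun (v : nat -> R) (_ : unit) => lim (v @ \oo)) u tt.

Definition quat_exp q : quat R :=
  quat_lim (fun m => \sum_(0 <= k < m) (k`!%:R)^-1 *: q ^+ k).

Definition quat_derive (f : R -> quat R) : R -> quat R :=
  componentwise (fun g : R -> R => derive1 g) f.

Definition quat_integrable d (T : measurableType d) (mu : {measure set T -> \bar R})
    (D : set T) (f : T -> quat R) : Prop :=
  all_components (fun g => mu.-integrable D (EFin \o g)) f.

Definition quat_integral d (T : measurableType d) (mu : {measure set T -> \bar R})
    (D : set T) (f : T -> quat R) : quat R :=
  componentwise (fun (g : T -> R) (_ : unit) => Rintegral mu D g) f tt.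

Definition lebesgue_R : {measure set (measurableTypeR R) -> \bar R} :=
  lebesgue_measure.

Definition lebesgue_R2 :
    {measure set (measurableTypeR R * measurableTypeR R)%type -> \bar R} :=
  (@lebesgue_measure R \x @lebesgue_measure R)%E.

Definition quat_L2norm (f : R -> quat R) : \bar R :=
  Lnorm lebesgue_R 2%:E (fun t => (quat_norm (f t))%:E).

Definition quat_L2 (f : R -> quat R) : Prop :=
  all_components (fun g => measurable_fun setT (g : measurableTypeR R -> R)) f
  /\ (quat_L2norm f < +oo)%E.

Definition hermite_w (n : nat) (t : R) : R :=
  (-1) ^+ n * expR (pi * t ^+ 2) *
  derive1n n (fun s : R => expR (- (2 * pi * s ^+ 2))) t.

Definition hermite_psi (n : nat) (t : R) : R :=
  hermite_w n t / fine (Lnorm lebesgue_R 2%:E (fun s => (hermite_w n s)%:E)).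

Definition bargmann (phi : R -> quat R) (q : quat R) : quat R :=
  2 `^ (3 / 4) *: quat_integral lebesgue_R setT (fun t : R =>
    quat_exp ((2 * pi * Num.sqrt 2 * t) *: q - pi *: (q ^+ 2 + (t ^+ 2)%:A)) * phi t).

(* A non-real q is x + J y with J = Im q / |Im q| and y = |Im q|; the other
   such decomposition, (- J, - y), yields the same value. *)
Definition sderive (f : quat R -> quat R) (q : quat R) : quat R :=
  let x := qre q in
  let y := quat_norm (quat_im q) in
  let J := y^-1 *: quat_im q in
  if quat_im q == 0 then quat_derive (fun s => f s%:A) x
  else 2^-1 *: (quat_derive (fun s => f (s%:A + y *: J)) x
                - J * quat_derive (fun s => f (x%:A + s *: J)) y).

(* Index shift: true_poly_bargmann n is B^{n+1}. *)
Definition true_poly_bargmann (n : nat) (phi : R -> quat R) (q : quat R) :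
    quat R :=
  ((-1) ^+ n * Num.sqrt (1 / ((2 * pi) ^+ n * n`!%:R))) *:
  \sum_(k < n.+1) 'C(n, k)%:R *:
    ((- (2 * pi)) *: quat_conj q) ^+ k * iter (n - k) sderive (bargmann phi) q.

Definition true_poly_QSTFT (I : quat R) (n : nat) (phi : R -> quat R)
    (x w : R) : quat R :=
  let q := x%:A + w *: I in
  quat_exp ((- (pi * x * w)) *: I)
  * true_poly_bargmann n phi ((Num.sqrt 2)^-1 *: quat_conj q)
  * (expR (- (quat_norm q ^+ 2 * pi / 2)))%:A.

Definition synthesis_integrand (I : quat R) (n : nat) (phi : R -> quat R)
    (y : R) (z : R * R) : quat R :=
  quat_exp ((2 * pi * z.2 * y) *: I) * true_poly_QSTFT I n phi z.1 z.2
  * (hermite_psi n (z.1 - y))%:A.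

(* The reconstruction integral at the point y, restricted to a subset A of the
   time-frequency plane, including the factor 1 / sqrt 2. *)
Definition reconstruction (I : quat R) (n : nat) (phi : R -> quat R)
    (A : set (R * R)) (y : R) : quat R :=
  (1 / Num.sqrt 2) *: quat_integral lebesgue_R2 A (synthesis_integrand I n phi y).

End QuatRing.

(* Main.v *)
From HB Require Import structures.
Require Import Defs.
From mathcomp Require Import all_boot all_order all_algebra.
From mathcomp Require Import all_classical all_reals all_analysis.
From mathcomp Require Import measurable_realfun ring lra complex.
Set Implicit Arguments.
Unset Strict Implicit.
Unset Printing Implicit Defensive.
Import Order.TTheory GRing.Theory Num.Theory.
Import numFieldNormedType.Exports.
Local Open Scope classical_set_scope.
Local Open Scope ring_scope.

(** By the addition formula for Hermite polynomials the true-poly QSTFT collapses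
    to sqrt 2 times the short-time Fourier transform
    \int e^(-2 pi I w t) psi_n(x - t) phi(t) dt.  Hence a real component of the
    synthesis integrand is sqrt 2 * H_y(x, w) with
    H_y = (cos(2 pi w y) W1 + sin(2 pi w y) W2) psi_n(x - y), where W1, W2 are real
    windowed cosine/sine transforms of a = phi_c and b = (I phi)_c.
    After damping by e^(-pi w^2 / k^2), Fubini gives
    \int H_y = \int a(t) (\int psi_n(x - t) psi_n(x - y) dx) k e^(-pi k^2 (t - y)^2) dt,
    which tends to a(y) at every Lebesgue point of a because psi_n has norm 1;
    dominated convergence removes the damping whenever H_y is integrable.
    For exhaustions K_m of the plane, the adjoint of the Bessel inequality and
    Fatou bound \int (a - \int_(K_m) H_y)^2 dy by twice the integral of
    W1^2 + W2^2 outside K_m. *)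

(** The obstacle is that the plane integral may fail to exist: a jump of [phi] makes the transform
    decay only like 1/w in frequency. The formula is therefore read in two ways, as an [L^2] limit
    along exhaustions on which the integrals exist, and pointwise wherever the full integral exists.

    Values in the slice of [I] act on [phi t] from the left and do not commute with it, so a real
    component of [z * phi t] mixes that component of [phi t] with the one of [I * phi t]. This is
    why each component carries a pair [a], [b]. In the damped inversion [b] only meets an odd sine
    integral and drops out.

    No Plancherel identity is required. Equality comes from the Gaussian inversion, while Bessel
    only has to show that the error is controlled by a tail of an integrable function. Rough
    constants such as the factor 2 are thus harmless.

    The factor [1 / Num.sqrt 2] compensates the [Num.sqrt 2] left over when the constants of the
    Bargmann transform are compared with the normalization of [hermite_psi]. *)

Lemma sqrB_le4 (R : realType) (c1 s1 c2 s2 : R) :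
  (c1 - s2) ^+ 2 <= 2 * (c1 ^+ 2 + s1 ^+ 2 + (c2 ^+ 2 + s2 ^+ 2)).
Proof. by have := sqr_ge0 (c1 + s2); have := sqr_ge0 s1; have := sqr_ge0 c2; nra. Qed.

Lemma sqrD_le4 (R : realType) (c1 s1 c2 s2 : R) :
  (c2 + s1) ^+ 2 <= 2 * (c1 ^+ 2 + s1 ^+ 2 + (c2 ^+ 2 + s2 ^+ 2)).
Proof. by have := sqr_ge0 (c2 - s1); have := sqr_ge0 c1; have := sqr_ge0 s2; nra. Qed.

Lemma normrM_le_sqrD (R : realType) (x y : R) : `|x * y| <= x ^+ 2 + y ^+ 2.
Proof.
rewrite normrM -(real_normK (num_real x)) -(real_normK (num_real y)).
by have := sqr_ge0 (`|x| - `|y|); have := sqr_ge0 (`|x| + `|y|); nra.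
Qed.

Lemma le_half_mul (R : realType) (a e n b : R) : 0 <= e -> 2 * a <= n * e -> n <= b ->
  a <= e / 2 * b.
Proof. by move=> e0 h nb; have := ler_wpM2r e0 nb; lra. Qed.

(** Trades a linear bound for a cubic one on radii [r >= d]. After rescaling by [c], the cubic
    moment gains the factor [c ^- 2] that makes large radii negligible. *)
Lemma mul_le_cube (R : realType) (M d r : R) : 0 <= M -> 0 < d -> d <= r ->
  M * r <= M / d ^+ 2 * r ^+ 3.
Proof.
move=> M0 d0 dr; have r0 : 0 <= r := le_trans (ltW d0) dr.
rewrite -mulrA; apply: ler_wpM2l => //; rewrite mulrC ler_pdivlMr ?exprn_gt0//.
by rewrite [leRHS]exprS; apply: ler_wpM2l => //; rewrite lerXn2r// nnegrE ltW.
Qed.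

Lemma indic_ge0 (R : realType) (T : Type) (A : set T) (t : T) : 0 <= \1_A t :> R.
Proof. by rewrite indicE. Qed.

(** Both signs follow from squares such as [(w1 - c / 2) ^+ 2]. The weight [4^-1] is chosen below 1
    so that the second term can be absorbed. *)
Lemma normr_le_sqrD (R : realType) (w1 w2 c s : R) :
  `|w1 * c + w2 * s| <= (w1 ^+ 2 + w2 ^+ 2) + 4^-1 * (c ^+ 2 + s ^+ 2).
Proof.
rewrite ler_norml; apply/andP; split.
  by have := sqr_ge0 (w1 + c / 2); have := sqr_ge0 (w2 + s / 2); lra.
by have := sqr_ge0 (w1 - c / 2); have := sqr_ge0 (w2 - s / 2); lra.
Qed.

(** [B <= A + B / 4] gives [B <= 4 / 3 * A], rounded up to 2. *)
Lemma absorb_quarter (R : realType) (A B D : R) :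
  B <= A + 4^-1 * D -> D <= B -> 0 <= A -> B <= 2 * A.
Proof. lra. Qed.

(** * Real-valued integrals *)

Section measure_helpers.
Context d (T : measurableType d) (R : realType) (mu : {measure set T -> \bar R}).
Implicit Types f g : T -> R.

Lemma rintegrable_le (D : set T) f g : measurable D -> measurable_fun D f ->
  (forall x, D x -> `|f x| <= g x) -> mu.-integrable D (EFin \o g) ->
  mu.-integrable D (EFin \o f).
Proof.
move=> mD mf fg; apply: le_integrable => //; first exact/measurable_EFinP.
move=> x Dx /=; rewrite lee_fin (le_trans (fg x Dx))//.
by rewrite ler_norm.
Qed.

Lemma rintegrable_ltyP f : measurable_fun setT f ->
  mu.-integrable setT (EFin \o f) <-> (\int[mu]_x `|f x|%:E < +oo)%E.
Proof.
move=> mf; split => [/integrableP[]//|fy].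
by apply/integrableP; split => //; exact/measurable_EFinP.
Qed.

Lemma Rintegral_EFin (D : set T) f : mu.-integrable D (EFin \o f) -> measurable D ->
  (\int[mu]_(x in D) f x)%:E = (\int[mu]_(x in D) (f x)%:E)%E.
Proof. by move=> fi mD; rewrite /Rintegral fineK//; exact: integrable_fin_num. Qed.

Lemma rintegrableD (D : set T) f g : measurable D -> mu.-integrable D (EFin \o f) ->
  mu.-integrable D (EFin \o g) -> mu.-integrable D (EFin \o (fun x => f x + g x)).
Proof.
move=> mD fi gi; have -> : EFin \o (fun x => f x + g x) = ((EFin \o f) \+ (EFin \o g))%E.
  by apply/funext => x /=; rewrite EFinD.
exact: integrableD.
Qed.

Lemma rintegrableB (D : set T) f g : measurable D -> mu.-integrable D (EFin \o f) ->
  mu.-integrable D (EFin \o g) -> mu.-integrable D (EFin \o (fun x => f x - g x)).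
Proof.
move=> mD fi gi; have -> : EFin \o (fun x => f x - g x) = ((EFin \o f) \- (EFin \o g))%E.
  by apply/funext => x /=; rewrite EFinB.
exact: integrableB.
Qed.

Lemma rintegrableZ (D : set T) (k : R) f : measurable D -> mu.-integrable D (EFin \o f) ->
  mu.-integrable D (EFin \o (fun x => k * f x)).
Proof.
move=> mD fi; have -> : EFin \o (fun x => k * f x) = (fun x => k%:E * (EFin \o f) x)%E.
  by apply/funext => x /=; rewrite EFinM.
exact: integrableZl.
Qed.

Lemma rintegrable_norm (D : set T) f : measurable D -> mu.-integrable D (EFin \o f) ->
  mu.-integrable D (EFin \o (fun x => `|f x|)).
Proof. by move=> mD fi; have := integrable_abse fi. Qed.

Lemma rintegrable_measurable (D : set T) f : measurable D ->
  mu.-integrable D (EFin \o f) -> measurable_fun D f.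
Proof. by move=> mD /integrableP[/measurable_EFinP]. Qed.

Lemma integrable_sqP f : measurable_fun setT f ->
  mu.-integrable setT (EFin \o (fun x => f x ^+ 2)) <-> (\int[mu]_x (f x ^+ 2)%:E < +oo)%E.
Proof.
move=> mf; rewrite rintegrable_ltyP; last exact: measurable_funX.
by under eq_integral do rewrite ger0_norm ?sqr_ge0//.
Qed.

Lemma rintegrable_mul f g : measurable_fun setT f -> measurable_fun setT g ->
  mu.-integrable setT (EFin \o (fun x => f x ^+ 2)) ->
  mu.-integrable setT (EFin \o (fun x => g x ^+ 2)) ->
  mu.-integrable setT (EFin \o (fun x => f x * g x)).
Proof.
move=> mf mg f2 g2.
apply: (@rintegrable_le _ _ (fun x => f x ^+ 2 + g x ^+ 2)) => //.
- exact: measurable_funM.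
- move=> x _; rewrite normrM -(real_normK (num_real (f x))) -(real_normK (num_real (g x))).
  have := sqr_ge0 (`|f x| - `|g x|); have := sqr_ge0 (`|f x| + `|g x|); nra.
- exact: rintegrableD.
Qed.

End measure_helpers.

Section fubini_helpers.
Context d1 d2 (T1 : measurableType d1) (T2 : measurableType d2) (R : realType).
Variable m1 : {sigma_finite_measure set T1 -> \bar R}.
Variable m2 : {sigma_finite_measure set T2 -> \bar R}.
Implicit Types f : T1 * T2 -> R.

(** Tonelli applied to positive and negative parts gives measurability without any integrability:
    [Rintegral] is a total function, whatever value it takes on bad sections. *)
Lemma measurable_Rintegral_snd f : measurable_fun setT f ->
  measurable_fun setT (fun x => \int[m2]_y f (x, y)).
Proof.
move=> mf; rewrite /Rintegral; apply: measurableT_comp => //.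
have mF : measurable_fun setT (EFin \o f) by exact/measurable_EFinP.
rewrite [X in measurable_fun _ X](_ : _ = (fun x =>
   \int[m2]_y (EFin \o f)^\+ (x, y) - \int[m2]_y (EFin \o f)^\- (x, y))%E); last first.
  apply/funext => x; rewrite integralE.
  by congr (_ - _)%E; apply: eq_integral => y _;
    rewrite -[RHS]/((_ \o pair x) y) -?funepos_comp -?funeneg_comp.
apply: emeasurable_funB.
  by apply: measurable_fun_fubini_tonelli_F => //; exact: measurable_funepos.
by apply: measurable_fun_fubini_tonelli_F => //; exact: measurable_funeneg.
Qed.

Lemma measurable_Rintegral_fst f : measurable_fun setT f ->
  measurable_fun setT (fun y => \int[m1]_x f (x, y)).
Proof.
move=> mf; rewrite /Rintegral; apply: measurableT_comp => //.
have mF : measurable_fun setT (EFin \o f) by exact/measurable_EFinP.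
rewrite [X in measurable_fun _ X](_ : _ = (fun y =>
   \int[m1]_x (EFin \o f)^\+ (x, y) - \int[m1]_x (EFin \o f)^\- (x, y))%E); last first.
  apply/funext => y; rewrite integralE.
  by congr (_ - _)%E; apply: eq_integral => x _;
    rewrite -[RHS]/((_ \o pair^~ y) x) -?funepos_comp -?funeneg_comp.
apply: emeasurable_funB.
  by apply: measurable_fun_fubini_tonelli_G => //; exact: measurable_funepos.
by apply: measurable_fun_fubini_tonelli_G => //; exact: measurable_funeneg.
Qed.

Lemma rintegrable_prod1 f (c : T1 -> R) : measurable_fun setT f ->
  (forall x, (\int[m2]_y `|f (x, y)|%:E <= (c x)%:E)%E) ->
  m1.-integrable setT (EFin \o c) -> (m1 \x m2)%E.-integrable setT (EFin \o f).
Proof.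
move=> mf fc ci.
have mF : measurable_fun setT (EFin \o f) by exact/measurable_EFinP.
apply/integrable12ltyP => //.
have /integrableP[mc] := ci.
apply: le_lt_trans; apply: ge0_le_integral => //.
- by move=> x _; exact: integral_ge0.
- apply: (@measurable_fun_fubini_tonelli_F _ _ _ _ _ _ (abse \o (EFin \o f))) => //.
    exact: measurableT_comp.
  by move=> z /=; rewrite lee_fin.
- exact: measurableT_comp.
- move=> x _ /=; apply: (le_trans (fc x)); rewrite lee_fin; exact: ler_norm.
Qed.

Lemma rintegrable_prod2 f (c : T2 -> R) : measurable_fun setT f ->
  (forall y, (\int[m1]_x `|f (x, y)|%:E <= (c y)%:E)%E) ->
  m2.-integrable setT (EFin \o c) -> (m1 \x m2)%E.-integrable setT (EFin \o f).
Proof.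
move=> mf fc ci.
have mF : measurable_fun setT (EFin \o f) by exact/measurable_EFinP.
apply/integrable21ltyP => //.
have /integrableP[mc] := ci.
apply: le_lt_trans; apply: ge0_le_integral => //.
- by move=> x _; exact: integral_ge0.
- apply: (@measurable_fun_fubini_tonelli_G _ _ _ _ _ _ (abse \o (EFin \o f))) => //.
    exact: measurableT_comp.
  by move=> z /=; rewrite lee_fin.
- exact: measurableT_comp.
- move=> x _ /=; apply: (le_trans (fc x)); rewrite lee_fin; exact: ler_norm.
Qed.

(** Sections are integrable only almost everywhere; on the exceptional null set [fine] may return a
    default value, so the inner integrals are compared almost everywhere. *)
Lemma Rintegral12 f : (m1 \x m2)%E.-integrable setT (EFin \o f) ->
  \int[m1]_x \int[m2]_y f (x, y) = \int[(m1 \x m2)%E]_z f z.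
Proof.
move=> fi; rewrite /Rintegral -integral12_prod_meas1//; congr fine.
apply: ae_eq_integral => //.
- apply/measurable_EFinP; apply: measurable_Rintegral_snd.
  exact: rintegrable_measurable fi.
- exact: (measurable_fubini_F fi).
- have := ae_integrable1 fi; apply: filterS => x fx _ /=.
  by rewrite fineK//; exact: integrable_fin_num.
Qed.

Lemma Rintegral21 f : (m1 \x m2)%E.-integrable setT (EFin \o f) ->
  \int[m2]_y \int[m1]_x f (x, y) = \int[(m1 \x m2)%E]_z f z.
Proof.
move=> fi; rewrite /Rintegral -integral21_prod_meas1//; congr fine.
apply: ae_eq_integral => //.
- apply/measurable_EFinP; apply: measurable_Rintegral_fst.
  exact: rintegrable_measurable fi.
- exact: (measurable_fubini_G fi).
- have := ae_integrable2 fi; apply: filterS => x fx _ /=.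
  by rewrite fineK//; exact: integrable_fin_num.
Qed.

Lemma RFubini f : (m1 \x m2)%E.-integrable setT (EFin \o f) ->
  \int[m1]_x \int[m2]_y f (x, y) = \int[m2]_y \int[m1]_x f (x, y).
Proof. by move=> fi; rewrite Rintegral12// Rintegral21. Qed.

Lemma rintegrable_fubini_F f : (m1 \x m2)%E.-integrable setT (EFin \o f) ->
  m1.-integrable setT (EFin \o (fun x => \int[m2]_y f (x, y))).
Proof.
move=> fi; have Fi := integrable_fubini_F fi.
have mf := rintegrable_measurable measurableT fi.
apply/integrableP; split.
  by apply/measurable_EFinP; exact: measurable_Rintegral_snd.
have /integrableP[mF] := Fi; apply: le_lt_trans; rewrite le_eqVlt; apply/orP; left; apply/eqP.
apply: ae_eq_integral => //.
- by apply: measurableT_comp => //; apply/measurable_EFinP; exact: measurable_Rintegral_snd.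
- exact: measurableT_comp.
- have := ae_integrable1 fi; apply: filterS => x fx _ /=.
  by rewrite -[LHS]/(`|(\int[m2]_y f (x, y))%:E|%E) Rintegral_EFin.
Qed.

Lemma rintegrable_tensor (f : T1 -> R) (g : T2 -> R) :
  m1.-integrable setT (EFin \o f) -> m2.-integrable setT (EFin \o g) ->
  (m1 \x m2)%E.-integrable setT (EFin \o (fun z => f z.1 * g z.2)).
Proof.
move=> fi gi.
apply: (@rintegrable_prod1 _ (fun x => (\int[m2]_y `|g y|) * `|f x|)).
- apply: measurable_funM.
    by apply: measurableT_comp => //; exact: (rintegrable_measurable measurableT fi).
  by apply: measurableT_comp => //; exact: (rintegrable_measurable measurableT gi).
- move=> x; under eq_integral do rewrite /= normrM EFinM.
  have gi' := rintegrable_norm measurableT gi.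
  rewrite ge0_integralZl//.
  + by rewrite EFinM (Rintegral_EFin gi')// muleC.
  + by have /integrableP[] := gi'.
- by apply: rintegrableZ => //; exact: rintegrable_norm.
Qed.

Lemma Rintegral_tensor (f : T1 -> R) (g : T2 -> R) :
  m1.-integrable setT (EFin \o f) -> m2.-integrable setT (EFin \o g) ->
  \int[(m1 \x m2)%E]_z (f z.1 * g z.2) = (\int[m1]_x f x) * \int[m2]_y g y.
Proof.
move=> fi gi; rewrite -Rintegral12; last exact: rintegrable_tensor.
rewrite /=; under eq_Rintegral do rewrite RintegralZl//.
by rewrite RintegralZr.
Qed.

End fubini_helpers.

(** * Gaussian integrals *)

Section real_line.
Context (R : realType).
Local Notation mu := (@lebesgue_measure R).

Lemma Rdominated_cvg d (T : measurableType d) (m : {measure set T -> \bar R})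
    (f_ : nat -> T -> R) (f g : T -> R) :
  (forall n, measurable_fun setT (f_ n)) ->
  (forall x, f_ n x @[n --> \oo] --> f x) ->
  (forall n x, `|f_ n x| <= g x) -> m.-integrable setT (EFin \o g) ->
  m.-integrable setT (EFin \o f) /\
  (\int[m]_x f_ n x @[n --> \oo] --> \int[m]_x f x).
Proof.
move=> mf cf fg gi.
have mf' n : measurable_fun setT (EFin \o f_ n) by exact/measurable_EFinP.
have cf' x : setT x -> ((EFin \o f_ n) x @[n --> \oo] --> (EFin \o f) x)%E.
  by move=> _; apply: cvg_EFin; [exact: nearW|exact: cf].
have fg' n x : setT x -> (`|(EFin \o f_ n) x| <= (EFin \o g) x)%E.
  by move=> _; rewrite lee_fin.
have [||fi _ h] := @dominated_convergence _ _ _ m _ measurableT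
  (fun n => EFin \o f_ n) (EFin \o f) (EFin \o g) mf' _ (aeW _ cf') gi.
- apply: emeasurable_fun_cvg cf' => n; exact: mf'.
- by apply/aeW => x n _; exact: fg'.
split => //.
by apply: fine_cvg; rewrite fineK; last exact: integrable_fin_num.
Qed.

Lemma edominated_cvg d (T : measurableType d) (m : {measure set T -> \bar R})
    (f_ : nat -> T -> R) (f g : T -> R) :
  (forall n, measurable_fun setT (f_ n)) ->
  (forall x, f_ n x @[n --> \oo] --> f x) ->
  (forall n x, `|f_ n x| <= g x) -> m.-integrable setT (EFin \o g) ->
  (\int[m]_x (f_ n x)%:E @[n --> \oo] --> \int[m]_x (f x)%:E)%E.
Proof.
move=> mf cf fg gi.
have mf' n : measurable_fun setT (EFin \o f_ n) by exact/measurable_EFinP.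
have cf' x : setT x -> ((EFin \o f_ n) x @[n --> \oo] --> (EFin \o f) x)%E.
  by move=> _; apply: cvg_EFin; [exact: nearW|exact: cf].
have fg' n x : setT x -> (`|(EFin \o f_ n) x| <= (EFin \o g) x)%E.
  by move=> _; rewrite lee_fin.
exact: (@dominated_cvg _ _ _ m _ _ (fun n => EFin \o f_ n) _ (EFin \o g)).
Qed.

Lemma cvg_mulVn (C : R) (u : nat -> R) :
  (forall n, (0 < n)%N -> `|u n| <= C / n%:R) -> u n @[n --> \oo] --> (0 : R).
Proof.
move=> uC; apply/cvgr0Pnorm_le => /= e e0.
have C0 : 0 <= C by have := uC 1%N isT; rewrite divr1; exact: le_trans.
near=> n.
have n0 : (0 < n)%N by near: n; exact: nbhs_infty_gt.
apply: (le_trans (uC n n0)); rewrite ler_pdivrMr ?ltr0n//.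
have : C / e <= n%:R by near: n; exact: nbhs_infty_ger.
by rewrite ler_pdivrMr// mulrC.
Unshelve. all: by end_near. Qed.

Lemma cvg_ltnat (x : R) : \forall n \near \oo, `|x| <= n%:R.
Proof. exact: nbhs_infty_ger. Qed.

(** On [[-n, n]] the integral is [F n - F (- n)], and the bound on [|F x| * |x|] makes this at most
    [2 * C / n]. Dominated convergence removes the truncation. *)
Lemma Rintegral_derive_eq0 (F f : R -> R) (C : R) :
  (forall x : R, is_derive x (1 : R) F (f x)) -> continuous f ->
  mu.-integrable setT (EFin \o f) ->
  (forall x, `|F x| * `|x| <= C) ->
  \int[mu]_x f x = 0.
Proof.
move=> dF cf fi FC.
pose f_ (n : nat) x := f x * \1_`[- n%:R, n%:R] x.
have [_ h] : mu.-integrable setT (EFin \o f) /\ (\int[mu]_x f_ n x @[n --> \oo] --> \int[mu]_x f x).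
  apply: (@Rdominated_cvg _ _ mu f_ f (fun x : R => `|f x|)).
  - by move=> n; apply: measurable_funM => //; exact: continuous_measurable_fun.
  - move=> x; apply: cvg_near_cst; near=> n.
    rewrite /f_ indicE mem_set ?mulr1//=.
    have xn : `|x| <= n%:R by near: n; exact: cvg_ltnat.
    by rewrite in_itv/= -ler_norml.
  - move=> n x; rewrite /f_ normrM ler_piMr// indicE.
    by case: (_ \in _); rewrite ?normr1 ?normr0.
  - exact: rintegrable_norm.
apply: (cvg_unique _ h) => //.
apply: (@cvg_mulVn (2 * C)) => n n0.
have nn : - n%:R < n%:R :> R by rewrite gtrN// ltr0n.
have -> : \int[mu]_x f_ n x = F n%:R - F (- n%:R).
  have -> : \int[mu]_x f_ n x = \int[mu]_(x in `[- n%:R, n%:R]) f x.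
    rewrite [RHS]Rintegral_mkcond; apply: eq_Rintegral => x _.
    by rewrite /f_ patchE indicE; case: (_ \in _); rewrite ?mulr1 ?mulr0.
  rewrite /Rintegral (@continuous_FTC2 _ _ F)//.
  - exact: continuous_subspaceT.
  - have cF x : {for x, continuous F}.
      by apply: differentiable_continuous; apply/derivable1_diffP; have [] := dF x.
    split.
    + by move=> x _; have [] := dF x.
    + by apply: cvg_at_right_filter; exact: cF.
    + by apply: cvg_at_left_filter; exact: cF.
  - by move=> x _; rewrite derive1E; have [_] := dF x.
have n0' : 0 < n%:R :> R by rewrite ltr0n.
rewrite ler_pdivlMr//; apply: (le_trans (ler_wpM2r (ltW n0') (ler_normB _ _))).
rewrite mulrDl mulr_natl mulr2n; apply: lerD.
  by have := FC n%:R; rewrite (ger0_norm (ltW n0')).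
by have := FC (- n%:R); rewrite normrN (ger0_norm (ltW n0')).
Unshelve. all: by end_near. Qed.

Lemma integral_shift (F : R -> R) (y : R) : continuous F -> (forall x, 0 <= F x) ->
  (\int[mu]_x (F (x - y))%:E = \int[mu]_x (F x)%:E)%E.
Proof.
move=> cF F0.
have dE (x : R) : is_derive x (1 : R) (fun x : R => x - y) 1.
  by apply: is_derive_eq; rewrite subr0.
have d1 : derive1 (fun x : R => x - y) = cst 1.
  by apply/funext => x; rewrite derive1E; apply: derive_val.
rewrite (@increasing_ge0_integration_by_substitutionT _ (fun x => x - y) F)//.
- by apply: eq_integral => x _; rewrite d1 !fctE /= mulr1.
- by move=> a b ab; rewrite ltrD2r.
- by rewrite d1 => x; exact: cvg_cst.
- by rewrite d1; exact: is_cvg_cst.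
- by rewrite d1; exact: is_cvg_cst.
- exact: cvg_addrr_Ny.
- exact: cvg_addrr.
Qed.

(** The Gaussian of total mass one that concentrates at 0 as [c] grows. It is also the Fourier
    transform of [e^(-pi w^2 / c^2)], so damping in frequency becomes averaging in time. *)
Definition gaussk (c u : R) := c * expR (- (pi * (c * u) ^+ 2)).

Lemma gaussk_ge0 (c u : R) : 0 <= c -> 0 <= gaussk c u.
Proof. by move=> c0; rewrite mulr_ge0// expR_ge0. Qed.

Lemma continuous_gaussk (c : R) : continuous (gaussk c).
Proof.
move=> x; apply: cvgM; first exact: cvg_cst.
apply: continuous_comp; last exact: continuous_expR.
apply: cvgN; apply: cvgM; first exact: cvg_cst.
apply: (@cvg_comp _ _ _ (fun u => c * u) (fun u => u ^+ 2)); last exact: sqr_continuous.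
by apply: cvgM; [exact: cvg_cst|exact: cvg_id].
Qed.

Lemma gaussk_normal_pdf (c y u : R) : 0 < c ->
  gaussk c (u - y) = normal_pdf y (c^-1 / Num.sqrt (2 * pi)) u.
Proof.
move=> c0; have p0 : 0 < 2 * pi :> R by rewrite mulr_gt0// pi_gt0.
have s0 : 0 < Num.sqrt (2 * pi) :> R by rewrite sqrtr_gt0.
have n0 : c^-1 / Num.sqrt (2 * pi) != 0.
  by rewrite mulf_neq0// ?invr_eq0 gt_eqF.
have s2 : Num.sqrt (2 * pi) ^+ 2 = 2 * pi :> R by rewrite sqr_sqrtr// ltW.
have pn : pi != 0 :> R by rewrite gt_eqF// pi_gt0.
rewrite normal_pdfE//; congr (_ * _).
  rewrite /normal_peak exprMn exprVn exprVn s2.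
  rewrite (_ : _ *+ 2 = (c^-1) ^+ 2); last first.
    rewrite mulr2n; move: pn; move: (@pi R) => P Pn; field; rewrite Pn gt_eqF//.
  by rewrite sqrtr_sqr ger0_norm ?invrK// invr_ge0 ltW.
rewrite /normal_fun; congr expR; rewrite exprMn exprMn !exprVn s2 mulr2n.
by move: pn; move: (@pi R) => P Pn; field; rewrite Pn gt_eqF//.
Qed.

Lemma integral_gaussk (c y : R) : 0 < c -> (\int[mu]_u (gaussk c (u - y))%:E = 1)%E.
Proof.
move=> c0; under eq_integral do rewrite gaussk_normal_pdf//.
exact: integral_normal_pdf.
Qed.

Lemma integrable_gaussk (c y : R) : 0 < c ->
  mu.-integrable setT (EFin \o (fun u => gaussk c (u - y))).
Proof.
move=> c0; rewrite (_ : _ \o _ = (fun u => (normal_pdf y (c^-1 / Num.sqrt (2 * pi)) u)%:E)).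
  exact: integrable_normal_pdf.
by apply/funext => u /=; rewrite gaussk_normal_pdf.
Qed.

Lemma expR_sq_gaussk (a x : R) : 0 < a ->
  expR (- (a * x ^+ 2)) = (Num.sqrt (a / pi))^-1 * gaussk (Num.sqrt (a / pi)) x.
Proof.
move=> a0; have p0 := pi_gt0 R.
have s0 : 0 < Num.sqrt (a / pi) by rewrite sqrtr_gt0 divr_gt0.
rewrite /gaussk mulKf ?gt_eqF//; congr expR; rewrite exprMn sqr_sqrtr ?divr_ge0 ?ltW//.
move: p0; move: (@pi R) => P p0; field; rewrite gt_eqF//.
Qed.

Lemma integrable_expR_sq (a y : R) : 0 < a ->
  mu.-integrable setT (EFin \o (fun x => expR (- (a * (x - y) ^+ 2)))).
Proof.
move=> a0; rewrite (_ : _ \o _ = EFin \o (fun x => (Num.sqrt (a / pi))^-1 * gaussk (Num.sqrt (a / pi)) (x - y))).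
  by apply: rintegrableZ => //; apply: integrable_gaussk; rewrite sqrtr_gt0 divr_gt0// pi_gt0.
by apply/funext => x /=; rewrite expR_sq_gaussk.
Qed.

Lemma integral_expR_sq (a y : R) : 0 < a ->
  (\int[mu]_x (expR (- (a * (x - y) ^+ 2)))%:E = ((Num.sqrt (a / pi))^-1)%:E)%E.
Proof.
move=> a0; under eq_integral do rewrite expR_sq_gaussk// EFinM.
have s0 : 0 < Num.sqrt (a / pi) by rewrite sqrtr_gt0 divr_gt0// pi_gt0.
rewrite integralZl//=; last exact: integrable_gaussk.
by rewrite integral_gaussk// mule1.
Qed.

(** Half of the Gaussian absorbs the linear exponent: with [t = |x|], the gap between the two
    exponents is the square [(a * t - c) ^+ 2 / (2 * a)]. *)
Lemma expR_lin_sq (a c : R) : 0 < a ->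
  forall x : R, expR (c * `|x|) * expR (- (a * x ^+ 2)) <=
    expR (c ^+ 2 / (2 * a)) * expR (- (a / 2 * x ^+ 2)).
Proof.
move=> a0 x; rewrite -!expRD ler_expR -(real_normK (num_real x)).
set t := `|x|; rewrite -subr_ge0.
have -> : c ^+ 2 / (2 * a) - a / 2 * t ^+ 2 - (c * t - a * t ^+ 2) = (a * t - c) ^+ 2 / (2 * a).
  by field; rewrite gt_eqF.
by rewrite divr_ge0 ?sqr_ge0// mulr_ge0// ltW.
Qed.

(** Induction on the Horner form: each further factor [x] raises the rate by one, since
    [|x| <= e^|x|]. *)
Lemma poly_expR_bound (p : {poly R}) :
  exists C c : R, [/\ 0 <= C, 0 <= c & forall x : R, `|p.[x]| <= C * expR (c * `|x|)].
Proof.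
elim/poly_ind: p => [|p a [C [c [C0 c0 Cc]]]].
  by exists 0, 0; split=> // x; rewrite horner0 normr0 mul0r.
exists (C + `|a|), (c + 1); split; rewrite ?addr_ge0// => x.
rewrite hornerMXaddC (le_trans (ler_normD _ _))// mulrDl; apply: lerD.
  rewrite normrM mulrDl mul1r expRD mulrA; apply: ler_pM => //.
  by rewrite (le_trans _ (expR_ge1Dx _))// lerDr.
rewrite ler_peMr// -expR0 ler_expR mulr_ge0// addr_ge0//.
Qed.

Lemma poly_gauss_bound (p : {poly R}) (a : R) : 0 < a ->
  exists C : R, 0 <= C /\ forall x : R, `|p.[x]| * expR (- (a * x ^+ 2)) <= C * expR (- (a / 2 * x ^+ 2)).
Proof.
move=> a0; have [C [c [C0 c0 Cc]]] := poly_expR_bound p.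
exists (C * expR (c ^+ 2 / (2 * a))); split; first by rewrite mulr_ge0 ?expR_ge0.
move=> x; rewrite -mulrA; apply: le_trans (ler_wpM2l C0 (expR_lin_sq c a0 x)).
by rewrite [leRHS]mulrA; apply: ler_wpM2r; rewrite ?expR_ge0.
Qed.

Lemma continuous_expR_sq (a : R) : continuous (fun x : R => expR (- (a * x ^+ 2))).
Proof.
move=> x; apply: continuous_comp; last exact: continuous_expR.
apply: cvgN; apply: cvgM; first exact: cvg_cst.
exact: sqr_continuous.
Qed.

Lemma continuous_poly_gauss (p : {poly R}) (a : R) :
  continuous (fun x => p.[x] * expR (- (a * x ^+ 2))).
Proof.
by move=> x; apply: cvgM; [exact: continuous_horner|exact: continuous_expR_sq].
Qed.

Lemma integrable_poly_gauss (p : {poly R}) (a : R) : 0 < a ->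
  mu.-integrable setT (EFin \o (fun x => p.[x] * expR (- (a * x ^+ 2)))).
Proof.
move=> a0; have [C [C0 Cp]] := poly_gauss_bound p a0.
apply: (@rintegrable_le _ _ _ mu setT _ (fun x : R => C * expR (- (a / 2 * x ^+ 2)))) => //.
- by apply: continuous_measurable_fun; exact: continuous_poly_gauss.
- by move=> x _; rewrite normrM (ger0_norm (expR_ge0 _)).
- have := @integrable_expR_sq (a / 2) 0 (divr_gt0 a0 (ltr0n _ 2)).
  by under eq_fun do rewrite subr0; exact: rintegrableZ.
Qed.

Lemma is_derive_expR_sq (a x : R) :
  is_derive x (1 : R) (fun x : R => expR (- (a * x ^+ 2))) (- (2 * a * x) * expR (- (a * x ^+ 2))).
Proof.
apply: is_derive_eq.
rewrite /GRing.scale /=. 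
ring.
Qed.

Lemma is_derive_poly_gauss (p : {poly R}) (a x : R) :
  is_derive x (1 : R) (fun x : R => p.[x] * expR (- (a * x ^+ 2)))
    ((p^`() - (2 * a) *: ('X * p)).[x] * expR (- (a * x ^+ 2))).
Proof.
have dp := is_derive_poly p x.
have dg := is_derive_expR_sq a x.
have -> : (p^`() - (2 * a) *: ('X * p)).[x] * expR (- (a * x ^+ 2)) =
  p.[x] *: (- (2 * a * x) * expR (- (a * x ^+ 2))) + expR (- (a * x ^+ 2)) *: (p^`()).[x].
  by rewrite !hornerE /GRing.scale /=; ring.
exact: is_deriveM.
Qed.

Lemma Rintegral_poly_gauss_deriv (p : {poly R}) (a : R) : 0 < a ->
  \int[mu]_x ((p^`() - (2 * a) *: ('X * p)).[x] * expR (- (a * x ^+ 2))) = 0.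
Proof.
move=> a0; have [C [C0 Cp]] := poly_gauss_bound (p * 'X) a0.
apply: (@Rintegral_derive_eq0 (fun x : R => p.[x] * expR (- (a * x ^+ 2))) _ C).
- by move=> x; exact: is_derive_poly_gauss.
- exact: continuous_poly_gauss.
- exact: integrable_poly_gauss.
- move=> x; rewrite normrM (ger0_norm (expR_ge0 _)) mulrAC -normrM.
  have := Cp x; rewrite hornerM hornerX; move/le_trans; apply.
  by rewrite ler_piMr// -expR0 ler_expR oppr_le0 mulr_ge0 ?sqr_ge0// divr_ge0// ltW.
Qed.

Definition gauss_cos (c u : R) := \int[mu]_w (expR (- (pi / c ^+ 2 * w ^+ 2)) * cos (2 * pi * w * u)).

Let integrable_gc (p : {poly R}) (c u : R) (tr : R -> R) : 0 < c -> continuous tr ->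
  (forall x, `|tr x| <= 1) ->
  mu.-integrable setT (EFin \o (fun w : R => p.[w] * expR (- (pi / c ^+ 2 * w ^+ 2)) * tr (2 * pi * w * u))).
Proof.
move=> c0 ctr tr1.
have a0 : 0 < pi / c ^+ 2 :> R by rewrite divr_gt0 ?pi_gt0 ?exprn_gt0.
apply: (@rintegrable_le _ _ _ mu setT _ (fun w : R => `|p.[w] * expR (- (pi / c ^+ 2 * w ^+ 2))|)) => //.
- apply: continuous_measurable_fun => w; apply: cvgM; first exact: continuous_poly_gauss.
  apply: continuous_comp; last exact: ctr.
  apply: cvgM; last exact: cvg_cst.
  by apply: cvgM; [exact: cvg_cst|exact: cvg_id].
- by move=> w _; rewrite normrM ler_piMr.
- by apply: rintegrable_norm => //; exact: integrable_poly_gauss.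
Qed.

(* Integrating by parts in [w] turns the derivative in [u] into a linear ODE. *)
Lemma is_derive_gauss_cos (c u : R) : 0 < c ->
  is_derive u (1 : R) (gauss_cos c) (- (2 * pi * c ^+ 2 * u) * gauss_cos c u).
Proof.
move=> c0.
have a0 : 0 < pi / c ^+ 2 :> R by rewrite divr_gt0 ?pi_gt0 ?exprn_gt0.
pose E (w : R) := expR (- (pi / c ^+ 2 * w ^+ 2)).
pose g (u w : R) := E w * cos (2 * pi * w * u).
have dg (x w : R) : is_derive x (1 : R) (g ^~ w)
   (E w * (- (2 * pi * w) * sin (2 * pi * w * x))).
  by rewrite /g; apply: is_derive_eq; rewrite /GRing.scale/=; ring.
pose X2 : {poly R} := (2 * pi) *: 'X.
have X2E w : X2.[w] = 2 * pi * w by rewrite !hornerE.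
have ic (x : R) : mu.-integrable setT (EFin \o g x).
  have := @integrable_gc 1 c x cos c0 (@continuous_cos R) (@cos_max R).
  by under eq_fun do rewrite hornerE mul1r.
have isn (x : R) : mu.-integrable setT (EFin \o (fun w => 2 * pi * w * E w * sin (2 * pi * w * x))).
  have := @integrable_gc X2 c x sin c0 (@continuous_sin R) (@sin_max R).
  by under eq_fun do rewrite X2E.
have iG : mu.-integrable setT (EFin \o (fun w => `|2 * pi * w * E w|)).
  apply: rintegrable_norm => //; have := integrable_poly_gauss X2 a0.
  by under eq_fun do rewrite X2E.
have uI : `]u - 1, u + 1[%classic u by rewrite /= in_itv/= ltrBlDr ltrDl ltr01.
have dg1 x w : partial1of2 g x w = E w * (- (2 * pi * w) * sin (2 * pi * w * x)).
  by rewrite partial1of2E; apply: derive_val.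
have G_ub (x w : R) : `]u - 1, u + 1[%classic x -> setT w ->
    `|partial1of2 g x w| <= `|2 * pi * w * E w|.
  move=> _ _; rewrite dg1 mulNr mulrN normrN mulrA (mulrC (E w)) normrM.
  by rewrite ler_piMr// sin_max.
have dd := @derivable_under_integral _ _ _ mu g setT measurableT u (u - 1) (u + 1) uI
  (fun x _ => ic x) (fun x w _ _ => @ex_derive _ _ _ _ _ _ _ (dg x w)) _ (fun w => normr_ge0 _) iG G_ub.
have de := @differentiation_under_integral _ _ _ mu g setT measurableT u (u - 1) (u + 1) uI
  (fun x _ => ic x) (fun x w _ _ => @ex_derive _ _ _ _ _ _ _ (dg x w)) _ (fun w => normr_ge0 _) iG G_ub.
apply: DeriveDef; first exact: dd.
rewrite -derive1E de.
(* [f0] is the derivative in [w] of [E w * sin (2 * pi * w * u)]. Its vanishing integral expresses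
   the sine integral, which is the derivative in [u] up to sign, through [gauss_cos c u]. *)
pose f0 (w : R) := 2 * pi * u * g u w - c ^- 2 * (2 * pi * w * E w * sin (2 * pi * w * u)).
have key : \int[mu]_w f0 w = 0.
  have [C [C0 Cp]] := poly_gauss_bound 'X a0.
  have dF (w : R) : is_derive w (1 : R) (fun w : R => E w * sin (2 * pi * w * u)) (f0 w).
    have dE : is_derive w (1 : R) E _ := is_derive_expR_sq (pi / c ^+ 2) w.
    have ds : is_derive w (1 : R) (fun w : R => sin (2 * pi * w * u)) (2 * pi * u * cos (2 * pi * w * u)).
      by apply: is_derive_eq; rewrite /GRing.scale/=; move: (@pi R) => P; ring.
    have -> : f0 w = E w *: (2 * pi * u * cos (2 * pi * w * u)) +
        sin (2 * pi * w * u) *: (- (2 * (pi / c ^+ 2) * w) * expR (- (pi / c ^+ 2 * w ^+ 2))).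
      rewrite /f0 /g /GRing.scale/= -/(E w); ring.
    exact: is_deriveM.
  apply: (@Rintegral_derive_eq0 _ f0 C dF).
  - have cE : continuous E := @continuous_expR_sq (pi / c ^+ 2).
    have cl : continuous (fun w : R => 2 * pi * w * u).
      by move=> w; apply: cvgM; [apply: cvgM; [exact: cvg_cst|exact: cvg_id]|exact: cvg_cst].
    move=> w; apply: cvgB.
      apply: cvgM; first exact: cvg_cst.
      by apply: cvgM; [exact: cE|apply: continuous_comp; [exact: cl|exact: continuous_cos]].
    apply: cvgM; first exact: cvg_cst.
    apply: cvgM; last by apply: continuous_comp; [exact: cl|exact: continuous_sin].
    by apply: cvgM; [apply: cvgM; [exact: cvg_cst|exact: cvg_id]|exact: cE].
  - by apply: rintegrableB => //; apply: rintegrableZ.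
  - move=> w; rewrite normrM mulrAC -normrM.
    rewrite mulrAC -mulrA normrM -[leRHS]mulr1; apply: ler_pM => //; last exact: sin_max.
    rewrite mulrC (ger0_norm (expR_ge0 _)).
    have := Cp w; rewrite hornerX => /le_trans; apply.
    by rewrite ler_piMr// -expR0 ler_expR oppr_le0 mulr_ge0 ?sqr_ge0// divr_ge0// ltW.
rewrite /f0 RintegralB// in key; [|exact: rintegrableZ..].
rewrite !RintegralZl// in key.
under eq_Rintegral do rewrite dg1.
rewrite (_ : \int[mu]_w _ = - \int[mu]_w (2 * pi * w * E w * sin (2 * pi * w * u))); last first.
  by rewrite -mulN1r -RintegralZl//; apply: eq_Rintegral => w _; ring.
move: key; rewrite -/(gauss_cos c u).
move/eqP; rewrite subr_eq0 => /eqP key.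
set J := \int[mu]_w (2 * pi * w * E w * sin (2 * pi * w * u)) in key *.
have -> : J = c ^+ 2 * (c ^- 2 * J) by rewrite mulVKf// expf_neq0// gt_eqF.
by rewrite -key; ring.
Qed.

(** The linear equation satisfied by [gauss_cos c] has an explicit integrating factor: the product
    [h] has zero derivative, and its value at 0 is the plain Gaussian integral [c]. *)
Lemma gauss_cosE (c u : R) : 0 < c -> gauss_cos c u = gaussk c u.
Proof.
move=> c0.
pose h (u : R) := gauss_cos c u * expR (pi * c ^+ 2 * u ^+ 2).
have dh (x : R) : is_derive x (1 : R) h 0.
  have d1 := is_derive_gauss_cos x c0.
  have d2 : is_derive x (1 : R) (fun u : R => expR (pi * c ^+ 2 * u ^+ 2))
     (2 * pi * c ^+ 2 * x * expR (pi * c ^+ 2 * x ^+ 2)).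
    by apply: is_derive_eq; rewrite /GRing.scale/=; ring.
  apply: is_derive_eq; rewrite /GRing.scale/=; ring.
have h0 : h 0 = c.
  rewrite /h expr0n mulr0 expR0 mulr1 /gauss_cos.
  under eq_Rintegral do rewrite mulr0 cos0 mulr1.
  have a0 : 0 < pi / c ^+ 2 :> R by rewrite divr_gt0 ?pi_gt0 ?exprn_gt0.
  rewrite /Rintegral (_ : integral _ _ _ = ((Num.sqrt (pi / c ^+ 2 / pi))^-1)%:E); last first.
    rewrite -(integral_expR_sq 0 a0); apply: eq_integral => x _.
    by rewrite subr0.
  have := pi_gt0 R; move: (@pi R) => P P0 /=.
  rewrite (_ : P / c ^+ 2 / P = (c^-1) ^+ 2); last by field; rewrite !gt_eqF.
  by rewrite sqrtr_sqr ger0_norm ?invrK// invr_ge0 ltW.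
have := is_derive_0_is_cst u 0 dh; rewrite h0 /h => hu.
have -> : gaussk c u = gauss_cos c u * expR (pi * c ^+ 2 * u ^+ 2) * expR (- (pi * (c * u) ^+ 2)).
  by rewrite hu.
by rewrite -mulrA -expRD (_ : _ - _ = 0) ?expR0 ?mulr1//; ring.
Qed.

End real_line.

Section fatou_le.
Context d (T : measurableType d) (R : realType) (m : {measure set T -> \bar R}).

(** The bounds may depend on [n]: only their limit survives. This lets the right-hand side sharpen
    as the damping is removed. *)
Lemma fatou_le (f_ : nat -> T -> R) (f : T -> R) (M_ : nat -> \bar R) (M : \bar R) :
  (forall n, measurable_fun setT (f_ n)) -> measurable_fun setT f ->
  (forall n x, 0 <= f_ n x) ->
  {ae m, forall x, f_ n x @[n --> \oo] --> f x} ->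
  (forall n, \int[m]_x (f_ n x)%:E <= M_ n)%E -> (M_ n @[n --> \oo] --> M)%E ->
  (\int[m]_x (f x)%:E <= M)%E.
Proof.
move=> mf_ mf f0 cf fM cM.
have mf' n : measurable_fun setT (EFin \o f_ n) by exact/measurable_EFinP.
rewrite (ae_eq_integral (fun x => limn_einf (fun n => (f_ n x)%:E)))//.
- apply: (le_trans (fatou m measurableT mf' _)).
    by move=> n x _; rewrite lee_fin.
  rewrite limn_einf_lim -(cvg_lim _ cM)//.
  apply: lee_lim; first exact: is_cvg_einfs.
    by apply/cvg_ex; exists M.
  apply: nearW => n; apply: le_trans (fM n).
  by apply: ereal_inf_lbound => /=; exists n => //=.
- exact/measurable_EFinP.
- rewrite (_ : (fun x => _) = fun x => - limn_esup (fun n => - (f_ n x)%:E))%E.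
    apply: measurableT_comp => //; 
    apply: (@measurable_fun_limn_esup _ _ _ setT (fun n x => (- (f_ n x)%:E)%E)) => n.
    by apply: measurableT_comp => //; exact: mf'.
  by apply/funext => x; rewrite limn_esupN oppeK.
- move: cf; apply: filterS => x cx _.
  have : ((f_ n x)%:E @[n --> \oo] --> (f x)%:E)%E.
    by apply: cvg_EFin; [exact: nearW|exact: cx].
  by move/cvg_limn_einf_sup => [-> _].
Qed.

Lemma fatou_le_everywhere (f_ : nat -> T -> R) (f : T -> R) (M : \bar R) :
  (forall n, measurable_fun setT (f_ n)) -> measurable_fun setT f ->
  (forall n x, 0 <= f_ n x) ->
  (forall x, f_ n x @[n --> \oo] --> f x) ->
  (forall n, \int[m]_x (f_ n x)%:E <= M)%E -> (\int[m]_x (f x)%:E <= M)%E.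
Proof.
move=> mf_ mf f0 cf fM; apply: (@fatou_le f_ f (fun=> M)) => //.
- exact: aeW.
- exact: cvg_cst.
Qed.

End fatou_le.

(* A copy of [lebesgue_R2] that can carry its own sigma-finite instance, which
   the library's Fubini theorems require. *)
Definition leb2 (R : realType) :
  set (measurableTypeR R * measurableTypeR R)%type -> \bar R :=
  (@lebesgue_measure R \x @lebesgue_measure R)%E.

Arguments leb2 R : clear implicits.

HB.instance Definition _ (R : realType) :=
  Measure.copy (leb2 R) (@lebesgue_measure R \x @lebesgue_measure R)%E.

Fact leb2_sigma_finite (R : realType) : sigma_finite setT (leb2 R).
Proof.
have /sigma_finiteP[F [TF ndF Foo]] := sigma_finiteT (@lebesgue_measure R).
exists (fun n => F n `*` F n).
  rewrite -setXTT TF predeqE => -[x y]; split.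
    move=> [/= [n _ Fnx] [k _ Fky]]; exists (maxn n k) => //; split.
      by move: x Fnx; exact/subsetPset/ndF/leq_maxl.
    by move: y Fky; exact/subsetPset/ndF/leq_maxr.
  by move=> [n _ []/= ? ?]; split; exists n.
move=> k; have [mFk Fky] := Foo k; split; first exact: measurableX.
rewrite [ltLHS](product_measure1E (@lebesgue_measure R) (@lebesgue_measure R))//.
by rewrite lte_mul_pinfty// ge0_fin_numE.
Qed.

HB.instance Definition _ (R : realType) :=
  Measure_isSigmaFinite.Build _ _ _ (leb2 R) (leb2_sigma_finite R).

(** * Bessel inequalities for the short-time Fourier transform *)

Section bessel.
Context (R : realType).
Local Notation mu := (@lebesgue_measure R).
Local Notation mu2 := (leb2 R).

Lemma rintegrable_tensor2 (f g : R -> R) : mu.-integrable setT (EFin \o f) ->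
  mu.-integrable setT (EFin \o g) -> mu2.-integrable setT (EFin \o (fun z => f z.1 * g z.2)).
Proof. exact: rintegrable_tensor. Qed.

Lemma Rintegral_tensor2 (f g : R -> R) : mu.-integrable setT (EFin \o f) ->
  mu.-integrable setT (EFin \o g) ->
  \int[mu2]_z (f z.1 * g z.2) = (\int[mu]_x f x) * \int[mu]_x g x.
Proof. exact: Rintegral_tensor. Qed.

Definition fcos (f : R -> R) (w : R) : R := \int[mu]_t (cos (2 * pi * w * t) * f t).
Definition fsin (f : R -> R) (w : R) : R := \int[mu]_t (sin (2 * pi * w * t) * f t).

Lemma measurable_trig d (T : measurableType d) (g : T -> R) :
  measurable_fun setT g ->
  measurable_fun setT (fun x => cos (g x)) /\ measurable_fun setT (fun x => sin (g x)).
Proof.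
by move=> mg; split; apply: measurableT_comp => //;
  apply: continuous_measurable_fun; [exact: continuous_cos|exact: continuous_sin].
Qed.

Lemma measurable_cos_comp d (T : measurableType d) (g : T -> R) :
  measurable_fun setT g -> measurable_fun setT (fun x => cos (g x)).
Proof. by move=> /measurable_trig[]. Qed.

Lemma measurable_sin_comp d (T : measurableType d) (g : T -> R) :
  measurable_fun setT g -> measurable_fun setT (fun x => sin (g x)).
Proof. by move=> /measurable_trig[]. Qed.

Lemma measurable_cont_comp d (T : measurableType d) (h : R -> R) (g : T -> R) :
  continuous h -> measurable_fun setT g -> measurable_fun setT (fun x => h (g x)).
Proof. by move=> ch mg; apply: measurableT_comp => //; exact: continuous_measurable_fun. Qed.

(** The shift to [n.+1] keeps the width nonzero at [n = 0]. The cosine transform is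
    [gaussk n.+1%:R], and the damping factor increases to 1. *)
Definition damp (n : nat) (w : R) : R := expR (- (pi / n.+1%:R ^+ 2 * w ^+ 2)).

Lemma damp_ge0 n w : 0 <= damp n w. Proof. exact: expR_ge0. Qed.

Lemma damp_le1 n w : damp n w <= 1.
Proof.
by rewrite -expR0 ler_expR oppr_le0 mulr_ge0 ?sqr_ge0// divr_ge0 ?pi_ge0// sqr_ge0.
Qed.

Lemma continuous_damp n : continuous (damp n).
Proof. exact: continuous_expR_sq. Qed.

Lemma measurable_damp n : measurable_fun setT (damp n).
Proof. by apply: continuous_measurable_fun; exact: continuous_damp. Qed.

Lemma integrable_damp n : mu.-integrable setT (EFin \o damp n).
Proof.
have := @integrable_poly_gauss R 1 (pi / n.+1%:R ^+ 2).
under eq_fun do rewrite hornerE mul1r.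
by apply; rewrite divr_gt0 ?pi_gt0// exprn_gt0// ltr0n.
Qed.

Lemma cvg_damp w : damp n w @[n --> \oo] --> (1 : R).
Proof.
rewrite -(@expR0 R).
apply: continuous_cvg; first exact: continuous_expR.
apply: (@cvg_mulVn _ (pi * w ^+ 2)) => n n0.
rewrite normrN ger0_norm; last by rewrite mulr_ge0 ?sqr_ge0// divr_ge0 ?pi_ge0// sqr_ge0.
rewrite -mulrA (mulrC _ (w ^+ 2)) mulrA; apply: ler_wpM2l.
  by rewrite mulr_ge0 ?sqr_ge0// pi_ge0.
rewrite lef_pV2 ?posrE ?ltr0n// ?exprn_gt0 ?ltr0n// -natrX ler_nat.
by rewrite (leq_trans (leqnSn n))// leq_pmulr.
Qed.

Lemma integral_damp_cos n u :
  \int[mu]_w (damp n w * cos (2 * pi * w * u)) = gaussk n.+1%:R u.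
Proof. by rewrite -gauss_cosE// ltr0n. Qed.

Variable f : R -> R.
Hypothesis f1 : mu.-integrable setT (EFin \o f).
Hypothesis f2 : mu.-integrable setT (EFin \o (fun t => f t ^+ 2)).

Let mf : measurable_fun setT f.
Proof. exact: (rintegrable_measurable _ f1). Qed.

Lemma integrable_cosM w : mu.-integrable setT (EFin \o (fun t => cos (2 * pi * w * t) * f t)).
Proof.
apply: (@rintegrable_le _ _ _ mu setT _ (fun t : R => `|f t|)) => //.
- by apply: measurable_funM => //; apply: measurable_cos_comp; apply: measurable_funM.
- by move=> t _; rewrite normrM ler_piMl// cos_max.
- exact: rintegrable_norm.
Qed.

Lemma integrable_sinM w : mu.-integrable setT (EFin \o (fun t => sin (2 * pi * w * t) * f t)).
Proof.
apply: (@rintegrable_le _ _ _ mu setT _ (fun t : R => `|f t|)) => //.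
- by apply: measurable_funM => //; apply: measurable_sin_comp; apply: measurable_funM.
- by move=> t _; rewrite normrM ler_piMl// sin_max.
- exact: rintegrable_norm.
Qed.


(** Each square is an integral over the product space, and the addition formula for [cos] merges the
    two. The frequency then appears in one cosine, ready to be integrated out. *)
Lemma fcos_fsin_sqr w : fcos f w ^+ 2 + fsin f w ^+ 2 =
  \int[mu2]_z (f z.1 * f z.2 * cos (2 * pi * w * (z.1 - z.2))).
Proof.
have ic := integrable_cosM w; have is_ := integrable_sinM w.
rewrite !expr2 /fcos /fsin -!Rintegral_tensor2//.
have ic2 := rintegrable_tensor2 ic ic; have is2 := rintegrable_tensor2 is_ is_.
rewrite -RintegralD//.
apply: eq_Rintegral => z _; rewrite mulrBr cosB; ring.
Qed.

Lemma integrable_ff_gauss n :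
  mu2.-integrable setT (EFin \o (fun z => f z.1 ^+ 2 * gaussk n.+1%:R (z.1 - z.2))) /\
  \int[mu2]_z (f z.1 ^+ 2 * gaussk n.+1%:R (z.1 - z.2)) = \int[mu]_t (f t ^+ 2).
Proof.
have n0 : 0 < n.+1%:R :> R by rewrite ltr0n.
have g1 (x : R) : (\int[mu]_y (gaussk n.+1%:R (x - y))%:E = 1)%E.
  rewrite -(integral_gaussk x n0); apply: eq_integral => y _.
  by rewrite /gaussk -[in RHS]opprB mulrN sqrrN.
have ig (x : R) : mu.-integrable setT (EFin \o (fun y => gaussk n.+1%:R (x - y))).
  have := integrable_gaussk x n0; congr (mu.-integrable _ _).
  by apply/funext => y /=; rewrite /gaussk -[in RHS]opprB mulrN sqrrN.
have hi : mu2.-integrable setT (EFin \o (fun z => f z.1 ^+ 2 * gaussk n.+1%:R (z.1 - z.2))).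
  apply: (@rintegrable_prod1 _ _ _ _ _ mu mu _ (fun t => f t ^+ 2)) => //.
  - apply: measurable_funM; first by apply: measurable_funX; exact: measurableT_comp.
    apply: measurable_cont_comp; first exact: continuous_gaussk.
    exact: measurable_funB.
  - move=> x /=; under eq_integral do rewrite normrM (ger0_norm (sqr_ge0 _)) (ger0_norm (gaussk_ge0 _ (ltW n0))) EFinM.
    rewrite integralZl//; last exact: ig.
    by rewrite g1 mule1.
split => //.
rewrite -(@Rintegral12 _ _ _ _ _ mu mu)//; apply: eq_Rintegral => x _ /=.
have igx := ig x; rewrite RintegralZl//.
by rewrite /Rintegral g1 mulr1.
Qed.

Lemma integrable_ff_gauss2 n :
  mu2.-integrable setT (EFin \o (fun z => f z.2 ^+ 2 * gaussk n.+1%:R (z.1 - z.2))) /\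
  \int[mu2]_z (f z.2 ^+ 2 * gaussk n.+1%:R (z.1 - z.2)) = \int[mu]_t (f t ^+ 2).
Proof.
have n0 : 0 < n.+1%:R :> R by rewrite ltr0n.
have hi : mu2.-integrable setT (EFin \o (fun z => f z.2 ^+ 2 * gaussk n.+1%:R (z.1 - z.2))).
  apply: (@rintegrable_prod2 _ _ _ _ _ mu mu _ (fun t => f t ^+ 2)) => //.
  - apply: measurable_funM; first by apply: measurable_funX; exact: measurableT_comp.
    apply: measurable_cont_comp; first exact: continuous_gaussk.
    exact: measurable_funB.
  - move=> x /=; under eq_integral do rewrite normrM (ger0_norm (sqr_ge0 _)) (ger0_norm (gaussk_ge0 _ (ltW n0))) EFinM.
    have ig := integrable_gaussk x n0.
    by rewrite integralZl// integral_gaussk// mule1.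
split => //.
rewrite -(@Rintegral21 _ _ _ _ _ mu mu)//; apply: eq_Rintegral => x _ /=.
have ig := integrable_gaussk x n0.
by rewrite RintegralZl// /Rintegral integral_gaussk// mulr1.
Qed.

(** Damping makes the triple integral absolutely convergent, so the frequency can be integrated
    first; it turns the cosine into the Gaussian kernel. *)
Lemma damp_bessel n : \int[mu]_w (damp n w * (fcos f w ^+ 2 + fsin f w ^+ 2)) =
  \int[mu2]_z (f z.1 * f z.2 * gaussk n.+1%:R (z.1 - z.2)).
Proof.
pose h (p : R * (R * R)) := damp n p.1 * (f p.2.1 * f p.2.2 * cos (2 * pi * p.1 * (p.2.1 - p.2.2))).
have fi : mu2.-integrable setT (EFin \o (fun z => f z.1 * f z.2)) := rintegrable_tensor2 f1 f1.
have mh : measurable_fun setT h.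
  apply: measurable_funM; first by apply: measurableT_comp => //; exact: measurable_damp.
  apply: measurable_funM.
    by apply: measurable_funM; apply: measurableT_comp => //; exact: measurableT_comp.
  apply: measurable_cos_comp; apply: measurable_funM; first exact: measurable_funM.
  by apply: measurable_funB; exact: measurableT_comp.
have hi : (mu \x mu2)%E.-integrable setT (EFin \o h).
  have := rintegrable_norm measurableT (rintegrable_tensor (integrable_damp n) fi).
  apply: rintegrable_le => // p _.
  by rewrite /h mulrA normrM ler_piMr// cos_max.
have ffc w : mu2.-integrable setT (EFin \o (fun z => f z.1 * f z.2 * cos (2 * pi * w * (z.1 - z.2)))).
  have := rintegrable_norm measurableT fi.
  apply: rintegrable_le => //.
    apply: measurable_funM.
      by apply: measurable_funM; exact: measurableT_comp.
    by apply: measurable_cos_comp; apply: measurable_funM => //; exact: measurable_funB.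
  by move=> z _; rewrite normrM ler_piMr// cos_max.
transitivity (\int[mu]_w \int[mu2]_z h (w, z)).
  by apply: eq_Rintegral => w _; rewrite fcos_fsin_sqr -RintegralZl.
rewrite RFubini//; apply: eq_Rintegral => z _.
rewrite -integral_damp_cos -RintegralZl//; last first.
  apply: (rintegrable_le measurableT _ _ (integrable_damp n)).
    apply: measurable_funM; first exact: measurable_damp.
    by apply: measurable_cos_comp; apply: measurable_funM => //; exact: measurable_funM.
  by move=> w _; rewrite normrM (ger0_norm (damp_ge0 _ _)) ler_piMr ?damp_ge0// cos_max.
by apply: eq_Rintegral => w _; rewrite /h/= mulrCA.
Qed.

(** By AM-GM, [|f s * f t|] is at most half of [f s ^+ 2 + f t ^+ 2]. As the Gaussian has mass one
    in either variable, each half contributes half of the integral of [f ^+ 2]. *)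
Lemma damp_bessel_le n : \int[mu]_w (damp n w * (fcos f w ^+ 2 + fsin f w ^+ 2)) <=
  \int[mu]_t (f t ^+ 2).
Proof.
have n0 : 0 < n.+1%:R :> R by rewrite ltr0n.
rewrite damp_bessel; have [i1 e1] := integrable_ff_gauss n.
have [i2 e2] := integrable_ff_gauss2 n.
have i12 := rintegrableD measurableT i1 i2.
have i12' := rintegrableZ 2^-1 measurableT i12.
have le12 (z : R * R) : `|f z.1 * f z.2 * gaussk n.+1%:R (z.1 - z.2)| <=
  2^-1 * (f z.1 ^+ 2 * gaussk n.+1%:R (z.1 - z.2) + f z.2 ^+ 2 * gaussk n.+1%:R (z.1 - z.2)).
  rewrite normrM (ger0_norm (gaussk_ge0 _ (ltW n0))) -mulrDl [leRHS]mulrA.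
  apply: ler_wpM2r; first exact: gaussk_ge0 (ltW n0).
  rewrite normrM -(real_normK (num_real (f z.1))) -(real_normK (num_real (f z.2))).
  by have := sqr_ge0 (`|f z.1| - `|f z.2|); lra.
apply: le_trans (_ : 2^-1 * (\int[mu2]_z (f z.1 ^+ 2 * gaussk n.+1%:R (z.1 - z.2)) +
   \int[mu2]_z (f z.2 ^+ 2 * gaussk n.+1%:R (z.1 - z.2))) <= _); last first.
  rewrite e1 e2; have H (A : R) : 2^-1 * (A + A) <= A by lra.
  exact: H.
rewrite -RintegralD// -RintegralZl//.
apply: le_Rintegral => //.
  apply: (rintegrable_le measurableT _ _ i12') => //.
  apply: measurable_funM; first by apply: measurable_funM; exact: measurableT_comp.
  apply: measurable_cont_comp; first exact: continuous_gaussk.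
  exact: measurable_funB.
by move=> z _; apply: le_trans (le12 z); rewrite ler_norm.
Qed.

Lemma measurable_fcos : measurable_fun setT (fcos f).
Proof.
apply: (@measurable_Rintegral_snd _ _ _ _ _ mu (fun p : R * R => cos (2 * pi * p.1 * p.2) * f p.2)).
apply: measurable_funM; last exact: measurableT_comp.
by apply: measurable_cos_comp; apply: measurable_funM => //; exact: measurable_funM.
Qed.

Lemma measurable_fsin : measurable_fun setT (fsin f).
Proof.
apply: (@measurable_Rintegral_snd _ _ _ _ _ mu (fun p : R * R => sin (2 * pi * p.1 * p.2) * f p.2)).
apply: measurable_funM; last exact: measurableT_comp.
by apply: measurable_sin_comp; apply: measurable_funM => //; exact: measurable_funM.
Qed.

Lemma bessel : (\int[mu]_w (fcos f w ^+ 2 + fsin f w ^+ 2)%:E <= (\int[mu]_t (f t ^+ 2))%:E)%E.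
Proof.
have mB : measurable_fun setT (fun w => fcos f w ^+ 2 + fsin f w ^+ 2).
  apply: measurable_funD; apply: measurable_funX; [exact: measurable_fcos|exact: measurable_fsin].
apply: (@fatou_le_everywhere _ _ _ mu (fun n w => damp n w * (fcos f w ^+ 2 + fsin f w ^+ 2))) => //.
- by move=> n; apply: measurable_funM => //; exact: measurable_damp.
- by move=> n w; rewrite mulr_ge0 ?damp_ge0// addr_ge0 ?sqr_ge0.
- move=> w; rewrite -[X in _ --> X]mul1r; apply: cvgM; [exact: cvg_damp|exact: cvg_cst].
- move=> n; rewrite -Rintegral_EFin//; first by rewrite lee_fin; exact: damp_bessel_le.
  (* Each transform is bounded by the [L^1] norm of [f], so the damped integrand is dominated by a
     multiple of [damp n]. Integrability is what permits passing between real and extended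
     integrals. *)
  apply: (@rintegrable_le _ _ _ mu setT _ (fun w : R => ((\int[mu]_t `|f t|) ^+ 2 *+ 2) * damp n w)) => //.
  + by apply: measurable_funM => //; exact: measurable_damp.
  + move=> w _; rewrite mulrC normrM (ger0_norm (damp_ge0 _ _)).
    apply: ler_wpM2r; rewrite ?damp_ge0// ger0_norm ?addr_ge0 ?sqr_ge0// mulr2n.
    have b (g : R -> R) : (forall t, `|g t| <= 1) -> mu.-integrable setT (EFin \o (fun t => g t * f t)) ->
       (\int[mu]_t (g t * f t)) ^+ 2 <= (\int[mu]_t `|f t|) ^+ 2.
      move=> g1 ig; rewrite -(real_normK (num_real (\int[mu]_t (g t * f t)))).
      rewrite lerXn2r ?nnegrE ?normr_ge0//; first exact: Rintegral_ge0.
      apply: (le_trans (le_normr_Rintegral _ _)) => //.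
      apply: le_Rintegral => //; [exact: rintegrable_norm|exact: rintegrable_norm|].
      by move=> t _; rewrite normrM ler_piMl.
    apply: lerD; apply: b.
    * by move=> t; exact: cos_max.
    * exact: integrable_cosM.
    * by move=> t; exact: sin_max.
    * exact: integrable_sinM.
  + by apply: rintegrableZ => //; exact: integrable_damp.
Qed.

End bessel.

(** All that the inversion uses about the Hermite function. The integral conditions are stated for
    every translate, so no change of variables occurs later. The single constant [L] serves both for
    the [L^1] bound and for the reflected [L^2] bound. *)
Record window (R : realType) (psi : R -> R) (M L K : R) : Prop := Window {
  window_continuous : continuous psi ;
  window_bounded : forall x, `|psi x| <= M ;
  window_lipschitz : forall x y, `|psi x - psi y| <= K * `|x - y| ;
  window_unit : forall y, (\int[@lebesgue_measure R]_x (psi (x - y) ^+ 2)%:E = 1)%E ;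
  window_int : forall y, (\int[@lebesgue_measure R]_x `|psi (x - y)|%:E <= L%:E)%E ;
  window_reflected : forall x, (\int[@lebesgue_measure R]_t (psi (x - t) ^+ 2)%:E <= L%:E)%E
}.

Section stft.
Context (R : realType).
Local Notation mu := (@lebesgue_measure R).
Local Notation mu2 := (leb2 R).
Variables (psi : R -> R) (M L K : R).
Hypothesis wpsi : window psi M L K.

Lemma measurable_window : measurable_fun setT psi.
Proof. by apply: continuous_measurable_fun; exact: window_continuous wpsi. Qed.

Lemma measurable_window_comp d (T : measurableType d) (g : T -> R) :
  measurable_fun setT g -> measurable_fun setT (fun x => psi (g x)).
Proof. by move=> mg; apply: measurableT_comp => //; exact: measurable_window. Qed.

Lemma integrable_window y : mu.-integrable setT (EFin \o (fun x => psi (x - y))).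
Proof.
apply/rintegrable_ltyP; first by apply: measurable_window_comp; exact: measurable_funB.
by apply: le_lt_trans (window_int wpsi y) _; rewrite ltry.
Qed.

Lemma integrable_window_sq y : mu.-integrable setT (EFin \o (fun x => psi (x - y) ^+ 2)).
Proof.
apply/integrable_sqP; first by apply: measurable_window_comp; exact: measurable_funB.
by rewrite (window_unit wpsi) ltry.
Qed.

Lemma integrable_window_reflected x : mu.-integrable setT (EFin \o (fun t => psi (x - t) ^+ 2)).
Proof.
apply/integrable_sqP; first by apply: measurable_window_comp; exact: measurable_funB.
by apply: le_lt_trans (window_reflected wpsi x) _; rewrite ltry.
Qed.

Section stft_fun.
Variable g : R -> R.
Hypothesis mg : measurable_fun setT g.
Hypothesis g2 : mu.-integrable setT (EFin \o (fun t => g t ^+ 2)).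

Definition cstft (g : R -> R) (z : R * R) : R := fcos (fun t => psi (z.1 - t) * g t) z.2.
Definition sstft (g : R -> R) (z : R * R) : R := fsin (fun t => psi (z.1 - t) * g t) z.2.

Lemma integrable_localized x : mu.-integrable setT (EFin \o (fun t => psi (x - t) * g t)).
Proof.
apply: rintegrable_mul => //; last exact: integrable_window_reflected.
by apply: measurable_window_comp; exact: measurable_funB.
Qed.

Lemma integrable_localized_sq x :
  mu.-integrable setT (EFin \o (fun t => (psi (x - t) * g t) ^+ 2)).
Proof.
apply: (@rintegrable_le _ _ _ mu setT _ (fun t : R => M ^+ 2 * g t ^+ 2)) => //.
- apply: measurable_funX; apply: measurable_funM => //.
  by apply: measurable_window_comp; exact: measurable_funB.
- move=> t _; rewrite ger0_norm ?sqr_ge0// exprMn ler_wpM2r ?sqr_ge0//.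
  rewrite -(real_normK (num_real (psi _))) lerXn2r ?nnegrE ?normr_ge0//.
    exact: le_trans (normr_ge0 _) (window_bounded wpsi 0).
  exact: window_bounded wpsi _.
- exact: rintegrableZ.
Qed.

Lemma measurable_cstft : measurable_fun setT (cstft g).
Proof.
apply: (@measurable_Rintegral_snd _ _ _ _ _ mu
  (fun p : (R * R) * R => cos (2 * pi * p.1.2 * p.2) * (psi (p.1.1 - p.2) * g p.2))).
apply: measurable_funM.
  apply: measurable_cos_comp; apply: measurable_funM => //; apply: measurable_funM => //.
  exact: measurableT_comp.
apply: measurable_funM; last exact: measurableT_comp.
apply: measurable_window_comp; apply: measurable_funB => //; exact: measurableT_comp.
Qed.

Lemma measurable_sstft : measurable_fun setT (sstft g).
Proof.
apply: (@measurable_Rintegral_snd _ _ _ _ _ mu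
  (fun p : (R * R) * R => sin (2 * pi * p.1.2 * p.2) * (psi (p.1.1 - p.2) * g p.2))).
apply: measurable_funM.
  apply: measurable_sin_comp; apply: measurable_funM => //; apply: measurable_funM => //.
  exact: measurableT_comp.
apply: measurable_funM; last exact: measurableT_comp.
apply: measurable_window_comp; apply: measurable_funB => //; exact: measurableT_comp.
Qed.

(** For fixed [x], Bessel applies to [t |-> psi (x - t) * g t]. Tonelli then integrates over [x]
    first, where the unit norm of the window leaves [g t ^+ 2]. *)
Lemma stft_bessel :
  (\int[mu2]_z (cstft g z ^+ 2 + sstft g z ^+ 2)%:E <= (\int[mu]_t (g t ^+ 2))%:E)%E.
Proof.
have mC := measurable_cstft; have mS := measurable_sstft.
have mCS : measurable_fun setT (fun z => (cstft g z ^+ 2 + sstft g z ^+ 2)%:E).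
  by apply/measurable_EFinP; apply: measurable_funD; exact: measurable_funX.
rewrite (fubini_tonelli1 (m1 := mu) (m2 := mu))//; last first.
  by move=> z; rewrite lee_fin addr_ge0 ?sqr_ge0.
pose q (p : R * R) : R := (psi (p.1 - p.2) * g p.2) ^+ 2.
have mq : measurable_fun setT q.
  apply: measurable_funX; apply: measurable_funM; last exact: measurableT_comp.
  by apply: measurable_window_comp; exact: measurable_funB.
apply: (@le_trans _ _ (\int[mu]_x \int[mu]_t (q (x, t))%:E)%E).
  apply: ge0_le_integral => //.
  - by move=> x _; apply: integral_ge0 => w _; rewrite lee_fin addr_ge0 ?sqr_ge0.
  - apply: measurable_fun_fubini_tonelli_F => //.
    by move=> z; rewrite lee_fin addr_ge0 ?sqr_ge0.
  - apply: (@measurable_fun_fubini_tonelli_F _ _ _ _ _ mu (EFin \o q)); first exact/measurable_EFinP.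
    by move=> z; rewrite lee_fin sqr_ge0.
  - move=> x _; apply: le_trans (bessel (integrable_localized x) (integrable_localized_sq x)) _.
    by rewrite Rintegral_EFin//; exact: integrable_localized_sq.
have -> : (\int[mu]_x \int[mu]_t (q (x, t))%:E = \int[mu]_t \int[mu]_x (q (x, t))%:E)%E.
  apply: (@fubini_tonelli _ _ _ _ _ mu mu (EFin \o q)); first exact/measurable_EFinP.
  by move=> z; rewrite lee_fin sqr_ge0.
rewrite Rintegral_EFin//; apply: ge0_le_integral => //.
- by move=> x _; apply: integral_ge0 => w _; rewrite lee_fin sqr_ge0.
- apply: (@measurable_fun_fubini_tonelli_G _ _ _ _ _ mu (EFin \o q)); first exact/measurable_EFinP.
  by move=> z; rewrite lee_fin sqr_ge0.
- by apply/measurable_EFinP; exact: measurable_funX.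
- move=> t _; under eq_integral do rewrite /q/= exprMn mulrC EFinM.
  by rewrite integralZl//; [rewrite (window_unit wpsi) mule1|exact: integrable_window_sq].
Qed.

Lemma integrable_stft_sq :
  mu2.-integrable setT (EFin \o (fun z => cstft g z ^+ 2 + sstft g z ^+ 2)).
Proof.
have mC := measurable_cstft; have mS := measurable_sstft.
apply/rintegrable_ltyP; first by apply: measurable_funD; exact: measurable_funX.
apply: le_lt_trans (ltry (\int[mu]_t (g t ^+ 2))).
apply: le_trans stft_bessel; rewrite le_eqVlt; apply/orP; left; apply/eqP.
by apply: eq_integral => z _; rewrite ger0_norm// addr_ge0 ?sqr_ge0.
Qed.

Lemma Rintegral_stft_sq_le :
  \int[mu2]_z (cstft g z ^+ 2 + sstft g z ^+ 2) <= \int[mu]_t (g t ^+ 2).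
Proof.
rewrite -lee_fin Rintegral_EFin//; first exact: stft_bessel.
exact: integrable_stft_sq.
Qed.

End stft_fun.

(** * The adjoint Bessel inequality for synthesis from the plane *)

Section adjoint.
Variables W1 W2 : R * R -> R.
Hypothesis mW1 : measurable_fun setT W1.
Hypothesis mW2 : measurable_fun setT W2.

Definition synth (W1 W2 : R * R -> R) (y : R) (z : R * R) : R :=
  (cos (2 * pi * z.2 * y) * W1 z + sin (2 * pi * z.2 * y) * W2 z) * psi (z.1 - y).

Lemma measurable_synth2 : measurable_fun setT (fun p : R * (R * R) => synth W1 W2 p.1 p.2).
Proof.
apply: measurable_funM.
  have mc : measurable_fun setT (fun p : R * (R * R) => 2 * pi * p.2.2 * p.1).
    apply: measurable_funM => //; apply: measurable_funM => //; exact: measurableT_comp.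
  apply: measurable_funD; apply: measurable_funM.
  - exact: measurable_cos_comp.
  - exact: measurableT_comp.
  - exact: measurable_sin_comp.
  - exact: measurableT_comp.
apply: measurable_window_comp; apply: measurable_funB => //; exact: measurableT_comp.
Qed.

Lemma measurable_synth y : measurable_fun setT (synth W1 W2 y).
Proof. exact: (measurableT_comp measurable_synth2 (pair1_measurable y)). Qed.

Hypothesis W1i : mu2.-integrable setT (EFin \o (fun z => W1 z ^+ 2)).
Hypothesis W2i : mu2.-integrable setT (EFin \o (fun z => W2 z ^+ 2)).
Hypothesis Ji : forall y, mu2.-integrable setT (EFin \o synth W1 W2 y).

Let Tf y := \int[mu2]_z synth W1 W2 y z.
Let S y := \int[mu2]_z `|synth W1 W2 y z|.

Let mT : measurable_fun setT Tf.
Proof. exact: (@measurable_Rintegral_snd _ _ _ _ _ mu2 _ measurable_synth2). Qed.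

Let mS : measurable_fun setT S.
Proof.
apply: (@measurable_Rintegral_snd _ _ _ _ _ mu2 (fun p => `|synth W1 W2 p.1 p.2|)).
by apply: measurableT_comp => //; exact: measurable_synth2.
Qed.

(** Truncation by duality: on [E n] both [|y|] and the absolute integral [S y] are at most [n], so
    [g n] is bounded with bounded support and its pairing with the synthesis is absolutely
    integrable. As [S] is real valued, the sets [E n] exhaust the line. *)
Let E (n : nat) : set R := [set y | `|y| <= n%:R] `&` [set y | S y <= n%:R].

Let mE n : measurable (E n : set (measurableTypeR R)).
Proof.
apply: measurableI; rewrite -[X in measurable X]setTI.
  by apply: measurable_fun_le => //; exact: measurableT_comp.
by apply: measurable_fun_le => //; exact: mS.
Qed.

Let g n y := Tf y * \1_(E n) y.

Let mg n : measurable_fun setT (g n).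
Proof. by apply: measurable_funM; [exact: mT|apply: measurable_indic; exact: mE]. Qed.

Let TS y : `|Tf y| <= S y.
Proof. exact: le_normr_Rintegral. Qed.

Let box (n : nat) (y : R) : R := \1_(`[- n%:R, n%:R]%classic : set R) y.

Let boxi n : mu.-integrable setT (EFin \o box n).
Proof.
apply/rintegrable_ltyP; first exact: measurable_indic.
under eq_integral do rewrite ger0_norm ?indicE//.
by rewrite integral_indic//= setIT lebesgue_measure_itv/=; case: ifP => _; rewrite -?EFinD ltry.
Qed.

Let Ebox n y : \1_(E n) y <= box n y.
Proof.
rewrite /box !indicE; have [|_] := boolP (y \in E n) => //.
by rewrite inE => -[/= yn _]; rewrite mem_set//= in_itv/= -ler_norml.
Qed.

Let g_le n y : `|g n y| <= n%:R * box n y.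
Proof.
rewrite /g normrM (ger0_norm (_ : 0 <= \1_(E n) y)) ?indicE//.
have [yE|_] := boolP (y \in E n); last first.
  by rewrite mulr0 mulr_ge0// /box indicE.
rewrite mulr1; have := Ebox n y; rewrite indicE yE => b1.
move: yE; rewrite inE => -[_ /= Sn].
by apply: le_trans (le_trans (TS y) Sn) _; rewrite ler_peMr.
Qed.

Let g2i n : mu.-integrable setT (EFin \o (fun y => g n y ^+ 2)).
Proof.
apply: (@rintegrable_le _ _ _ mu setT _ (fun y : R => n%:R ^+ 2 * box n y)) => //.
- by apply: measurable_funX; exact: mg.
- move=> y _; rewrite ger0_norm ?sqr_ge0// -(real_normK (num_real (g n y))).
  apply: le_trans (_ : (n%:R * box n y) ^+ 2 <= _); first by rewrite lerXn2r ?nnegrE ?mulr_ge0// /box indicE.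
  by rewrite exprMn /box indicE; case: (_ \in _); rewrite ?expr1n ?expr0n.
- exact: rintegrableZ.
Qed.

Let hn n (p : R * (R * R)) := g n p.1 * synth W1 W2 p.1 p.2.

Let hi n : (mu \x mu2)%E.-integrable setT (EFin \o hn n).
Proof.
apply: (@rintegrable_prod1 _ _ _ _ _ mu mu2 _ (fun y => n%:R ^+ 2 * box n y)).
- apply: measurable_funM; [exact: measurableT_comp|exact: measurable_synth2].
- move=> y; rewrite /hn/=.
  under eq_integral do rewrite normrM EFinM.
  rewrite integralZl//; last by apply: rintegrable_norm.
  rewrite -Rintegral_EFin//; last by apply: rintegrable_norm.
  rewrite -EFinM lee_fin -/(S y) /g normrM (ger0_norm (_ : 0 <= \1_(E n) y)) ?indicE//.
  have [yE|_] := boolP (y \in E n); last by rewrite mulr0 mul0r mulr_ge0// /box indicE.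
  have := Ebox n y; rewrite indicE yE => b1.
  move: yE; rewrite inE mulr1 expr2 -mulrA => -[_ /= Sn].
  have S0 : 0 <= S y by apply: Rintegral_ge0.
  apply: ler_pM => //; first exact: le_trans Sn.
  by apply: le_trans Sn _; rewrite ler_peMr.
- exact: rintegrableZ.
Qed.

(* [\int g^2] is the pairing of [(W1, W2)] with the transform of [g]; by AM-GM
   and Bessel it is at most [\int (W1^2 + W2^2) + 4^-1 \int g^2]. *)
Lemma adjoint_step n : \int[mu]_y (g n y ^+ 2) <=
  2 * \int[mu2]_z (W1 z ^+ 2 + W2 z ^+ 2).
Proof.
have eg : \int[mu]_y (g n y ^+ 2) = \int[mu]_y \int[mu2]_z hn n (y, z).
  apply: eq_Rintegral => y _; rewrite /hn/= RintegralZl//.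
  rewrite -/(Tf y) /g expr2 indicE; case: (_ \in _); rewrite ?mulr1 ?mulr0 ?mul0r//.
have e z : \int[mu]_y hn n (y, z) = W1 z * cstft (g n) z + W2 z * sstft (g n) z.
  have l1 := integrable_localized (mg n) (g2i n) z.1.
  have ic := integrable_cosM l1 z.2; have is_ := integrable_sinM l1 z.2.
  rewrite /cstft /sstft /fcos /fsin -!RintegralZl// -RintegralD//; [|exact: rintegrableZ..].
  by apply: eq_Rintegral => y _; rewrite /hn /synth/=; ring.
have {}eg : \int[mu]_y (g n y ^+ 2) = \int[mu2]_z (W1 z * cstft (g n) z + W2 z * sstft (g n) z).
  by rewrite eg RFubini//; apply: eq_Rintegral => z _; exact: e.
have CSi := integrable_stft_sq (mg n) (g2i n).
have CSle := Rintegral_stft_sq_le (mg n) (g2i n).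
have Wi := rintegrableD measurableT W1i W2i.
have CSi4 := rintegrableZ 4^-1 measurableT CSi.
have le1 : \int[mu]_y (g n y ^+ 2) <= \int[mu2]_z (W1 z ^+ 2 + W2 z ^+ 2) +
    4^-1 * \int[mu2]_z (cstft (g n) z ^+ 2 + sstft (g n) z ^+ 2).
  rewrite eg -RintegralZl// -RintegralD//.
  have Wi4 := rintegrableD measurableT Wi CSi4.
  apply: le_Rintegral => //.
    apply: (rintegrable_le measurableT _ _ Wi4) => //.
      by apply: measurable_funD; apply: measurable_funM => //; [exact: measurable_cstft|exact: measurable_sstft].
    by move=> z _; exact: normr_le_sqrD.
  by move=> z _; apply: le_trans (ler_norm _) (normr_le_sqrD _ _ _ _).
have A0 : 0 <= \int[mu2]_z (W1 z ^+ 2 + W2 z ^+ 2) by apply: Rintegral_ge0 => z _; rewrite addr_ge0 ?sqr_ge0.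
exact: absorb_quarter le1 CSle A0.
Qed.

(** The bound for the truncations does not depend on [n], so Fatou carries it to the untruncated
    synthesis. That the latter is square integrable is part of the conclusion. *)
Lemma adjoint_bessel :
  (\int[mu]_y (Tf y ^+ 2)%:E <= (2 * \int[mu2]_z (W1 z ^+ 2 + W2 z ^+ 2))%:E)%E.
Proof.
apply: (@fatou_le_everywhere _ _ _ mu (fun n y => g n y ^+ 2)) => //.
- by move=> n; apply: measurable_funX; exact: mg.
- by apply: measurable_funX; exact: mT.
- by move=> n y; exact: sqr_ge0.
- move=> y; apply: cvg_near_cst; near=> n.
  rewrite /g indicE mem_set ?mulr1//; split => /=.
    by near: n; exact: cvg_ltnat.
  apply: (le_trans (ler_norm _)); near: n; exact: cvg_ltnat.
- by move=> n; rewrite -Rintegral_EFin// lee_fin; exact: adjoint_step.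
Unshelve. all: by end_near. Qed.

End adjoint.
End stft.

(** * Reconstruction of a real component *)

Section layer_cake.
Context (R : realType).
Local Notation mu := (@lebesgue_measure R).

(* [e^(-pi u^2) = \int_(s >= |u|) layer s], the layer-cake form of the Gaussian. *)
Definition layer (s : R) : R := 2 * pi * s * expR (- (pi * s ^+ 2)) * \1_(`[0, +oo[%classic : set R) s.

Lemma layer_ge0 s : 0 <= layer s.
Proof.
rewrite /layer indicE; have [|_] := boolP (s \in _); last by rewrite mulr0.
rewrite inE/= in_itv/= andbT mulr1 => s0.
by rewrite mulr_ge0 ?expR_ge0// mulr_ge0// mulr_ge0// pi_ge0.
Qed.

Lemma measurable_layer : measurable_fun setT layer.
Proof.
apply: measurable_funM; last exact: measurable_indic.
apply: measurable_funM; first exact: measurable_funM.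
by apply: continuous_measurable_fun; exact: continuous_expR_sq.
Qed.

Lemma cvg_expR_sq : (- expR (- (pi * s ^+ 2))) @[s --> +oo%R] --> (0 : R).
Proof.
rewrite -oppr0; apply: cvgN.
apply: (@cvg_comp _ _ _ (fun s : R => pi * s ^+ 2) (fun x : R => expR (- x))); last exact: cvgr_expR.
rewrite (_ : (fun s : R => pi * s ^+ 2) = fun s => s ^+ 2 * pi); last by apply/funext => s; exact: mulrC.
by apply: gt0_cvgMly; [exact: pi_gt0|exact: cvgr_expr2].
Qed.

Lemma integral_layer (a : R) : 0 <= a ->
  (\int[mu]_(s in `[a, +oo[) (layer s)%:E = (expR (- (pi * a ^+ 2)))%:E)%E.
Proof.
move=> a0.
transitivity (\int[mu]_(s in `[a, +oo[) (2 * pi * s * expR (- (pi * s ^+ 2)))%:E)%E.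
  apply: eq_integral => s; rewrite inE/= in_itv/= andbT => sa.
  by rewrite /layer indicE mem_set ?mulr1//= in_itv/= andbT (le_trans a0).
have dF (s : R) : is_derive s (1 : R) (fun s : R => - expR (- (pi * s ^+ 2))) (2 * pi * s * expR (- (pi * s ^+ 2))).
  have := is_deriveN (is_derive_expR_sq pi s); by rewrite mulNr opprK.
have cF : continuous (fun s : R => - expR (- (pi * s ^+ 2))).
  by move=> s; apply: cvgN; exact: continuous_expR_sq.
rewrite (@ge0_continuous_FTC2y R _ (fun s : R => - expR (- (pi * s ^+ 2))) a 0).
- by rewrite -EFinB sub0r opprK.
- by move=> s sa; rewrite !mulr_ge0 ?expR_ge0 ?pi_ge0// (le_trans a0).
- apply: continuous_subspaceT => s.
  apply: cvgM; last exact: continuous_expR_sq.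
  by apply: cvgM; [exact: cvg_cst|exact: cvg_id].
- exact: cvg_expR_sq.
- by move=> s _; have [] := dF s.
- by apply: cvg_at_right_filter; exact: cF.
- by move=> s _; rewrite derive1E; have [_] := dF s.
Qed.

(** Writes the Gaussian as a superposition of indicators of intervals. This reduces a Gaussian
    average to integrals over balls, which is all that a Lebesgue point controls. *)
Lemma gaussk_layer (c u : R) : 0 < c ->
  (\int[mu]_s (c * (layer s * \1_([set s | (`|c * u| <= s)%R] : set R) s))%:E = (gaussk c u)%:E)%E.
Proof.
move=> c0; under eq_integral do rewrite EFinM.
have ms : measurable [set s : R | `|c * u| <= s].
  have -> : [set s : R | `|c * u| <= s] = `[`|c * u|, +oo[%classic.
    by apply/seteqP; split => s /=; rewrite in_itv/= andbT.
  exact: measurable_itv.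
rewrite ge0_integralZl//; last 3 first.
- apply/measurable_EFinP; apply: measurable_funM; first exact: measurable_layer.
  exact: measurable_indic.
- by move=> s _; rewrite lee_fin mulr_ge0 ?layer_ge0// indicE.
- by rewrite lee_fin ltW.
rewrite /gaussk EFinM; congr (_ * _)%E.
rewrite -[in RHS](real_normK (num_real (c * u))) -integral_layer//.
rewrite [RHS]integral_mkcond; apply: eq_integral => s _.
rewrite patchE indicE.
have -> : (s \in [set s0 : R | `|c * u| <= s0]) = (s \in `[`|c * u|, +oo[%classic).
  by apply/idP/idP; rewrite !inE/= in_itv/= andbT.
by case: (_ \in _); rewrite ?mulr1 ?mulr0.
Qed.

Variables (g : R -> R) (y Mb : R).
Hypothesis mg : measurable_fun setT g.
Hypothesis g0 : forall t, 0 <= g t.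
Let B (r : R) := (\int[mu]_t (g t * \1_([set t | (`|t - y| <= r)%R] : set R) t)%:E)%E.
Hypothesis BM : forall r : R, 0 <= r -> (B r <= (Mb * r)%:E)%E.
Hypothesis Bs : forall e : R, 0 < e -> exists2 d : R, 0 < d & forall r : R, 0 <= r -> r < d -> (B r <= (e * r)%:E)%E.

Let B0 r : (0 <= B r)%E.
Proof. by apply: integral_ge0 => t _; rewrite lee_fin mulr_ge0// indic_ge0. Qed.

(** Tonelli exchanges the point [t] and the level [s]; the condition [|c * (t - y)| <= s] is a ball
    of radius [s / c]. *)
Let layered (c : R) : 0 < c -> (\int[mu]_t (g t * gaussk c (t - y))%:E =
  \int[mu]_s ((c * layer s)%:E * B (s / c)))%E.
Proof.
move=> c0.
pose h (p : R * R) := c * layer p.2 * (g p.1 * \1_([set p : R * R | `|c * (p.1 - y)| <= p.2]) p).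
have mset : measurable ([set p : R * R | `|c * (p.1 - y)| <= p.2] : set (measurableTypeR R * measurableTypeR R)).
  rewrite -[X in measurable X]setTI; apply: measurable_fun_le => //.
  by apply: measurableT_comp => //; apply: measurable_funM => //; exact: measurable_funB.
have mh : measurable_fun setT h.
  apply: measurable_funM.
    by apply: measurable_funM => //; apply: measurableT_comp => //; exact: measurable_layer.
  by apply: measurable_funM; [exact: measurableT_comp|exact: measurable_indic].
have h0 p : 0 <= h p by rewrite /h; apply: mulr_ge0; apply: mulr_ge0; rewrite ?indic_ge0 ?layer_ge0 ?(ltW c0).
transitivity (\int[mu]_t \int[mu]_s (h (t, s))%:E)%E.
  apply: eq_integral => t _; rewrite EFinM -gaussk_layer//.
  rewrite -ge0_integralZl//.
  - apply: eq_integral => s _; rewrite -EFinM /h/= !indicE; congr EFin.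
    rewrite (_ : ((t, s) \in _) = (s \in [set s : R | `|c * (t - y)| <= s])); last first.
      by apply/idP/idP; rewrite !inE.
    ring.
  - apply/measurable_EFinP; apply: measurable_funM => //; apply: measurable_funM; first exact: measurable_layer.
    apply: measurable_indic.
    have -> : [set s : R | `|c * (t - y)| <= s] = `[`|c * (t - y)|, +oo[%classic.
      by apply/seteqP; split => s /=; rewrite in_itv/= andbT.
    exact: measurable_itv.
  - by move=> s _; rewrite lee_fin; apply: mulr_ge0; [exact: ltW|apply: mulr_ge0; rewrite ?layer_ge0 ?indic_ge0].
  - by rewrite lee_fin.
rewrite (@fubini_tonelli _ _ _ _ _ mu mu (EFin \o h)); last 2 first.
- exact/measurable_EFinP.
- by move=> p; rewrite lee_fin.
apply: eq_integral => s _; rewrite /B -ge0_integralZl//.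
- apply: eq_integral => t _; rewrite -EFinM /h/= !indicE; congr EFin.
  rewrite (_ : ((t, s) \in _) = (t \in [set t : R | `|t - y| <= s / c]))//.
  by apply/idP/idP; rewrite !inE/= normrM (gtr0_norm c0) ler_pdivlMr// mulrC.
- apply/measurable_EFinP; apply: measurable_funM => //; apply: measurable_indic.
  rewrite -[X in measurable X]setTI; apply: measurable_fun_le => //.
  by apply: measurableT_comp => //; exact: measurable_funB.
- by move=> t _; rewrite lee_fin mulr_ge0// indicE.
- by rewrite lee_fin mulr_ge0 ?layer_ge0// ltW.
Qed.

Lemma layer_poly (p : {poly R}) : mu.-integrable setT (EFin \o (fun s => layer s * p.[s])).
Proof.
have := rintegrable_norm measurableT (integrable_poly_gauss ((2 * pi) *: 'X * p) (pi_gt0 R)).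
apply: rintegrable_le => //.
  apply: measurable_funM; first exact: measurable_layer.
  by apply: continuous_measurable_fun; exact: continuous_horner.
move=> s _; rewrite /layer /=.
have -> : ((2 * pi) *: 'X * p).[s] = 2 * pi * s * p.[s] by rewrite hornerM hornerZ hornerX.
set i := \1__ _; have i1 : `|i| <= 1 by rewrite /i indicE; case: (_ \in _); rewrite ?normr1 ?normr0.
rewrite (_ : 2 * pi * s * _ * i * p.[s] = 2 * pi * s * p.[s] * expR (- (pi * s ^+ 2)) * i); last by ring.
by rewrite normrM ler_piMr.
Qed.

Let mB : measurable_fun setT B.
Proof.
apply: (@measurable_fun_fubini_tonelli_G _ _ _ _ _ mu
  (EFin \o (fun p : R * R => g p.1 * \1_([set t : R | `|t - y| <= p.2]) p.1))).
  apply/measurable_EFinP; apply: measurable_funM; first exact: measurableT_comp.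
  rewrite (_ : (fun p : R * R => _) = \1_([set p : R * R | `|p.1 - y| <= p.2])).
    apply: measurable_indic; rewrite -[X in measurable X]setTI; apply: measurable_fun_le => //.
    by apply: measurableT_comp => //; exact: measurable_funB.
  by apply/funext => p /=; rewrite !indicE; congr (_%:R); congr nat_of_bool; apply/idP/idP; rewrite !inE.
by move=> p; rewrite lee_fin mulr_ge0// indicE.
Qed.

(** Radii below [d] are handled by the smallness of [B], the others by the linear bound
    [Mb * r <= Mb / d ^+ 2 * r ^+ 3]. Both bounds are monomials in [s / c], so after integration
    only the first and third moments of [layer] enter. *)
Lemma approx_identity (e : R) : 0 < e ->
  \forall n \near \oo, (\int[mu]_t (g t * gaussk n.+1%:R (t - y))%:E <= e%:E)%E.
Proof.
move=> e0.
have Mb0 : 0 <= Mb.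
  rewrite -[Mb]mulr1 -lee_fin; apply: le_trans (BM ler01).
  by apply: integral_ge0 => t _; rewrite lee_fin mulr_ge0// indicE.
pose k1 := \int[mu]_s (layer s * 'X.[s]); pose k3 := \int[mu]_s (layer s * ('X^3).[s]).
have k10 : 0 <= k1.
  apply: Rintegral_ge0 => s _; rewrite hornerX /layer indicE; have [|_] := boolP (s \in _); last by rewrite mulr0 mul0r.
  by rewrite inE/= in_itv/= andbT => s0; rewrite !mulr_ge0 ?expR_ge0 ?pi_ge0.
have k30 : 0 <= k3.
  apply: Rintegral_ge0 => s _; rewrite hornerXn /layer indicE; have [|_] := boolP (s \in _); last by rewrite mulr0 mul0r.
  by rewrite inE/= in_itv/= andbT => s0; rewrite !mulr_ge0 ?expR_ge0 ?pi_ge0 ?exprn_ge0.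
(* Makes the first-moment term at most [e / 2]; the [+ 1] avoids dividing by zero. *)
pose e1 := e / 2 / (k1 + 1).
have e10 : 0 < e1 by rewrite !divr_gt0// ltr_wpDl.
have [d d0 Bd] := Bs e10.
have d20 : 0 < d ^+ 2 by rewrite exprn_gt0.
near=> n.
set c : R := n.+1%:R; have c0 : 0 < c by rewrite ltr0n.
(* The factor [c] of the Gaussian times [(s / c) ^+ 3] leaves [s ^+ 3 / c ^+ 2]. *)
pose D := Mb / d ^+ 2 / c ^+ 2.
have D0 : 0 <= D by rewrite !divr_ge0 ?sqr_ge0.
have i1 := rintegrableZ e1 measurableT (layer_poly 'X).
have i3 := rintegrableZ D measurableT (layer_poly 'X^3).
have i13 := rintegrableD measurableT i1 i3.
rewrite layered//; apply: (@le_trans _ _ (\int[mu]_s (e1 * (layer s * 'X.[s]) + D * (layer s * ('X^3).[s])))%:E).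
  rewrite Rintegral_EFin//; apply: ge0_le_integral => //.
  - by move=> s _; apply: mule_ge0; [rewrite lee_fin mulr_ge0 ?layer_ge0 ?(ltW c0)|exact: B0].
  - apply: emeasurable_funM.
      by apply/measurable_EFinP; apply: measurable_funM => //; exact: measurable_layer.
    by apply: measurableT_comp; [exact: mB|exact: measurable_funM].
  - by case/integrableP: i13.
  - move=> s _; rewrite hornerX hornerXn.
    have [s0|s0] := ltP s 0.
      have -> : layer s = 0 by rewrite /layer indicE memNset ?mulr0//= in_itv/= andbT; apply/negP; rewrite -ltNge.
      by rewrite mulr0 mul0e !mul0r !mulr0 addr0.
    have sc0 : 0 <= s / c by rewrite divr_ge0// ltW.
    apply: (@le_trans _ _ ((c * layer s)%:E * (e1 * (s / c) + Mb / d ^+ 2 * (s / c) ^+ 3)%:E)%E).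
      apply: lee_wpmul2l; first by rewrite lee_fin mulr_ge0 ?layer_ge0// ltW.
      have [sd|sd] := ltP (s / c) d.
        apply: (le_trans (Bd _ sc0 sd)).
        by rewrite lee_fin lerDl mulr_ge0 ?exprn_ge0// divr_ge0// ltW.
      apply: (le_trans (BM sc0)).
      rewrite lee_fin -[leLHS]add0r lerD//; first by rewrite mulr_ge0// ltW.
      exact: mul_le_cube.
    rewrite -EFinM lee_fin le_eqVlt; apply/orP; left; apply/eqP.
    rewrite /D; field; rewrite !gt_eqF//.
rewrite RintegralD// !RintegralZl//; [|exact: layer_poly..].
rewrite -/k1 -/k3 lee_fin (splitr e); apply: lerD.
  rewrite /e1 mulrAC ler_pdivrMr ?ltr_wpDl// ler_wpM2l// ?divr_ge0 ?(ltW e0)//.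
  by rewrite lerDl.
(* With [n <= c ^+ 2], this choice of [n] brings the third-moment term below [e / 2]. *)
have : (2 * (Mb / d ^+ 2 * k3) / e) <= n%:R by near: n; exact: nbhs_infty_ger.
rewrite ler_pdivrMr// => h.
rewrite /D mulrAC ler_pdivrMr ?exprn_gt0//.
have : n%:R <= c ^+ 2 by rewrite /c -natrX ler_nat (leq_trans (leqnSn n))// leq_pmulr.
exact: le_half_mul (ltW e0) h.
Unshelve. all: by end_near. Qed.

End layer_cake.

Lemma oscillation_arith (R : realType) (e r D : R) :
  0 <= r * r -> 0 <= D -> r * (r * (D + 1)) <= r * (e / 4) ->
  2 * (e / 4 * r) + D * r * (2 * r) <= e * r.
Proof. nra. Qed.

Lemma damped_integrand_arith (R : realType) (A w G N : R) : 0 <= G -> G <= N -> `|w| <= 2 ->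
  `|A| * `|w| * G <= 2 * G + 2 * N * A ^+ 2.
Proof.
move=> G0 GN w2; rewrite -(real_normK (num_real A)); move: (`|A|) (normr_ge0 A) => u u0.
have h : u * `|w| * G <= 2 * u * G.
  by rewrite ler_wpM2r// mulrC ler_wpM2r.
have h2 : u * G <= G + N * u ^+ 2.
  have : u ^+ 2 * G <= u ^+ 2 * N by rewrite ler_wpM2l ?sqr_ge0.
  have : 0 <= (u - 1) ^+ 2 * G by rewrite mulr_ge0 ?sqr_ge0.
  have : 0 <= u ^+ 2 * G by rewrite mulr_ge0 ?sqr_ge0.
  nra.
lra.
Qed.

Lemma synth_kernel_bound (R : realType) (D P q c s x y : R) : 0 <= D ->
  `|c| <= 1 -> `|s| <= 1 ->
  `|D * (q * P) * (c * x + s * y)| <= (`|P| * D) * (2 * q ^+ 2 + x ^+ 2 + y ^+ 2).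
Proof.
move=> D0 c1 s1.
have h : `|c * x + s * y| <= `|x| + `|y|.
  by apply: le_trans (ler_normD _ _) _; rewrite !normrM; apply: lerD; rewrite ler_piMl.
rewrite !normrM (ger0_norm D0).
rewrite (_ : D * (_ * _) * _ = `|P| * D * (`|q| * `|c * x + s * y|)); last by ring.
rewrite ler_wpM2l ?mulr_ge0//; apply: (@le_trans _ _ (`|q| * (`|x| + `|y|))).
  by rewrite ler_wpM2l.
rewrite mulrDr -!normrM.
by have := normrM_le_sqrD q x; have := normrM_le_sqrD q y; lra.
Qed.

(** * Vanishing of the damped sine integral *)

Section odd_integral.
Context (R : realType).
Local Notation mu := (@lebesgue_measure R).

Lemma cvg_Rintegral_box (f : R -> R) : mu.-integrable setT (EFin \o f) ->
  \int[mu]_(x in `[- n%:R, n%:R]) f x @[n --> \oo] --> \int[mu]_x f x.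
Proof.
move=> fi; have mf := rintegrable_measurable measurableT fi.
pose f_ (n : nat) x := f x * \1_`[- n%:R, n%:R] x.
have [_] : mu.-integrable setT (EFin \o f) /\ (\int[mu]_x f_ n x @[n --> \oo] --> \int[mu]_x f x).
  apply: (@Rdominated_cvg R _ _ mu f_ f (fun x : R => `|f x|)).
  - by move=> n; apply: measurable_funM => //; exact: measurable_indic.
  - move=> x; apply: cvg_near_cst; near=> n.
    rewrite /f_ indicE mem_set ?mulr1//=.
    have xn : `|x| <= n%:R by near: n; exact: cvg_ltnat.
    by rewrite in_itv/= -ler_norml.
  - move=> n x; rewrite /f_ normrM ler_piMr// indicE.
    by case: (_ \in _); rewrite ?normr1 ?normr0.
  - exact: rintegrable_norm.
rewrite [X in X @ _ --> _](_ : _ = (fun n : nat => \int[mu]_(x in `[- n%:R, n%:R]) f x))//.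
apply/funext => n; rewrite [RHS]Rintegral_mkcond; apply: eq_Rintegral => x _.
by rewrite /f_ patchE indicE; case: (_ \in _); rewrite ?mulr1 ?mulr0.
Unshelve. all: by end_near. Qed.

Lemma Rintegral_odd (f : R -> R) : continuous f -> mu.-integrable setT (EFin \o f) ->
  (forall x, f (- x) = - f x) -> \int[mu]_x f x = 0.
Proof.
move=> cf fi fN.
suff c0 : \int[mu]_(x in `[- n%:R, n%:R]) f x @[n --> \oo] --> (0 : R).
  exact: (cvg_unique _ (cvg_Rintegral_box fi) c0).
rewrite [X in X @ _ --> _](_ : _ = fun=> 0); first exact: cvg_cst.
apply/funext => n.
have fin : mu.-integrable `[- n%:R, n%:R] (EFin \o f).
  by apply: integrableS fi => //; exact: measurable_itv.
have nn : - n%:R <= n%:R :> R by rewrite -subr_ge0 opprK addr_ge0.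
have := @integration_by_substitution_oppr R f (- n%:R) n%:R nn.
rewrite opprK => /(_ (continuous_subspaceT cf)) e.
set I := Rintegral _ _ _.
suff : I = - I by move: I => I; lra.
rewrite {1}/I /Rintegral e -/(Rintegral _ _ _).
rewrite -[RHS]mulN1r /I -RintegralZl//.
by apply: eq_Rintegral => x _; rewrite /= fN mulN1r.
Qed.

(** This is what eliminates the companion function [b] from the inversion formula. *)
Lemma integral_damp_sin n u : \int[mu]_w (damp n w * sin (2 * pi * w * u)) = 0.
Proof.
have cs : continuous (fun w : R => sin (2 * pi * w * u)).
  move=> w; apply: continuous_comp; last exact: continuous_sin.
  by apply: cvgM; [apply: cvgM; [exact: cvg_cst|exact: cvg_id]|exact: cvg_cst].
apply: Rintegral_odd.
- by move=> w; apply: cvgM; [exact: continuous_damp|exact: cs].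
- apply: (rintegrable_le measurableT _ _ (integrable_damp R n)).
    by apply: measurable_funM; [exact: measurable_damp|exact: continuous_measurable_fun].
  by move=> w _; rewrite normrM (ger0_norm (damp_ge0 _ _)) ler_piMr ?damp_ge0// sin_max.
- by move=> w; rewrite /damp sqrrN mulrN mulNr sinN mulrN.
Qed.

Lemma integrable_damp_cos n u : mu.-integrable setT (EFin \o (fun w => damp n w * cos (2 * pi * w * u))).
Proof.
apply: (rintegrable_le measurableT _ _ (integrable_damp R n)).
  apply: measurable_funM; first exact: measurable_damp.
  by apply: measurable_cos_comp; apply: measurable_funM => //; exact: measurable_funM.
by move=> w _; rewrite normrM (ger0_norm (damp_ge0 _ _)) ler_piMr ?damp_ge0// cos_max.
Qed.

Lemma integrable_damp_sin n u : mu.-integrable setT (EFin \o (fun w => damp n w * sin (2 * pi * w * u))).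
Proof.
apply: (rintegrable_le measurableT _ _ (integrable_damp R n)).
  apply: measurable_funM; first exact: measurable_damp.
  by apply: measurable_sin_comp; apply: measurable_funM => //; exact: measurable_funM.
by move=> w _; rewrite normrM (ger0_norm (damp_ge0 _ _)) ler_piMr ?damp_ge0// sin_max.
Qed.

End odd_integral.

Local Notation plane R := (measurableTypeR R * measurableTypeR R)%type.

(** * Damped inversion, pointwise reconstruction and the error over part of the plane *)

Section reconstruction.
Context (R : realType).
Local Notation mu := (@lebesgue_measure R).
Local Notation mu2 := (leb2 R).
Variables (psi : R -> R) (M L K : R).
Hypothesis wpsi : window psi M L K.
Variables a b : R -> R.
Hypotheses (ma : measurable_fun setT a) (mb : measurable_fun setT b).
Hypothesis a2 : mu.-integrable setT (EFin \o (fun t => a t ^+ 2)).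
Hypothesis b2 : mu.-integrable setT (EFin \o (fun t => b t ^+ 2)).

(* If [a], [b] are the same real component of [f] and of [I * f], these are that
   component of [V] and of [I * V], where
   [V = \int e^(- 2 pi I w t) psi(x - t) f(t) dt]. *)
Definition stft_re (z : R * R) : R := cstft psi a z - sstft psi b z.
Definition stft_im (z : R * R) : R := cstft psi b z + sstft psi a z.
Local Notation W1 := stft_re.
Local Notation W2 := stft_im.
Definition resynth (y : R) (z : R * R) : R := synth psi W1 W2 y z.
Local Notation H := resynth.

Lemma measurable_stft_re : measurable_fun setT W1.
Proof. by apply: measurable_funB; [exact: (measurable_cstft wpsi)|exact: (measurable_sstft wpsi)]. Qed.

Lemma measurable_stft_im : measurable_fun setT W2.
Proof. by apply: measurable_funD; [exact: (measurable_cstft wpsi)|exact: (measurable_sstft wpsi)]. Qed.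

Lemma measurable_resynth y : measurable_fun setT (H y).
Proof. exact: (measurable_synth wpsi measurable_stft_re measurable_stft_im). Qed.

Lemma integrable_stft_re_sq : mu2.-integrable setT (EFin \o (fun z => W1 z ^+ 2)).
Proof.
have i := rintegrableZ 2 measurableT (rintegrableD measurableT (integrable_stft_sq wpsi ma a2) (integrable_stft_sq wpsi mb b2)).
apply: (rintegrable_le measurableT _ _ i).
  by apply: measurable_funX; exact: measurable_stft_re.
move=> z _; rewrite ger0_norm ?sqr_ge0//.
by exact: sqrB_le4.
Qed.

Lemma integrable_stft_im_sq : mu2.-integrable setT (EFin \o (fun z => W2 z ^+ 2)).
Proof.
have i := rintegrableZ 2 measurableT (rintegrableD measurableT (integrable_stft_sq wpsi ma a2) (integrable_stft_sq wpsi mb b2)).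
apply: (rintegrable_le measurableT _ _ i).
  by apply: measurable_funX; exact: measurable_stft_im.
move=> z _; rewrite ger0_norm ?sqr_ge0//.
by exact: sqrD_le4.
Qed.

(** AM-GM bounds the localized integrand by [psi (x - t) ^+ 2 + g t ^+ 2], whose integral is bounded
    independently of [x]. Boundedness of the transform is what gives integrability of the synthesis
    over sets of finite measure. *)
Lemma stft_bounded : exists C : R, 0 <= C /\ forall y z, `|H y z| <= C * `|psi (z.1 - y)|.
Proof.
have bnd (tr : R -> R) (g : R -> R) (z : R * R) : measurable_fun setT tr -> (forall t, `|tr t| <= 1) ->
    measurable_fun setT g -> mu.-integrable setT (EFin \o (fun t => g t ^+ 2)) ->
    `|\int[mu]_t (tr t * (psi (z.1 - t) * g t))| <= L + \int[mu]_t (g t ^+ 2).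
  move=> mtr tr1 mg g2.
  have l1 := integrable_localized wpsi mg g2 z.1.
  have ir := integrable_window_reflected wpsi z.1.
  have itr : mu.-integrable setT (EFin \o (fun t => tr t * (psi (z.1 - t) * g t))).
    apply: (rintegrable_le measurableT _ _ (rintegrable_norm measurableT l1)).
      by apply: measurable_funM => //; exact: (rintegrable_measurable measurableT l1).
    by move=> t _; rewrite normrM ler_piMl.
  apply: le_trans (le_normr_Rintegral measurableT itr) _.
  apply: (@le_trans _ _ (\int[mu]_t (psi (z.1 - t) ^+ 2 + g t ^+ 2))).
    apply: le_Rintegral => //; [exact: rintegrable_norm|exact: rintegrableD|].
    move=> t _; apply: (@le_trans _ _ `|psi (z.1 - t) * g t|); first by rewrite normrM ler_piMl.
    exact: normrM_le_sqrD.
  rewrite RintegralD// lerD2r -lee_fin Rintegral_EFin//.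
  exact: window_reflected wpsi _.
pose A := L + \int[mu]_t (a t ^+ 2); pose B := L + \int[mu]_t (b t ^+ 2).
have mcos w : measurable_fun setT (fun t : R => cos (2 * pi * w * t)).
  by apply: measurable_cos_comp; apply: measurable_funM.
have msin w : measurable_fun setT (fun t : R => sin (2 * pi * w * t)).
  by apply: measurable_sin_comp; apply: measurable_funM.
exists (2 * (A + B)).
have bW (z : R * R) : `|W1 z| <= A + B /\ `|W2 z| <= A + B.
  split; rewrite /stft_re /stft_im.
    apply: le_trans (ler_normB _ _) _; apply: lerD; apply: bnd => // t; [exact: cos_max|exact: sin_max].
  rewrite (addrC A); apply: le_trans (ler_normD _ _) _; apply: lerD; apply: bnd => // t; [exact: cos_max|exact: sin_max].
split.
  by rewrite mulr_ge0//; apply: le_trans (proj1 (bW (0, 0))).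
move=> y z; rewrite /resynth /synth normrM; apply: ler_wpM2r => //.
have [b1 b2'] := bW z.
apply: le_trans (ler_normD _ _) _; rewrite [leRHS]mulr_natl [leRHS]mulr2n !normrM; apply: lerD.
  by apply: le_trans b1; rewrite ler_piMl// cos_max.
by apply: le_trans b2'; rewrite ler_piMl// sin_max.
Qed.

Lemma resynth_integrable_finite (A : set (plane R)) y :
  measurable A -> (mu2 A < +oo)%E -> mu2.-integrable A (EFin \o H y).
Proof.
move=> mA Afin; have [C [C0 HC]] := stft_bounded.
apply: (@rintegrable_le _ _ _ mu2 A _ (fun=> C * M)) => //.
- by apply: measurable_funTS; exact: measurable_resynth.
- by move=> z _; apply: le_trans (HC y z) _; rewrite ler_wpM2l// (window_bounded wpsi).
- apply/integrableP; split; first exact/measurable_EFinP.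
  by rewrite /= integral_cst// lte_mul_pinfty.
Qed.

(** The autocorrelation of the window. By [window_unit] it equals 1 at [t = y], the only value that
    survives in the limit. *)
Definition wcorr (t y : R) : R := \int[mu]_x (psi (x - t) * psi (x - y)).

Lemma integrable_wcorr t y : mu.-integrable setT (EFin \o (fun x => psi (x - t) * psi (x - y))).
Proof.
have mw (u : R) : measurable_fun setT (fun x : R => psi (x - u)).
  by apply: (measurable_window_comp wpsi); exact: measurable_funB.
apply: rintegrable_mul; [exact: mw|exact: mw|exact: (integrable_window_sq wpsi t)|].
exact: (integrable_window_sq wpsi y).
Qed.

(** The damped synthesis with the transforms written out under one integral. The addition formulas
    combine the analysis and synthesis phases into functions of [y - t]. *)
Let kernel n y (p : (R * R) * R) : R :=
  damp n p.1.2 * (psi (p.1.1 - p.2) * psi (p.1.1 - y)) *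
  (cos (2 * pi * p.1.2 * (y - p.2)) * a p.2 + sin (2 * pi * p.1.2 * (y - p.2)) * b p.2).

Lemma measurable_synth_kernel n y : measurable_fun setT (kernel n y).
Proof.
have m12 : measurable_fun setT (fun p : R * R * R => p.1.2) by exact: measurableT_comp.
have m11 : measurable_fun setT (fun p : R * R * R => p.1.1) by exact: measurableT_comp.
have mt : measurable_fun setT (fun p : R * R * R => 2 * pi * p.1.2 * (y - p.2)).
  by apply: measurable_funM; [exact: measurable_funM|exact: measurable_funB].
apply: measurable_funM.
  apply: measurable_funM; first by apply: measurableT_comp => //; exact: measurable_damp.
  by apply: measurable_funM; apply: (measurable_window_comp wpsi); exact: measurable_funB.
apply: measurable_funD; apply: measurable_funM.
- exact: measurable_cos_comp.
- exact: measurableT_comp.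
- exact: measurable_sin_comp.
- exact: measurableT_comp.
Qed.

(** Each variable has its own source of integrability: [psi (x - y)] for [x], the damping for [w],
    and for [t] the AM-GM bound of [synth_kernel_bound], whose three terms produce the constant
    [C]. *)
Lemma integrable_synth_kernel n y : (mu2 \x mu)%E.-integrable setT (EFin \o kernel n y).
Proof.
pose C := 2 * L + \int[mu]_t (a t ^+ 2) + \int[mu]_t (b t ^+ 2).
apply: (@rintegrable_prod1 _ _ _ _ _ mu2 mu _ (fun z => C * (`|psi (z.1 - y)| * damp n z.2))).
- exact: measurable_synth_kernel.
- move=> z.
  have ir := integrable_window_reflected wpsi z.1.
  have iD : mu.-integrable setT (EFin \o (fun t => 2 * psi (z.1 - t) ^+ 2 + a t ^+ 2 + b t ^+ 2)).
    by apply: rintegrableD => //; apply: rintegrableD => //; exact: rintegrableZ.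
  apply: (@le_trans _ _ (\int[mu]_t ((`|psi (z.1 - y)| * damp n z.2) *
      (2 * psi (z.1 - t) ^+ 2 + a t ^+ 2 + b t ^+ 2))%:E)%E).
    apply: ge0_le_integral => //.
    + apply/measurable_EFinP; apply: measurableT_comp => //.
      exact: (measurableT_comp (measurable_synth_kernel n y) (pair1_measurable z)).
    + apply/measurable_EFinP; apply: measurable_funM => //.
      exact: (rintegrable_measurable measurableT iD).
    + move=> t _; rewrite lee_fin /kernel /=.
      by apply: synth_kernel_bound; rewrite ?damp_ge0 ?cos_max ?sin_max.
  under eq_integral do rewrite EFinM.
  rewrite integralZl// -Rintegral_EFin// -EFinM lee_fin mulrC.
  apply: ler_wpM2r; first by rewrite mulr_ge0 ?damp_ge0.
  rewrite RintegralD//; last by apply: rintegrableD => //; exact: rintegrableZ.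
  rewrite RintegralD//; last exact: rintegrableZ.
  rewrite RintegralZl// /C !lerD2r ler_pM2l// -lee_fin Rintegral_EFin//.
  exact: window_reflected wpsi _.
- apply: rintegrableZ => //.
  have iw := rintegrable_norm measurableT (integrable_window wpsi y).
  exact: (rintegrable_tensor2 iw (integrable_damp R n)).
Qed.

Lemma damp_resynthE n y z : damp n z.2 * H y z = \int[mu]_t kernel n y (z, t).
Proof.
rewrite /resynth /synth /stft_re /stft_im /cstft /sstft /fcos /fsin.
have la := integrable_localized wpsi ma a2 z.1; have lb := integrable_localized wpsi mb b2 z.1.
have ica := integrable_cosM la z.2; have isa := integrable_sinM la z.2.
have icb := integrable_cosM lb z.2; have isb := integrable_sinM lb z.2.
rewrite -RintegralB// -RintegralD//.
have iB := rintegrableB measurableT ica isb; have iD := rintegrableD measurableT icb isa.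
rewrite -!RintegralZl//.
have iB' := rintegrableZ (cos (2 * pi * z.2 * y)) measurableT iB.
have iD' := rintegrableZ (sin (2 * pi * z.2 * y)) measurableT iD.
rewrite -RintegralD// -RintegralZr; [|by []|exact: rintegrableD].
rewrite -RintegralZl//; last first.
  by under eq_fun do rewrite mulrC; apply: rintegrableZ => //; exact: rintegrableD.
apply: eq_Rintegral => t _; rewrite /kernel/= (mulrBr (2 * pi * z.2)) cosB sinB; ring.
Qed.

Lemma integrable_damp_resynth n y : mu2.-integrable setT (EFin \o (fun z => damp n z.2 * H y z)).
Proof.
have := rintegrable_fubini_F (integrable_synth_kernel n y).
by congr (_.-integrable _ _); apply/funext => z /=; rewrite damp_resynthE.
Qed.

(** With [t] integrated last, the plane integral factors: [x] gives [wcorr], the cosine in [w] gives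
    the Gaussian, and the sine attached to [b] gives 0. *)
Lemma damped_inversion n y : \int[mu2]_z (damp n z.2 * H y z) =
  \int[mu]_t (a t * wcorr t y * gaussk n.+1%:R (t - y)).
Proof.
transitivity (\int[mu2]_z \int[mu]_t kernel n y (z, t)).
  by apply: eq_Rintegral => z _; rewrite damp_resynthE.
rewrite RFubini; last exact: integrable_synth_kernel.
apply: eq_Rintegral => t _; rewrite /kernel /=.
transitivity (\int[mu2]_z ((psi (z.1 - t) * psi (z.1 - y)) * (a t * (damp n z.2 * cos (2 * pi * z.2 * (y - t))) +
   b t * (damp n z.2 * sin (2 * pi * z.2 * (y - t)))))).
  by apply: eq_Rintegral => z _; ring.
have ic := integrable_damp_cos n (y - t); have isn := integrable_damp_sin n (y - t).
have iD := rintegrableD measurableT (rintegrableZ (a t) measurableT ic) (rintegrableZ (b t) measurableT isn).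
rewrite (Rintegral_tensor2 (integrable_wcorr t y) iD).
rewrite RintegralD//; [|exact: rintegrableZ..].
rewrite !RintegralZl// integral_damp_sin integral_damp_cos mulr0 addr0 /wcorr.
rewrite (_ : gaussk _ (y - t) = gaussk n.+1%:R (t - y)); last by rewrite /gaussk -[in RHS]opprB mulrN sqrrN.
by rewrite mulrCA mulrA.
Qed.

Lemma measurable_wcorr y : measurable_fun setT (wcorr^~ y).
Proof.
apply: (@measurable_Rintegral_snd _ _ _ _ _ mu (fun p : R * R => psi (p.2 - p.1) * psi (p.2 - y))).
by apply: measurable_funM; apply: (measurable_window_comp wpsi); exact: measurable_funB.
Qed.

Lemma wcorr_le2 t y : `|wcorr t y| <= 2.
Proof.
apply: le_trans (le_normr_Rintegral measurableT (integrable_wcorr t y)) _.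
have it := integrable_window_sq wpsi t; have iy := integrable_window_sq wpsi y.
apply: (@le_trans _ _ (\int[mu]_x (psi (x - t) ^+ 2 + psi (x - y) ^+ 2))).
  apply: le_Rintegral => //; [exact: (rintegrable_norm measurableT (integrable_wcorr t y))|exact: rintegrableD|].
  by move=> x _; exact: normrM_le_sqrD.
by rewrite RintegralD// /Rintegral !(window_unit wpsi).
Qed.

Lemma window_constants_ge0 : 0 <= L /\ 0 <= K.
Proof.
split.
  by rewrite -lee_fin; apply: le_trans (window_int wpsi 0); apply: integral_ge0 => x _; rewrite lee_fin.
by have := window_lipschitz wpsi 1 0; rewrite subr0 normr1 mulr1; exact: le_trans.
Qed.

(** The difference from the diagonal value integrates [psi (x - t) - psi (x - y)], at most
    [K * |t - y|], against [psi (x - y)], whose [L^1] norm is at most [L]. *)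
Lemma wcorr_lipschitz t y : `|wcorr t y - 1| <= K * L * `|t - y|.
Proof.
have [L0 K0] := window_constants_ge0.
have iy := integrable_window_sq wpsi y.
have -> : 1 = \int[mu]_x (psi (x - y) * psi (x - y)).
  rewrite /Rintegral (_ : integral _ _ _ = 1%E)//.
  by rewrite -[RHS](window_unit wpsi y); apply: eq_integral => x _; rewrite expr2.
have i1 := integrable_wcorr t y; have i2 := integrable_wcorr y y.
rewrite /wcorr -RintegralB//.
apply: le_trans (le_normr_Rintegral measurableT (rintegrableB measurableT i1 i2)) _.
have iw := rintegrable_norm measurableT (integrable_window wpsi y).
apply: (@le_trans _ _ (\int[mu]_x (K * `|t - y| * `|psi (x - y)|))).
  apply: le_Rintegral => //.
  - exact: (rintegrable_norm measurableT (rintegrableB measurableT i1 i2)).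
  - exact: rintegrableZ.
  - move=> x _; rewrite -mulrBl normrM ler_wpM2r//.
    apply: le_trans (window_lipschitz wpsi _ _) _.
    have e (u v w : R) : u - v - (u - w) = - (v - w) by ring.
    by rewrite e normrN.
rewrite RintegralZl// mulrAC; apply: ler_wpM2r => //.
rewrite ler_wpM2l// -lee_fin Rintegral_EFin//; exact: window_int wpsi _.
Qed.

(** The Lebesgue-point condition, unnormalized: the integral over a ball is [o(r)]. This is the form
    that [approx_identity] consumes. *)
Definition small_oscillation (f : R -> R) (y : R) : Prop :=
  forall e : R, 0 < e -> exists2 d : R, 0 < d & forall r : R, 0 <= r -> r < d ->
    (\int[mu]_t (`|f t - f y| * \1_([set t | (`|t - y| <= r)%R] : set R) t)%:E <= (e * r)%:E)%E.

Lemma dist_le_itv (y r : R) : [set t : R | `|t - y| <= r] = `[y - r, y + r]%classic.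
Proof. by apply/seteqP; split => t /=; rewrite in_itv/= ler_distl. Qed.

Lemma integral_ball_indic (y r : R) : 0 <= r ->
  (\int[mu]_t (\1_([set t : R | `|t - y| <= r]) t)%:E = (2 * r)%:E)%E.
Proof.
move=> r0; rewrite dist_le_itv integral_indic//= setIT lebesgue_measure_itv/= lte_fin.
case: ifPn => [_|]; first by rewrite -EFinD; congr EFin; ring.
rewrite -leNgt => h; congr EFin; have : r <= 0 by lra.
move=> r0'; rewrite (_ : r = 0) ?mulr0//.
by apply/eqP; rewrite eq_le r0' r0.
Qed.

Section pointwise.
Variable y : R.
Hypothesis osc : small_oscillation a y.

Let g (t : R) : R := `|a t * wcorr t y - a y|.
Let chi (r : R) (t : R) : R := \1_([set t : R | `|t - y| <= r]) t.

Let mg : measurable_fun setT g.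
Proof.
apply: measurableT_comp => //; apply: measurable_funB => //.
by apply: measurable_funM => //; exact: measurable_wcorr.
Qed.

Let mchi r : measurable_fun setT (chi r).
Proof. by apply: measurable_indic; rewrite dist_le_itv; exact: measurable_itv. Qed.

Let chi0 r t : 0 <= chi r t. Proof. exact: indic_ge0. Qed.

Let D : R := `|a y| * (K * L).

Let D0 : 0 <= D.
Proof. by have [L0 K0] := window_constants_ge0; rewrite !mulr_ge0. Qed.

(** The product [a t * wcorr t y] is compared with [a y] by splitting off the oscillation of [a],
    weighted by [|wcorr| <= 2], and the Lipschitz defect of [wcorr] at the diagonal. *)
Let g_le t : g t <= 2 * `|a t - a y| + D * `|t - y|.
Proof.
rewrite /g (_ : _ - a y = wcorr t y * (a t - a y) + a y * (wcorr t y - 1)); last by ring.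
apply: le_trans (ler_normD _ _) _; rewrite !normrM; apply: lerD.
  by rewrite ler_wpM2r// wcorr_le2.
by rewrite /D -mulrA ler_wpM2l// wcorr_lipschitz.
Qed.

Let near_bound (r : R) : 0 <= r ->
  (\int[mu]_t (g t * chi r t)%:E <=
   2%:E * \int[mu]_t (`|a t - a y| * chi r t)%:E + (D * r * (2 * r))%:E)%E.
Proof.
move=> r0.
have ma' : measurable_fun setT (fun t => `|a t - a y|).
  by apply: measurableT_comp => //; exact: measurable_funB.
rewrite (EFinM (D * r)) -(integral_ball_indic y r0) -/(chi r).
have m1 : measurable_fun setT (EFin \o (fun t => `|a t - a y| * chi r t)).
  by apply/measurable_EFinP; exact: measurable_funM.
have n1 (t : R) : setT t -> (0 <= (`|a t - a y| * chi r t)%:E)%E by move=> _; rewrite lee_fin mulr_ge0.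
have m2 : measurable_fun setT (EFin \o chi r) by apply/measurable_EFinP; exact: mchi.
have n2 (t : R) : setT t -> (0 <= (chi r t)%:E)%E by move=> _; rewrite lee_fin chi0.
have Dr0 : (0 <= (D * r)%:E)%E by rewrite lee_fin mulr_ge0.
rewrite -[X in (_ <= X + _)%E]ge0_integralZl// -[X in (_ <= _ + X)%E]ge0_integralZl//.
rewrite -ge0_integralD//; last 4 first.
- by move=> t tT; apply: mule_ge0 => //; exact: n1.
- exact: measurable_funeM.
- by move=> t tT; apply: mule_ge0 => //; exact: n2.
- exact: measurable_funeM.
apply: ge0_le_integral => //.
- by move=> t _; rewrite lee_fin mulr_ge0// /g.
- by apply/measurable_EFinP; apply: measurable_funM; [exact: mg|exact: mchi].
- by apply: emeasurable_funD; exact: measurable_funeM.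
- move=> t _; rewrite -!EFinM -EFinD lee_fin /chi !indicE.
  have [|_] := boolP (t \in _); last by rewrite !mulr0 addr0.
  rewrite inE/= !mulr1 => tr; apply: le_trans (g_le t) _.
  by rewrite lerD2l ler_wpM2l.
Qed.

Let osc_small (e : R) : 0 < e -> exists2 d : R, 0 < d & forall r : R, 0 <= r -> r < d ->
  (\int[mu]_t (g t * chi r t)%:E <= (e * r)%:E)%E.
Proof.
move=> e0; have e40 : 0 < e / 4 by rewrite divr_gt0.
have [d d0 dP] := osc e40.
(* The oscillation of [a] enters twice, giving [e / 2 * r]. The second entry of the minimum keeps
   the quadratic term [2 * D * r ^+ 2] below [e / 2 * r]. *)
exists (Num.min d (e / 4 / (D + 1))).
  by rewrite lt_min d0/= divr_gt0// ltr_wpDl.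
move=> r r0; rewrite lt_min => /andP[rd rD].
apply: le_trans (near_bound r0) _.
apply: (@le_trans _ _ (2%:E * (e / 4 * r)%:E + (D * r * (2 * r))%:E)%E).
  by rewrite leeD2r// lee_wpmul2l ?lee_fin//; exact: dP.
rewrite -EFinM -EFinD lee_fin.
have : r * (D + 1) <= e / 4 by rewrite -ler_pdivlMr ?ltr_wpDl// ltW.
move=> h; have := ler_wpM2l r0 h; have := D0; have : 0 <= r * r by rewrite mulr_ge0.
exact: oscillation_arith.
Qed.

Let osc_bounded : exists Mb : R, forall r : R, 0 <= r ->
  (\int[mu]_t (g t * chi r t)%:E <= (Mb * r)%:E)%E.
Proof.
have [d d0 dP] := osc_small ltr01.
pose A2 := \int[mu]_t (a t ^+ 2).
have A20 : 0 <= A2 by apply: Rintegral_ge0 => t _; exact: sqr_ge0.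
pose C : R := 2 + `|a y|.
have C0 : 0 <= C by rewrite addr_ge0.
(* The 1 covers [r < d]. For [r >= d], the integrand is at most [C + 2 * a t ^+ 2] on the ball: the
   constant yields [2 * C * r], and the global bound [2 * A2] is at most [2 * A2 / d * r]. *)
exists (1 + (2 * C + 2 * A2 / d)) => r r0.
have [rd|rd] := ltP r d.
  apply: le_trans (dP _ r0 rd) _; rewrite lee_fin ler_wpM2r// lerDl.
  by apply: addr_ge0; [rewrite mulr_ge0|rewrite divr_ge0 ?mulr_ge0// ltW].
apply: (@le_trans _ _ (\int[mu]_t (C * chi r t + 2 * a t ^+ 2)%:E)%E).
  apply: ge0_le_integral => //.
  - by move=> t _; rewrite lee_fin mulr_ge0// /g.
  - by apply/measurable_EFinP; apply: measurable_funM; [exact: mg|exact: mchi].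
  - apply/measurable_EFinP; apply: measurable_funD.
      by apply: measurable_funM; [exact: measurable_cst|exact: mchi].
    by apply: measurable_funM; [exact: measurable_cst|exact: measurable_funX].
  - move=> t _; rewrite lee_fin /chi indicE; have [_|_] := boolP (t \in _); last first.
      by rewrite !mulr0 add0r mulr_ge0 ?sqr_ge0.
    rewrite !mulr1 /g; apply: le_trans (ler_normB _ _) _; rewrite normrM.
    rewrite /C addrAC lerD2r; apply: le_trans (ler_wpM2l (normr_ge0 _) (wcorr_le2 t y)) _.
    rewrite -(real_normK (num_real (a t))); have := sqr_ge0 (`|a t| - 1).
    by move: (`|a t|) => u; nra.
under eq_integral do rewrite EFinD !EFinM.
have ichi : mu.-integrable setT (EFin \o chi r).
  apply/integrableP; split; first by apply/measurable_EFinP; exact: mchi.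
  rewrite [X in (X < _)%E](_ : _ = (2 * r)%:E) ?ltry//.
  by rewrite -(integral_ball_indic y r0); apply: eq_integral => t _; rewrite /= ger0_norm.
rewrite integralD//; last 2 first.
- by have := rintegrableZ C measurableT ichi.
- by have := rintegrableZ 2 measurableT a2.
rewrite !integralZl//= -(Rintegral_EFin a2)// -/A2 integral_ball_indic//.
rewrite -!EFinM -EFinD lee_fin.
rewrite (_ : (1 + _) * r = r + (C * (2 * r) + 2 * A2 / d * r)); last by ring.
have : 2 * A2 <= 2 * A2 / d * r by rewrite mulrAC ler_pdivlMr// ler_wpM2l ?mulr_ge0.
by move=> h; rewrite -[leLHS]add0r lerD// lerD2l.
Qed.

Lemma gaussk_le (c u : R) : 0 <= c -> gaussk c u <= c.
Proof.
move=> c0; rewrite /gaussk ler_piMr// -expR0 ler_expR oppr_le0 mulr_ge0 ?sqr_ge0//.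
exact: pi_ge0.
Qed.

Let integrable_awg n : mu.-integrable setT (EFin \o (fun t => a t * wcorr t y * gaussk n.+1%:R (t - y))).
Proof.
have n0 : 0 < n.+1%:R :> R by rewrite ltr0n.
have ig := integrable_gaussk y n0.
have iD := rintegrableD measurableT (rintegrableZ 2 measurableT ig) (rintegrableZ (2 * n.+1%:R) measurableT a2).
apply: (rintegrable_le measurableT _ _ iD).
  apply: measurable_funM; last exact: (rintegrable_measurable measurableT ig).
  by apply: measurable_funM => //; exact: measurable_wcorr.
move=> t _; have G0 := gaussk_ge0 (t - y) (ltW n0); have G1 := gaussk_le (t - y) (ltW n0).
rewrite normrM (ger0_norm G0) normrM.
apply: damped_integrand_arith => //; exact: wcorr_le2.
Qed.

(** As the Gaussian has mass one, [a y] can be put under the integral; the difference is then at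
    most the Gaussian average of [g], which [approx_identity] makes small. *)
Lemma damped_inversion_cvg :
  \int[mu]_t (a t * wcorr t y * gaussk n.+1%:R (t - y)) @[n --> \oo] --> a y.
Proof.
have [Mb BM] := osc_bounded.
apply/cvgrPdist_le => /= e e0.
have := @approx_identity R g y Mb mg (fun t => normr_ge0 _) BM osc_small e e0.
apply: filterS => n h; rewrite -lee_fin; apply: le_trans h.
have n0 : 0 < n.+1%:R :> R by rewrite ltr0n.
have ig := integrable_gaussk y n0.
have -> : a y = \int[mu]_t (a y * gaussk n.+1%:R (t - y)).
  by rewrite RintegralZl// /Rintegral integral_gaussk// mulr1.
rewrite distrC -RintegralB//; last exact: rintegrableZ.
have iB := rintegrableB measurableT (integrable_awg n) (rintegrableZ (a y) measurableT ig).
rewrite EFin_normr_Rintegral//; apply: le_trans (le_abse_integral _ _ _) _ => //.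
  by case/integrableP: iB.
apply: ge0_le_integral => //.
- by apply: measurableT_comp => //; case/integrableP: iB.
- apply/measurable_EFinP; apply: measurable_funM => //; exact: (rintegrable_measurable measurableT ig).
- move=> t _; rewrite lee_fin -mulrBl normrM (ger0_norm (gaussk_ge0 _ (ltW n0)))//.
Qed.

End pointwise.

Lemma resynth_pointwise y : small_oscillation a y ->
  mu2.-integrable setT (EFin \o H y) -> a y = \int[mu2]_z H y z.
Proof.
move=> osc Hi.
have [_ c1] : mu2.-integrable setT (EFin \o H y) /\
    (\int[mu2]_z (damp n z.2 * H y z) @[n --> \oo] --> \int[mu2]_z H y z).
  apply: (@Rdominated_cvg R _ _ mu2 (fun n z => damp n z.2 * H y z) (H y) (fun z => `|H y z|)).
  - by move=> n; exact: (rintegrable_measurable measurableT (integrable_damp_resynth n y)).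
  - move=> z; rewrite -[X in _ --> X]mul1r; apply: cvgM; [exact: cvg_damp|exact: cvg_cst].
  - by move=> n z; rewrite normrM ler_piMl// ger0_norm ?damp_ge0// damp_le1.
  - exact: (rintegrable_norm measurableT Hi).
apply: (cvg_unique _ _ c1) => //.
rewrite (_ : (fun n => _) = (fun n => \int[mu]_t (a t * wcorr t y * gaussk n.+1%:R (t - y)))).
  exact: damped_inversion_cvg.
by apply/funext => n; exact: damped_inversion.
Qed.

(** Multiplying the transform by [damp - 1_B] keeps it square integrable, makes its synthesis
    integrable, and turns the synthesis integral into the damped inversion minus the integral over
    [B]. The multiplier tends to the indicator of the complement of [B]. *)
Let resynth_cut (B : set (R * R)) n (z : R * R) : R := damp n z.2 - \1_B z.

Let resynth_cut_le1 B n z : `|resynth_cut B n z| <= 1.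
Proof.
rewrite /resynth_cut indicE; case: (z \in B) => /=.
  by rewrite ler_norml; have := damp_ge0 n z.2; have := damp_le1 n z.2; lra.
by rewrite subr0 ger0_norm ?damp_ge0// damp_le1.
Qed.

Let cvg_resynth_cut (B : set (R * R)) z : resynth_cut B n z @[n --> \oo] --> (\1_(~` B) z : R).
Proof.
have -> : \1_(~` B) z = 1 - \1_B z :> R.
  by rewrite !indicE in_setC; case: (z \in B) => /=; rewrite ?subrr ?subr0.
by apply: cvgB; [exact: cvg_damp|exact: cvg_cst].
Qed.

Lemma measurable_resynth_part (B : set (plane R)) : measurable B ->
  measurable_fun setT (fun y => a y - \int[mu2]_(z in B) H y z).
Proof.
move=> mB; apply: measurable_funB => //.
rewrite (_ : (fun y => _) = (fun y => \int[mu2]_z (\1_B z * H y z))); last first.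
  apply/funext => y; rewrite Rintegral_mkcond; apply: eq_Rintegral => z _.
  by rewrite patchE indicE; case: (z \in B) => /=; rewrite ?mul1r ?mul0r.
apply: (@measurable_Rintegral_snd _ _ _ _ _ mu2 (fun p : R * (R * R) => \1_B p.2 * synth psi W1 W2 p.1 p.2)).
apply: measurable_funM; last exact: (measurable_synth2 wpsi measurable_stft_re measurable_stft_im).
by apply: measurableT_comp; [exact: measurable_indic|exact: measurable_snd].
Qed.

(** [adjoint_bessel] is applied to the transform cut by [resynth_cut]. As [n] grows, the left side
    converges almost everywhere to the reconstruction error, so Fatou applies, and the right side
    converges to the energy outside [B] by dominated convergence. The undamped integral over the
    complement is never formed. *)
Lemma resynth_error (B : set (plane R)) : measurable B ->
  (forall y, mu2.-integrable B (EFin \o H y)) ->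
  {ae mu, forall y, small_oscillation a y} ->
  (\int[mu]_y ((a y - \int[mu2]_(z in B) H y z) ^+ 2)%:E <=
   2%:E * \int[mu2]_z (\1_(~` B) z * (W1 z ^+ 2 + W2 z ^+ 2))%:E)%E.
Proof.
move=> mB BH aosc.
have mcut n : measurable_fun setT (resynth_cut B n).
  apply: measurable_funB; last exact: measurable_indic.
  by apply: measurableT_comp; [exact: measurable_damp|exact: measurable_snd].
have BH' y : mu2.-integrable setT (EFin \o (fun z => \1_B z * H y z)).
  have := (@integrable_mkcond _ _ _ mu2 B _ mB).1 (BH y).
  congr (_.-integrable _ _); apply/funext => z /=.
  by rewrite patchE indicE; case: (z \in B) => /=; rewrite ?mul1r ?mul0r.
pose V1 n z := resynth_cut B n z * W1 z; pose V2 n z := resynth_cut B n z * W2 z.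
have mV1 n : measurable_fun setT (V1 n).
  by apply: measurable_funM; [exact: mcut|exact: measurable_stft_re].
have mV2 n : measurable_fun setT (V2 n).
  by apply: measurable_funM; [exact: mcut|exact: measurable_stft_im].
have sq (c w : R) : `|c| <= 1 -> `|(c * w) ^+ 2| <= w ^+ 2.
  move=> c1; rewrite normrX normrM -[leRHS](real_normK (num_real w)).
  by rewrite ler_pXn2r ?nnegrE ?mulr_ge0// ler_piMl.
have sV1 n : mu2.-integrable setT (EFin \o (fun z => V1 n z ^+ 2)).
  apply: (rintegrable_le measurableT _ _ integrable_stft_re_sq).
    by apply: measurable_funX; exact: mV1.
  by move=> z _; apply: sq.
have sV2 n : mu2.-integrable setT (EFin \o (fun z => V2 n z ^+ 2)).
  apply: (rintegrable_le measurableT _ _ integrable_stft_im_sq).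
    by apply: measurable_funX; exact: mV2.
  by move=> z _; apply: sq.
have synthE n y z : synth psi (V1 n) (V2 n) y z = damp n z.2 * H y z - \1_B z * H y z.
  by rewrite /resynth /synth /V1 /V2 /resynth_cut; ring.
have iS n y : mu2.-integrable setT (EFin \o synth psi (V1 n) (V2 n) y).
  have := rintegrableB measurableT (integrable_damp_resynth n y) (BH' y).
  by congr (_.-integrable _ _); apply/funext => z /=; rewrite synthE.
have IS n y : \int[mu2]_z synth psi (V1 n) (V2 n) y z =
    \int[mu2]_z (damp n z.2 * H y z) - \int[mu2]_(z in B) H y z.
  rewrite (_ : \int[mu2]_(z in B) _ = \int[mu2]_z (\1_B z * H y z)); last first.
    rewrite Rintegral_mkcond; apply: eq_Rintegral => z _.
    by rewrite patchE indicE; case: (z \in B) => /=; rewrite ?mul1r ?mul0r.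
  have := BH' y; have := integrable_damp_resynth n y => i1 i2.
  by rewrite -RintegralB//; apply: eq_Rintegral => z _; rewrite synthE.
pose u n y := (\int[mu2]_z synth psi (V1 n) (V2 n) y z) ^+ 2.
apply: (@fatou_le _ _ _ mu u _ (fun n => (2 * \int[mu2]_z (V1 n z ^+ 2 + V2 n z ^+ 2))%:E)).
- move=> n; apply: measurable_funX.
  apply: (@measurable_Rintegral_snd _ _ _ _ _ mu2 (fun p : R * (R * R) => synth psi (V1 n) (V2 n) p.1 p.2)).
  exact: (measurable_synth2 wpsi).
- by apply: measurable_funX; exact: measurable_resynth_part.
- by move=> n y; exact: sqr_ge0.
- have [N [mN N0 NP]] := aosc; exists N; split => // y /= ny; apply: NP => /= osc; apply: ny.
  have c1 : \int[mu2]_z synth psi (V1 n) (V2 n) y z @[n --> \oo] --> a y - \int[mu2]_(z in B) H y z.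
    rewrite (_ : (fun n => _) = (fun n => \int[mu]_t (a t * wcorr t y * gaussk n.+1%:R (t - y)) -
        \int[mu2]_(z in B) H y z)); last first.
      by apply/funext => n; rewrite IS damped_inversion.
    by apply: cvgB; [exact: damped_inversion_cvg|exact: cvg_cst].
  by rewrite /u; apply: cvgM.
- by move=> n; exact: (adjoint_bessel wpsi).
- have iV n : mu2.-integrable setT (EFin \o (fun z => V1 n z ^+ 2 + V2 n z ^+ 2)).
    exact: (rintegrableD measurableT (sV1 n) (sV2 n)).
  rewrite (_ : (fun n => _) = (fun n => 2%:E * \int[mu2]_z (V1 n z ^+ 2 + V2 n z ^+ 2)%:E)%E); last first.
    by apply/funext => n; rewrite EFinM Rintegral_EFin.
  apply: cvgeZl; first by [].
  apply: (@edominated_cvg R _ _ mu2 _ _ (fun z => W1 z ^+ 2 + W2 z ^+ 2)).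
  - by move=> n; exact: (rintegrable_measurable measurableT (iV n)).
  - move=> z; rewrite (_ : \1_(~` B) z * _ = \1_(~` B) z * W1 z * (\1_(~` B) z * W1 z) +
       \1_(~` B) z * W2 z * (\1_(~` B) z * W2 z)); last first.
      by rewrite indicE; case: (z \in _) => /=; ring.
    have c1 : V1 n z @[n --> \oo] --> \1_(~` B) z * W1 z.
      by apply: cvgM; [exact: cvg_resynth_cut|exact: cvg_cst].
    have c2 : V2 n z @[n --> \oo] --> \1_(~` B) z * W2 z.
      by apply: cvgM; [exact: cvg_resynth_cut|exact: cvg_cst].
    by apply: cvgD; apply: cvgM.
  - move=> n z; apply: le_trans (ler_normD _ _) _; apply: lerD; apply: sq; exact: resynth_cut_le1.
  - exact: (rintegrableD measurableT integrable_stft_re_sq integrable_stft_im_sq).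
Qed.

Lemma resynth_L2_cvg (B : nat -> set (plane R)) :
  (forall m, measurable (B m)) -> (forall m, B m `<=` B m.+1) -> \bigcup_m B m = setT ->
  (forall m y, mu2.-integrable (B m) (EFin \o H y)) ->
  {ae mu, forall y, small_oscillation a y} ->
  (\int[mu]_y ((a y - \int[mu2]_(z in B m) H y z) ^+ 2)%:E)%E @[m --> \oo] --> 0%E.
Proof.
move=> mB Bincr Bcov BH aosc.
have W0 : (\int[mu2]_z (\1_(~` B m) z * (W1 z ^+ 2 + W2 z ^+ 2))%:E)%E @[m --> \oo] -->
    (\int[mu2]_z ((fun=> 0 : R) z)%:E)%E.
  have iW := rintegrableD measurableT integrable_stft_re_sq integrable_stft_im_sq.
  apply: (@edominated_cvg R _ _ mu2 _ _ (fun z => W1 z ^+ 2 + W2 z ^+ 2)) => //.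
  - move=> m; apply: measurable_funM; last exact: (rintegrable_measurable measurableT iW).
    by apply: measurable_indic; exact: measurableC.
  - move=> z; apply: cvg_near_cst.
    have [m _ Bmz] : (\bigcup_m B m) z by rewrite Bcov.
    exists m => // k /= mk; rewrite indicE memNset ?mul0r//; apply.
    by have := @homo_leq _ B (fun X Y => X `<=` Y) (@subset_refl _) (fun _ _ _ h1 h2 => subset_trans h1 h2) Bincr m k mk; apply.
  - move=> m z; rewrite normrM indicE (ger0_norm (addr_ge0 (sqr_ge0 _) (sqr_ge0 _))).
    rewrite ler_piMl ?addr_ge0 ?sqr_ge0//.
    by case: (z \in _); rewrite ?normr1 ?normr0.
have c0 : (2%:E * \int[mu2]_z (\1_(~` B m) z * (W1 z ^+ 2 + W2 z ^+ 2))%:E)%E @[m --> \oo] --> 0%E.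
  rewrite (_ : 0%E = (2%:E * 0)%E); last by rewrite mule0.
  apply: cvgeZl; first by [].
  by rewrite integral0 in W0.
apply: (@squeeze_cvge _ _ _ _ (fun=> 0%E) _ (fun m => (2%:E * \int[mu2]_z (\1_(~` B m) z * (W1 z ^+ 2 + W2 z ^+ 2))%:E)%E)).
- near=> m; apply/andP; split; first by apply: integral_ge0 => y _; rewrite lee_fin sqr_ge0.
  exact: resynth_error.
- exact: cvg_cst.
- exact: c0.
Unshelve. all: by end_near. Qed.

End reconstruction.

(** * Continuity points and Lebesgue points have small oscillation *)

Section oscillation.
Context (R : realType).
Local Notation mu := (@lebesgue_measure R).

Lemma continuous_small_oscillation (f : R -> R) y : measurable_fun setT f ->
  {for y, continuous f} -> small_oscillation f y.
Proof.
move=> mf cf e e0; have e20 : 0 < e / 2 by rewrite divr_gt0.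
have /cvgrPdist_le /(_ _ e20) := cf; rewrite near_simpl => /nbhs_ballP [d /= d0 dP].
exists d => // r r0 rd.
have mB : measurable_fun setT (\1_([set t : R | `|t - y| <= r]) : R -> R).
  by apply: measurable_indic; rewrite dist_le_itv; exact: measurable_itv.
apply: (@le_trans _ _ (\int[mu]_t ((e / 2)%:E * (\1_([set t : R | `|t - y| <= r]) t)%:E))%E).
  apply: ge0_le_integral => //.
  - apply/measurable_EFinP; apply: measurable_funM => //.
    by apply: measurableT_comp => //; exact: measurable_funB.
  - by apply/measurable_EFinP; apply: measurable_funM.
  - move=> t _; rewrite -EFinM lee_fin indicE.
    have [|_] := boolP (t \in _); last by rewrite !mulr0.
    rewrite inE/= !mulr1 => tr; rewrite distrC; apply: dP.
    by rewrite /ball/= distrC (le_lt_trans tr).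
rewrite ge0_integralZl//; last by rewrite lee_fin ltW.
  rewrite integral_ball_indic// -EFinM lee_fin.
  by rewrite (_ : e / 2 * (2 * r) = e * r)//; field.
by apply/measurable_EFinP; exact: mB.
Qed.

Lemma locally_integrable_sq (f : R -> R) : measurable_fun setT f ->
  mu.-integrable setT (EFin \o (fun t => f t ^+ 2)) -> locally_integrable setT f.
Proof.
move=> mf f2; split => //; first exact: openT.
move=> A _ cA; have mA : measurable A by exact: compact_measurable.
have Afin : (mu A < +oo)%E by exact: compact_finite_measure.
have fi : mu.-integrable A (EFin \o f).
  apply: (@rintegrable_le _ _ _ mu A _ (fun t : R => 1 + f t ^+ 2)) => //.
  - exact: measurable_funTS.
  - move=> t _; rewrite -(real_normK (num_real (f t))); have := sqr_ge0 (`|f t| - 1).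
    by have := normr_ge0 (f t); move: (`|f t|) => u; nra.
  - apply: rintegrableD => //; last by apply: integrableS f2.
    apply/integrableP; split; first exact/measurable_EFinP.
    by rewrite /= integral_cst// normr1 mul1e.
by case/integrableP: fi.
Qed.

Lemma lebesgue_pt_small_oscillation (f : R -> R) y : measurable_fun setT f ->
  lebesgue_pt f y -> small_oscillation f y.
Proof.
move=> mf fy e e0.
(* The closed ball of radius [r] lies in the open ball of radius [2 * r], which has measure [4 * r]:
   hence [e / 4] for the mean and [d / 2] for the radius. *)
have e40 : 0 < e / 4 by rewrite divr_gt0.
have /fine_cvgP[fin /cvgrPdist_le /(_ _ e40) small] := fy.
have [d /= d0 dP] : \forall r \near (0 : R)^'+, (davg f y r <= (e / 4)%:E)%E.
  near=> r.
  have fr : davg f y r \is a fin_num by near: r.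
  have : `|0 - fine (davg f y r)| <= e / 4 by near: r.
  rewrite sub0r normrN ger0_norm ?fine_ge0 ?davg_ge0// => h.
  by rewrite -(fineK fr) lee_fin.
exists (d / 2); first by rewrite divr_gt0.
move=> r; rewrite le_eqVlt => /orP[/eqP <- _|r0 rd].
  rewrite mulr0 (eq_integral (fun=> 0%E)) ?integral0// => t _.
  rewrite indicE; have [|_] := boolP (t \in _); last by rewrite mulr0.
  by rewrite inE/= normr_le0 subr_eq0 => /eqP ->; rewrite subrr normr0 mul0r.
have r20 : 0 < 2 * r by rewrite mulr_gt0.
have : (davg f y (2 * r) <= (e / 4)%:E)%E.
  apply: dP => //; rewrite /ball/= sub0r normrN gtr0_norm//.
  by rewrite mulrC -ltr_pdivlMr.
rewrite /davg /iavg lebesgue_measure_ball; last exact: ltW.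
have r40 : (2 * r) *+ 2 != 0 by rewrite mulrn_eq0/= gt_eqF.
rewrite inver (negbTE r40) lee_pdivrMl; last by rewrite pmulrn_lgt0.
move=> h; rewrite (_ : e * r = (2 * r) *+ 2 * (e / 4)); last by field.
apply: le_trans h; rewrite [leRHS]integral_mkcond; apply: ge0_le_integral => //.
- apply/measurable_EFinP; apply: measurable_funM.
    by apply: measurableT_comp => //; exact: measurable_funB.
  by apply: measurable_indic; rewrite dist_le_itv; exact: measurable_itv.
- have mb : measurable (ball y (2 * r)) by exact: measurable_ball.
  apply/(measurable_restrictT _ mb); apply: measurable_funTS.
  apply: measurableT_comp => //; apply/measurable_EFinP => /=.
  by apply: measurable_funB.
- move=> t _; rewrite patchE indicE.
  have [|_] := boolP (t \in _); last by rewrite mulr0; case: ifP => // _; rewrite abse_ge0.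
  rewrite inE /= mulr1 => tr; rewrite mem_set//.
  by rewrite /ball/= distrC (le_lt_trans tr)// mulr_natl mulr2n ltrDl.
Unshelve. all: by end_near. Qed.

End oscillation.

(** * The exponential on a slice *)

Section exponential_series.
Context (R : realType).
Implicit Types (p : R^nat) (z : R[i]).

(** The sum norm on the complex numbers: submultiplicative by the triangle inequality alone, and it
    dominates both parts. *)
Definition cabs z : R := `|complex.Re z| + `|complex.Im z|.

Lemma cabs_ge0 z : 0 <= cabs z.
Proof. exact: addr_ge0. Qed.

Lemma ReM (z w : R[i]) : complex.Re (z * w) = complex.Re z * complex.Re w - complex.Im z * complex.Im w.
Proof. by case: z w => [a b] [c d]. Qed.

Lemma ImM (z w : R[i]) : complex.Im (z * w) = complex.Re z * complex.Im w + complex.Im z * complex.Re w.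
Proof. by case: z w => [a b] [c d]. Qed.

Lemma cabsM (z w : R[i]) : cabs (z * w) <= cabs z * cabs w.
Proof.
rewrite /cabs ReM ImM.
apply: le_trans (lerD (ler_normB _ _) (ler_normD _ _)) _; rewrite !normrM.
by rewrite le_eqVlt; apply/orP; left; apply/eqP; ring.
Qed.

Lemma cabsD (z w : R[i]) : cabs (z + w) <= cabs z + cabs w.
Proof.
case: z w => [a b] [c d]; rewrite /cabs /=.
apply: le_trans (lerD (ler_normD _ _) (ler_normD _ _)) _.
by rewrite addrACA.
Qed.

Lemma cabs1 : cabs (1 : R[i]) = 1.
Proof. by rewrite /cabs /= normr1 normr0 addr0. Qed.

Lemma cabsX z k : cabs (z ^+ k) <= cabs z ^+ k.
Proof.
elim: k => [|k IH]; first by rewrite !expr0 cabs1.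
rewrite !exprS; apply: le_trans (cabsM _ _) _.
by rewrite ler_wpM2l ?cabs_ge0.
Qed.

Let term p (k : nat) : R := p k / k`!%:R.

Lemma is_cvg_exp_series p (s S x : R) : 0 <= s -> 0 <= S ->
  (forall k, `|p k| <= S * s ^+ k) -> cvgn (pseries (term p) x).
Proof.
move=> s0 S0 pS; apply: normed_cvg.
apply: (@series_le_cvg _ _ (fun k => S * exp_coeff (s * `|x|) k)) => [k|k|k|].
- by rewrite normr_ge0.
- by rewrite mulr_ge0 ?exp_coeff_ge0 ?mulr_ge0.
- rewrite /= normrM normrX /term normrM (ger0_norm (_ : 0 <= k`!%:R^-1)) ?invr_ge0//.
  rewrite /exp_coeff /= exprMn !mulrA; set c := k`!%:R^-1.
  rewrite -[leLHS]mulrA (mulrC c) mulrA ler_wpM2r ?invr_ge0//.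
  by rewrite ler_wpM2r ?exprn_ge0.
- by apply: is_cvg_seriesZ; exact: is_cvg_series_exp_coeff.
Qed.

Definition exp_sum p (x : R) : R := limn (pseries (term p) x).

(** For series with factorial denominators, differentiation is a shift of the numerators. Geometric
    growth of the numerators is preserved by the shift. *)
Lemma is_derive_exp_sum p (s S x : R) : 0 <= s -> 0 <= S ->
  (forall k, `|p k| <= S * s ^+ k) ->
  is_derive x (1 : R) (exp_sum p) (exp_sum (fun k => p k.+1) x).
Proof.
move=> s0 S0 pS.
have shift (q : R^nat) : pseries_diffs (term q) = term (fun k => q k.+1).
  apply/funext => k; rewrite /pseries_diffs /term factS natrM invfM.
  by rewrite mulrCA mulVKf ?pnatr_eq0.
have pS1 (q : R^nat) S' : (forall k, `|q k| <= S' * s ^+ k) -> forall k, `|q k.+1| <= S' * s * s ^+ k.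
  by move=> qS k; apply: le_trans (qS _) _; rewrite exprS mulrA.
have S1 : 0 <= S * s by rewrite mulr_ge0.
have S2 : 0 <= S * s * s by rewrite mulr_ge0.
(* The criterion asks for convergence of the series and of its first two formal derivatives at a
   point beyond [x], hence the bounds [S * s] and [S * s * s]. *)
have := @pseries_snd_diffs R (term p) (`|x| + 1) x; rewrite !shift; apply.
- exact: is_cvg_exp_series pS.
- exact: is_cvg_exp_series (pS1 _ _ pS).
- exact: is_cvg_exp_series (pS1 _ _ (pS1 _ _ pS)).
- by rewrite [ltRHS]ger0_norm ?ltrDl// addr_ge0.
Qed.

Definition cexp z : R[i] :=
  ((expR (complex.Re z) * cos (complex.Im z)) +i* (expR (complex.Re z) * sin (complex.Im z)))%C.

Let pow_re z k : R := complex.Re (z ^+ k).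
Let pow_im z k : R := complex.Im (z ^+ k).

Let pow_re_le z k : `|pow_re z k| <= 1 * cabs z ^+ k.
Proof. by rewrite mul1r; apply: le_trans (cabsX z k); rewrite lerDl. Qed.

Let pow_im_le z k : `|pow_im z k| <= 1 * cabs z ^+ k.
Proof. by rewrite mul1r; apply: le_trans (cabsX z k); rewrite lerDr. Qed.

Let cvg_pow_re z x : cvgn (pseries (term (pow_re z)) x).
Proof. exact: is_cvg_exp_series (cabs_ge0 z) ler01 (pow_re_le z). Qed.

Let cvg_pow_im z x : cvgn (pseries (term (pow_im z)) x).
Proof. exact: is_cvg_exp_series (cabs_ge0 z) ler01 (pow_im_le z). Qed.

Let exp_sum_lin (u v : R) p q x : cvgn (pseries (term p) x) -> cvgn (pseries (term q) x) ->
  exp_sum (fun k => u * p k + v * q k) x = u * exp_sum p x + v * exp_sum q x.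
Proof.
move=> cp cq; rewrite /exp_sum.
apply: cvg_lim => //.
rewrite (_ : pseries _ x = (fun n => u * pseries (term p) x n + v * pseries (term q) x n)).
  by apply: cvgD; apply: cvgM => //; exact: cvg_cst.
apply/funext => n; rewrite /pseries /series /= !mulr_sumr -big_split /=.
by apply: eq_bigr => k _; rewrite /term; ring.
Qed.

Let exp_sum0 p : exp_sum p 0 = p 0.
Proof.
apply: cvg_lim => //; rewrite -cvg_shiftS; apply: cvg_near_cst; near=> n.
rewrite /pseries /series /= big_nat_recl// big1_seq ?addr0.
  by rewrite /term expr0 fact0 invr1 !mulr1.
by move=> i _; rewrite exprS mul0r mulr0.
Unshelve. all: by end_near. Qed.

(* The two sums, as functions F, G of a real parameter scaling z = a + i b, satisfy
   F' = a F - b G and G' = a G + b F, as do e^(a x) cos(b x) and e^(a x) sin(b x). *)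
Lemma cvg_cexp z :
  (fun m => \sum_(0 <= k < m) (k`!%:R)^-1 * complex.Re (z ^+ k)) @ \oo --> complex.Re (cexp z) /\
  (fun m => \sum_(0 <= k < m) (k`!%:R)^-1 * complex.Im (z ^+ k)) @ \oo --> complex.Im (cexp z).
Proof.
pose F := exp_sum (pow_re z); pose G := exp_sum (pow_im z).
pose a := complex.Re z; pose b := complex.Im z.
have dF (x : R) : is_derive x (1 : R) F (a * F x - b * G x).
  have := is_derive_exp_sum x (cabs_ge0 z) ler01 (pow_re_le z).
  congr is_derive; rewrite /F /G -mulNr -exp_sum_lin//; congr (exp_sum _ x).
  by apply/funext => k; rewrite /pow_re /pow_im exprS ReM mulNr.
have dG (x : R) : is_derive x (1 : R) G (a * G x + b * F x).
  have := is_derive_exp_sum x (cabs_ge0 z) ler01 (pow_im_le z).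
  congr is_derive; rewrite /F /G -exp_sum_lin//; congr (exp_sum _ x).
  by apply/funext => k; rewrite /pow_re /pow_im exprS ImM.
have dl (c x : R) : is_derive x (1 : R) (fun y : R => c * y) c.
  by apply: is_derive_eq; rewrite /GRing.scale /= mulr1 ?mulr0 ?addr0 ?add0r.
have de (x : R) : is_derive x (1 : R) (fun y : R => expR (- a * y)) (- a * expR (- a * x)).
  have d1 := dl (- a) x.
  by apply: is_derive_eq; rewrite /GRing.scale /= mulrC.
have dc (x : R) : is_derive x (1 : R) (fun y : R => cos (b * y)) (- b * sin (b * x)).
  have d1 := dl b x.
  by apply: is_derive_eq; rewrite /GRing.scale /=; ring.
have ds (x : R) : is_derive x (1 : R) (fun y : R => sin (b * y)) (b * cos (b * x)).
  have d1 := dl b x.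
  by apply: is_derive_eq; rewrite /GRing.scale /=; ring.
(* [A] and [B] are the real and imaginary parts of [e^(-z x) * (F x + i G x)]. Both have zero
   derivative, so they keep their values 1 and 0 from [x = 0]. *)
have eA : expR (- a * 1) * (cos (b * 1) * F 1 + sin (b * 1) * G 1) = 1.
  pose A (x : R) := expR (- a * x) * (cos (b * x) * F x + sin (b * x) * G x).
  have dA (x : R) : is_derive x (1 : R) A 0.
    have d1 := de x; have d2 := dc x; have d3 := ds x; have d4 := dF x; have d5 := dG x.
    by rewrite /A; apply: is_derive_eq; rewrite /GRing.scale /=; ring.
  rewrite -/(A 1) (is_derive_0_is_cst 1 0 dA) /A !mulr0 expR0 cos0 sin0.
  by rewrite /F exp_sum0 /pow_re /= mul0r !mul1r addr0.
have eB : expR (- a * 1) * (cos (b * 1) * G 1 - sin (b * 1) * F 1) = 0.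
  pose B (x : R) := expR (- a * x) * (cos (b * x) * G x - sin (b * x) * F x).
  have dB (x : R) : is_derive x (1 : R) B 0.
    have d1 := de x; have d2 := dc x; have d3 := ds x; have d4 := dF x; have d5 := dG x.
    by rewrite /B; apply: is_derive_eq; rewrite /GRing.scale /=; ring.
  rewrite -/(B 1) (is_derive_0_is_cst 1 0 dB) /B !mulr0 expR0 cos0 sin0.
  by rewrite /G exp_sum0 /pow_im /= !mul0r mulr0 subrr mulr0.
move: eA eB; rewrite !mulr1 => eA eB.
have cs : cos b ^+ 2 + sin b ^+ 2 = 1 by rewrite addrC sin2cos2 subrK.
have E : expR (- a) * expR a = 1 by rewrite -expRD addNr expR0.
have [F1 G1] : F 1 = complex.Re (cexp z) /\ G 1 = complex.Im (cexp z).
  rewrite /cexp /= -/a -/b; move: (F 1) (G 1) eA eB => f g eA eB; split.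
    have -> : f = expR (- a) * expR a * ((cos b ^+ 2 + sin b ^+ 2) * f) by rewrite E cs !mul1r.
    transitivity (expR a * cos b * (expR (- a) * (cos b * f + sin b * g)) -
       expR a * sin b * (expR (- a) * (cos b * g - sin b * f))); first by ring.
    by rewrite eA eB mulr0 subr0 mulr1.
  have -> : g = expR (- a) * expR a * ((cos b ^+ 2 + sin b ^+ 2) * g) by rewrite E cs !mul1r.
  transitivity (expR a * sin b * (expR (- a) * (cos b * f + sin b * g)) +
     expR a * cos b * (expR (- a) * (cos b * g - sin b * f))); first by ring.
  by rewrite eA eB mulr0 addr0 mulr1.
rewrite -F1 -G1; split.
- rewrite [X in X @ _ --> _](_ : _ = pseries (term (pow_re z)) 1); first exact: (@cvg_pow_re z 1).
  by apply/funext => m; apply: eq_bigr => k _ /=; rewrite /term expr1n mulr1 mulrC.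
- rewrite [X in X @ _ --> _](_ : _ = pseries (term (pow_im z)) 1); first exact: (@cvg_pow_im z 1).
  by apply/funext => m; apply: eq_bigr => k _ /=; rewrite /term expr1n mulr1 mulrC.
Qed.

End exponential_series.

Section slice.
Context (R : realType).
Variable I : quat R.
Hypothesis hI : I ^+ 2 = -1.
Implicit Types z w : R[i].

(** The embedding of the complex numbers that sends [i] to [I]. It is a ring morphism, so all kernel
    computations can be done in the commutative field [R[i]]. *)
Definition slice z : quat R := (complex.Re z)%:A + complex.Im z *: I.

Lemma sliceD z w : slice (z + w) = slice z + slice w.
Proof. by case: z w => [a b] [c d]; rewrite /slice /= !scalerDl addrACA. Qed.

Lemma sliceM z w : slice (z * w) = slice z * slice w.
Proof.
case: z w => [a b] [c d]; rewrite /slice /=.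
rewrite mulrDl !mulrDr -!scalerAl -!scalerAr !mul1r !mulr1 -expr2 hI.
rewrite !scalerA scalerN !scalerBl !scalerDl -!addrA; congr (_ + _).
by rewrite addrC -!addrA.
Qed.

Lemma slice_real (x : R) : slice (x%:C)%C = x%:A.
Proof. by rewrite /slice /= scale0r addr0. Qed.

Lemma sliceX z k : slice (z ^+ k) = slice z ^+ k.
Proof.
elim: k => [|k IH]; first by rewrite !expr0 (slice_real 1) scale1r.
by rewrite !exprS sliceM IH.
Qed.

Lemma sliceZ (x : R) z : slice ((x%:C)%C * z) = x *: slice z.
Proof. by rewrite sliceM slice_real -scalerAl mul1r. Qed.

(** Every quaternion component of a partial sum is a fixed combination of the real and imaginary
    partial sums, the coefficients being that component of 1 and of [I]. *)
Lemma quat_exp_slice z : quat_exp (slice z) = slice (cexp z).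
Proof.
have [cR cI] := cvg_cexp z.
have sE m : \sum_(0 <= k < m) (k`!%:R)^-1 *: slice z ^+ k =
    (\sum_(0 <= k < m) (k`!%:R)^-1 * complex.Re (z ^+ k))%:A +
    (\sum_(0 <= k < m) (k`!%:R)^-1 * complex.Im (z ^+ k)) *: I.
  rewrite !scaler_suml -big_split /=; apply: eq_bigr => k _.
  by rewrite -sliceX /slice scalerDr !scalerA.
rewrite /quat_exp /quat_lim /componentwise.
have cvgc (x y : R) : (fun m => (\sum_(0 <= k < m) (k`!%:R)^-1 * complex.Re (z ^+ k)) * x +
    (\sum_(0 <= k < m) (k`!%:R)^-1 * complex.Im (z ^+ k)) * y) @ \oo -->
    complex.Re (cexp z) * x + complex.Im (cexp z) * y.
  by apply: cvgD; apply: cvgM => //; exact: cvg_cst.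
have limc (c : quat R -> R) (x y : R) : (forall u v : R, c (u%:A + v *: I) = u * x + v * y) ->
    lim ((c \o (fun m => \sum_(0 <= k < m) (k`!%:R)^-1 *: slice z ^+ k)) @ \oo) =
    c (slice (cexp z)).
  move=> cE; apply: cvg_lim => //; rewrite /slice cE.
  rewrite [X in X @ _ --> _](_ : _ = (fun m => (\sum_(0 <= k < m) (k`!%:R)^-1 * complex.Re (z ^+ k)) * x +
    (\sum_(0 <= k < m) (k`!%:R)^-1 * complex.Im (z ^+ k)) * y)); first exact: cvgc.
  by apply/funext => m /=; rewrite sE cE.
rewrite (limc (@qre R) 1 (qre I))// (limc (@qi R) 0 (qi I))// (limc (@qj R) 0 (qj I))//.
by rewrite (limc (@qk R) 0 (qk I))//; case: (slice _).
Qed.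

End slice.
(** * Slice derivatives of the Bargmann transform *)

Section gaussian_kernel.
Context (R : realType).
Local Notation mu := (@lebesgue_measure R).
Local Notation C := R[i].
Local Notation "x %:C" := (real_complex R x).
Implicit Types (f g : R -> C) (p : {poly R}).

Definition cderiv f (s : R) (l : C) : Prop :=
  is_derive s (1 : R) (fun x => complex.Re (f x)) (complex.Re l) /\
  is_derive s (1 : R) (fun x => complex.Im (f x)) (complex.Im l).

Lemma cderiv_cst (c : C) s : cderiv (fun=> c) s 0.
Proof. by split; exact: is_derive_cst. Qed.

Lemma ReD (z w : C) : complex.Re (z + w) = complex.Re z + complex.Re w.
Proof. by case: z w => [? ?] [? ?]. Qed.

Lemma ImD (z w : C) : complex.Im (z + w) = complex.Im z + complex.Im w.
Proof. by case: z w => [? ?] [? ?]. Qed.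

Lemma cderivD f g s l m : cderiv f s l -> cderiv g s m -> cderiv (fun x => f x + g x) s (l + m).
Proof.
move=> [f1 f2] [g1 g2]; split.
- by under eq_fun do rewrite ReD; rewrite ReD; exact: is_deriveD f1 g1.
- by under eq_fun do rewrite ImD; rewrite ImD; exact: is_deriveD f2 g2.
Qed.

Lemma cderivM f g s l m : cderiv f s l -> cderiv g s m ->
  cderiv (fun x => f x * g x) s (l * g s + f s * m).
Proof.
move=> [f1 f2] [g1 g2]; split.
- under eq_fun do rewrite ReM.
  apply: (is_derive_eq (is_deriveB (is_deriveM f1 g1) (is_deriveM f2 g2))).
  rewrite /GRing.scale /=.
  case: l m (f s) (g s) {f1 f2 g1 g2} => [? ?] [? ?] [? ?] [? ?] /=; ring.
- under eq_fun do rewrite ImM.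
  apply: (is_derive_eq (is_deriveD (is_deriveM f1 g2) (is_deriveM f2 g1))).
  rewrite /GRing.scale /=.
  case: l m (f s) (g s) {f1 f2 g1 g2} => [? ?] [? ?] [? ?] [? ?] /=; ring.
Qed.

Lemma cderivC (h : R -> R) s (l : R) : is_derive s (1 : R) h l -> cderiv (fun x => (h x)%:C) s l%:C.
Proof. by move=> d; split => //=; exact: is_derive_cst. Qed.

Lemma cderiv_horner p f s l : cderiv f s l ->
  cderiv (fun x => (map_poly (real_complex R) p).[f x]) s
         ((map_poly (real_complex R) p^`()).[f s] * l).
Proof.
move=> fl; elim/poly_ind: p => [|p c IH].
  rewrite deriv0 rmorph0 horner0 mul0r; under eq_fun do rewrite horner0.
  exact: cderiv_cst.
rewrite rmorphD rmorphM /= map_polyC map_polyX.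
under eq_fun do rewrite hornerMXaddC.
have := cderivD (cderivM IH fl) (cderiv_cst c%:C s); congr cderiv.
by rewrite derivMXaddC rmorphD rmorphM /= map_polyX hornerD hornerM hornerX; ring.
Qed.

Lemma cderiv_cexp f s l : cderiv f s l -> cderiv (fun x => cexp (f x)) s (l * cexp (f s)).
Proof.
move=> [f1 f2].
have e1 := is_derive1_comp (is_derive_expR _) f1.
have c1 := is_derive1_comp (is_derive_cos _) f2.
have s1 := is_derive1_comp (is_derive_sin _) f2.
split.
- apply: (is_derive_eq (is_deriveM e1 c1)).
  by rewrite ReM /cexp /GRing.scale /=; ring.
- apply: (is_derive_eq (is_deriveM e1 s1)).
  by rewrite ImM /cexp /GRing.scale /=; ring.
Qed.

(* [hermite_poly c m = e^(c x^2 / 2) (d/dx)^m e^(- c x^2 / 2)]. *)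
Fixpoint hermite_poly (c : R) (m : nat) : {poly R} :=
  if m is k.+1 then (hermite_poly c k)^`() - c *: ('X * hermite_poly c k) else 1.
Local Notation he := (hermite_poly (2 * pi)).

Definition kernel_phase (q : C) (t : R) : C :=
  (2 * pi * Num.sqrt 2 * t)%:C * q - pi%:C * (q ^+ 2 + (t ^+ 2)%:C).

(* The [m]-th complex derivative in [q] of the Bargmann kernel. *)
Definition hermite_kernel m (q : C) (t : R) : C :=
  (map_poly (real_complex R) (he m)).[q - (Num.sqrt 2 * t)%:C] * cexp (kernel_phase q t).

Lemma cderiv_line (q d : C) s : cderiv (fun x => q + x%:C * d) s d.
Proof.
have h := cderivM (cderivC (is_derive_id s (1 : R))) (cderiv_cst d s).
have := cderivD (cderiv_cst q s) h; congr cderiv.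
by rewrite add0r mulr0 addr0 rmorph1 mul1r.
Qed.

(** The derivative of the phase in [q] is [- 2 pi (q - sqrt 2 t)], a multiple of the very argument
    of the polynomial. Differentiation thus reproduces the recursion that defines [hermite_poly]. *)
Lemma cderiv_hermite_kernel m (q d : C) t s :
  cderiv (fun x => hermite_kernel m (q + x%:C * d) t) s
         (d * hermite_kernel m.+1 (q + s%:C * d) t).
Proof.
have dq := cderiv_line q d s.
have dw := cderivD dq (cderiv_cst (- (Num.sqrt 2 * t)%:C) s).
have dk : cderiv (fun x => kernel_phase (q + x%:C * d) t) s
   ((2 * pi * Num.sqrt 2 * t)%:C * d - pi%:C * (2 * (q + s%:C * d) * d)).
  have := cderivD (cderivM (cderiv_cst (2 * pi * Num.sqrt 2 * t)%:C s) dq)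
    (cderivM (cderiv_cst (- pi%:C) s) (cderivD (cderivM dq dq) (cderiv_cst (t ^+ 2)%:C s))).
  rewrite (_ : (fun x => _) = (fun x => kernel_phase (q + x%:C * d) t)).
    by congr cderiv; ring.
  by apply/funext => x; rewrite /kernel_phase expr2 mulNr.
have := cderivM (cderiv_horner (he m) dw) (cderiv_cexp dk); congr cderiv.
rewrite /hermite_kernel /= addr0 rmorphB /= hornerD hornerN map_polyZ [map_poly _ ('X * _)]rmorphM/= map_polyX hornerZ hornerM hornerX.
rewrite !rmorphM /=; set u := _.[_]; set v := _.[_]; set e := cexp _.
move: u v e; rewrite (_ : 2%:C = 2); last by rewrite rmorph_nat.
move: (q + s%:C * d) => w; have h2 : (Num.sqrt 2)%:C * (Num.sqrt 2)%:C = 2 :> C.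
  by rewrite -rmorphM -expr2 sqr_sqrtr// rmorph_nat.
move: h2; set r := (Num.sqrt 2)%:C => h2 u v e; ring.
Qed.

Lemma cderiv_continuous f : (forall s, exists l, cderiv f s l) ->
  continuous (fun x => complex.Re (f x)) /\ continuous (fun x => complex.Im (f x)).
Proof.
move=> df; split=> s; have [l [d1 d2]] := df s;
  by apply: differentiable_continuous; apply/derivable1_diffP; apply: ex_derive.
Qed.

Lemma continuous_hermite_kernel m q :
  continuous (fun t => complex.Re (hermite_kernel m q t)) /\
  continuous (fun t => complex.Im (hermite_kernel m q t)).
Proof.
apply: cderiv_continuous => s.
have dt := cderivC (is_derive_id s (1 : R)).
have dw : cderiv (fun x => q - (Num.sqrt 2 * x)%:C) s (0 + (0 * s%:C + (- Num.sqrt 2)%:C * 1%:C)).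
  have := cderivD (cderiv_cst q s) (cderivM (cderiv_cst (- Num.sqrt 2)%:C s) dt).
  by congr cderiv; apply/funext => x; rewrite -rmorphM mulNr rmorphN.
have dk : exists l, cderiv (kernel_phase q) s l.
  have := cderivD (cderivM (cderiv_cst ((2 * pi * Num.sqrt 2)%:C * q) s) dt)
    (cderivM (cderiv_cst (- pi%:C) s) (cderivD (cderiv_cst (q ^+ 2) s) (cderivM dt dt))).
  rewrite (_ : (fun x => _) = kernel_phase q); first by move=> h; eexists; exact: h.
  by apply/funext => x; rewrite /kernel_phase (rmorphM _ _ x) (rmorphXn _ 2 x)/=; ring.
case: dk => l dk; eexists; exact: cderivM (cderiv_horner (he m) dw) (cderiv_cexp dk).
Qed.

Lemma cpoly_expR_bound p :
  exists A c : R, [/\ 0 <= A, 0 <= c & forall w : C,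
    cabs (map_poly (real_complex R) p).[w] <= A * expR (c * cabs w)].
Proof.
elim/poly_ind: p => [|p a [A [c [A0 c0 Ac]]]].
  by exists 0, 0; split=> // w; rewrite rmorph0 horner0 /cabs /= normr0 addr0 mul0r.
exists (A + `|a|), (c + 1); split; rewrite ?addr_ge0// => w.
rewrite rmorphD rmorphM /= map_polyC map_polyX hornerMXaddC.
apply: (le_trans (cabsD _ _)); rewrite mulrDl; apply: lerD.
  apply: le_trans (cabsM _ _) _; rewrite [(c + 1) * _]mulrDl mul1r expRD mulrA; apply: ler_pM; rewrite ?cabs_ge0//.
  by rewrite (le_trans _ (expR_ge1Dx _))// lerDr.
rewrite {1}/cabs /= normr0 addr0 ler_peMr// -expR0 ler_expR mulr_ge0 ?cabs_ge0// addr_ge0//.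
Qed.

Lemma cabs_cexp (z : C) : cabs (cexp z) <= 2 * expR (complex.Re z).
Proof.
rewrite /cabs /cexp /= !normrM (ger0_norm (expR_ge0 _)) -mulrDr mulrC ler_wpM2r ?expR_ge0//.
by have := cos_max (complex.Im z); have := sin_max (complex.Im z); lra.
Qed.

Lemma Re_kernel_phase (U t : R) q : cabs q <= U ->
  complex.Re (kernel_phase q t) <= 2 * pi * Num.sqrt 2 * U * `|t| + pi * U ^+ 2 - pi * t ^+ 2.
Proof.
case: q => [u v]; rewrite /cabs /kernel_phase /= => qU.
rewrite /= !mul0r !subr0.
have uU : `|u| <= U by apply: le_trans qU; rewrite lerDl.
have vU : v ^+ 2 <= U ^+ 2.
  rewrite -(real_normK (num_real v)) ler_pXn2r ?nnegrE//; last exact: le_trans uU.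
  by apply: le_trans qU; rewrite lerDr.
have tu : t * u <= U * `|t|.
  by apply: le_trans (ler_norm _) _; rewrite normrM mulrC ler_wpM2r.
have p0 := pi_ge0 R.
have : 0 <= 2 * pi * Num.sqrt 2 * (U * `|t| - t * u) by rewrite !mulr_ge0// subr_ge0.
have : 0 <= pi * (U ^+ 2 - v ^+ 2) by rewrite mulr_ge0// subr_ge0.
have : 0 <= pi * (u ^+ 2) by rewrite mulr_ge0// sqr_ge0.
rewrite -!(expr2 _) => h1 h2 h3.
move: h1 h2 h3; move: (@pi R) (Num.sqrt 2) `|t| => P S n.
lra.
Qed.

(** One Gaussian dominates the kernel for all [q] in a bounded region, as differentiation under the
    integral demands. *)
Lemma hermite_kernel_bound m (U : R) : exists A : R, 0 <= A /\ forall q t, cabs q <= U ->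
  cabs (hermite_kernel m q t) <= A * expR (- (pi / 2 * t ^+ 2)).
Proof.
have [A [c [A0 c0 Ac]]] := cpoly_expR_bound (he m).
(* The total linear rate in [|t|], from the polynomial and from the cross term of the phase;
   [expR_lin_sq] absorbs it at the cost of half the Gaussian. *)
pose k := c * Num.sqrt 2 + 2 * pi * Num.sqrt 2 * U.
pose B := A * expR (c * U) * (2 * expR (pi * U ^+ 2)).
have B0 : 0 <= B by rewrite !mulr_ge0// ?expR_ge0.
exists (B * expR (k ^+ 2 / (2 * pi))); split; first by rewrite mulr_ge0 ?expR_ge0.
move=> q t qU; apply: le_trans (cabsM _ _) _.
have h1 : cabs (map_poly (real_complex R) (he m)).[q - (Num.sqrt 2 * t)%:C] <=
    A * expR (c * U) * expR (c * Num.sqrt 2 * `|t|).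
  apply: le_trans (Ac _) _; rewrite -[leRHS]mulrA -expRD; apply: ler_wpM2l => //.
  rewrite ler_expR -mulrA -mulrDr ler_wpM2l//.
  apply: le_trans (cabsD _ _) _; apply: lerD => //.
  by rewrite {1}/cabs /= oppr0 normr0 addr0 normrN normrM ger0_norm.
have h2 : cabs (cexp (kernel_phase q t)) <= 2 * expR (pi * U ^+ 2) *
    (expR (2 * pi * Num.sqrt 2 * U * `|t|) * expR (- (pi * t ^+ 2))).
  apply: le_trans (cabs_cexp _) _; rewrite -mulrA ler_wpM2l// -!expRD ler_expR.
  by apply: le_trans (Re_kernel_phase t qU) _; rewrite addrCA addrA.
apply: le_trans (ler_pM (cabs_ge0 _) (cabs_ge0 _) h1 h2) _.
have h3 := expR_lin_sq k (pi_gt0 R) t.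
apply: (@le_trans _ _ (B * (expR (k * `|t|) * expR (- (pi * t ^+ 2))))); last first.
  by rewrite -mulrA ler_wpM2l.
rewrite /k (mulrDl (c * Num.sqrt 2)) expRD /B le_eqVlt; apply/orP; left; apply/eqP; ring.
Qed.

End gaussian_kernel.

Section kernel_integral.
Context (R : realType).
Local Notation mu := (@lebesgue_measure R).
Local Notation C := R[i].
Local Notation "x %:C" := (real_complex R x).
Variables a b : R -> R.
Hypotheses (ma : measurable_fun setT a) (mb : measurable_fun setT b).
Hypothesis a2 : mu.-integrable setT (EFin \o (fun t => a t ^+ 2)).
Hypothesis b2 : mu.-integrable setT (EFin \o (fun t => b t ^+ 2)).

(* A real component of [z * f t], when [a] and [b] are that component of [f] and
   of [I * f]. *)
Definition pairing (z : C) (t : R) : R := complex.Re z * a t + complex.Im z * b t.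

Lemma pairing_le z t : `|pairing z t| <= cabs z * (`|a t| + `|b t|).
Proof.
apply: le_trans (ler_normD _ _) _; rewrite !normrM /cabs.
by rewrite mulrDr; apply: lerD; rewrite ler_wpM2r// ?lerDl ?lerDr.
Qed.

Lemma integrable_gauss_abs :
  mu.-integrable setT (EFin \o (fun t => expR (- (pi / 2 * t ^+ 2)) * (`|a t| + `|b t|))).
Proof.
have mg : measurable_fun setT (fun t : R => expR (- (pi / 2 * t ^+ 2))).
  by apply: continuous_measurable_fun; exact: continuous_expR_sq.
have g2 : mu.-integrable setT (EFin \o (fun t : R => expR (- (pi / 2 * t ^+ 2)) ^+ 2)).
  have := @integrable_expR_sq R pi 0 (pi_gt0 R); congr (_.-integrable _ _).
  apply/funext => t /=; congr EFin; rewrite subr0 [RHS]expr2 -expRD; congr expR.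
  by rewrite -opprD -mulrDl -splitr.
have h (f : R -> R) : measurable_fun setT f -> mu.-integrable setT (EFin \o (fun t => f t ^+ 2)) ->
    mu.-integrable setT (EFin \o (fun t => expR (- (pi / 2 * t ^+ 2)) * `|f t|)).
  move=> mf f2; apply: rintegrable_mul => //; first exact: measurableT_comp.
  by move: f2; congr (_.-integrable _ _); apply/funext => t /=; rewrite real_normK ?num_real.
have := rintegrableD measurableT (h _ ma a2) (h _ mb b2); congr (_.-integrable _ _).
by apply/funext => t /=; rewrite mulrDr.
Qed.

Lemma measurable_pairing (f : R -> C) : measurable_fun setT (fun t => complex.Re (f t)) ->
  measurable_fun setT (fun t => complex.Im (f t)) -> measurable_fun setT (fun t => pairing (f t) t).
Proof. by move=> m1 m2; apply: measurable_funD; exact: measurable_funM. Qed.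

Lemma measurable_kernel m (q d : C) :
  measurable_fun setT (fun t => complex.Re (d * hermite_kernel m q t)) /\
  measurable_fun setT (fun t => complex.Im (d * hermite_kernel m q t)).
Proof.
have [c1 c2] := continuous_hermite_kernel m q.
have m1 := continuous_measurable_fun c1; have m2 := continuous_measurable_fun c2.
split.
- under eq_fun do rewrite ReM.
  by apply: measurable_funB; apply: measurable_funM.
- under eq_fun do rewrite ImM.
  by apply: measurable_funD; apply: measurable_funM.
Qed.

Lemma integrable_kernel_pairing m (q d : C) :
  mu.-integrable setT (EFin \o (fun t => pairing (d * hermite_kernel m q t) t)).
Proof.
have [A [A0 AP]] := hermite_kernel_bound m (cabs q).
have [m1 m2] := measurable_kernel m q d.
apply: (@rintegrable_le _ _ _ mu setT _ _ measurableT _ _ (rintegrableZ (cabs d * A) measurableT integrable_gauss_abs)).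
  exact: measurable_pairing.
move=> t _; apply: le_trans (pairing_le _ _) _; rewrite mulrA ler_wpM2r ?addr_ge0//.
apply: le_trans (cabsM _ _) _; rewrite -mulrA ler_wpM2l ?cabs_ge0//; exact: AP.
Qed.

Definition kernel_integral m (d q : C) : R := \int[mu]_t pairing (d * hermite_kernel m q t) t.

Lemma kernel_integral_derive m (c q d : C) (s : R) :
  derive1 (fun x => kernel_integral m c (q + x%:C * d)) s =
  kernel_integral m.+1 (c * d) (q + s%:C * d).
Proof.
pose f (x t : R) := pairing (c * hermite_kernel m (q + x%:C * d) t) t.
have df (x t : R) : is_derive x (1 : R) (f^~ t) (pairing (c * d * hermite_kernel m.+1 (q + x%:C * d) t) t).
  have [d1 d2] := cderivM (cderiv_cst c x) (cderiv_hermite_kernel m q d t x).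
  have e1 := is_deriveM d1 (is_derive_cst (a t) x (1 : R)).
  have e2 := is_deriveM d2 (is_derive_cst (b t) x (1 : R)).
  apply: (is_derive_eq (is_deriveD e1 e2)).
  by rewrite /GRing.scale /= !mulr0 !add0r mul0r add0r mulrA mulrC (mulrC (b t)).
(* Bounds [q + x d] for all [x] within distance 1 of [s], the interval used for domination. *)
pose U := cabs q + (`|s| + 1) * cabs d.
have [A [A0 AP]] := hermite_kernel_bound m.+1 U.
pose G t := cabs (c * d) * A * (expR (- (pi / 2 * t ^+ 2)) * (`|a t| + `|b t|)).
have xU (x : R) : `]s - 1, s + 1[%classic x -> cabs (q + x%:C * d) <= U.
  rewrite /= in_itv/= => xs; apply: le_trans (cabsD _ _) _; rewrite lerD2l.
  apply: le_trans (cabsM _ _) _; rewrite ler_wpM2r ?cabs_ge0//.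
  rewrite /cabs /= normr0 addr0 (_ : x = s + (x - s)); last by rewrite addrC subrK.
  apply: le_trans (ler_normD _ _) _; rewrite lerD2l ler_norml; case/andP: xs; lra.
have h := @differentiation_under_integral R _ _ mu f setT measurableT s (s - 1) (s + 1).
rewrite /kernel_integral -/(f _ _).
have -> : (fun x => \int[mu]_t f x t) = (fun x => \int[mu]_(t in setT) f x t) by [].
rewrite (h _ _ _ G).
- by apply: eq_Rintegral => t _; rewrite partial1of2E; have d1 := df s t; exact: derive_val.
- by rewrite /= in_itv/=; lra.
- by move=> x _; exact: integrable_kernel_pairing.
- by move=> x t _ _; have d1 := df x t; exact: ex_derive.
- by move=> t; rewrite !mulr_ge0 ?cabs_ge0 ?expR_ge0 ?addr_ge0.
- by have := rintegrableZ (cabs (c * d) * A) measurableT integrable_gauss_abs.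
- move=> x t /xU xs _; rewrite partial1of2E; have d1 := df x t; rewrite derive_val.
  apply: le_trans (pairing_le _ _) _; rewrite /G mulrA ler_wpM2r ?addr_ge0//.
  apply: le_trans (cabsM _ _) _; rewrite -mulrA ler_wpM2l ?cabs_ge0//; exact: AP.
Qed.

End kernel_integral.

(** * Square-integrable quaternion-valued functions and their integrals *)

Section square_integrable.
Context (R : realType).
Local Notation mu := (lebesgue_R R).

Definition square_integrable (f : R -> R) : Prop :=
  measurable_fun setT (f : measurableTypeR R -> R) /\ mu.-integrable setT (EFin \o (fun t => f t ^+ 2)).

Lemma square_integrableD f g : square_integrable f -> square_integrable g ->
  square_integrable (fun t => f t + g t).
Proof.
move=> [mf f2] [mg g2]; split; first exact: measurable_funD.
have i := rintegrableZ 2 measurableT (rintegrableD measurableT f2 g2).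
apply: (rintegrable_le measurableT _ _ i).
  by apply: measurable_funX; exact: measurable_funD.
move=> z _; rewrite ger0_norm ?sqr_ge0//; have := sqr_ge0 (f z - g z); nra.
Qed.

Lemma square_integrableZ (r : R) f : square_integrable f -> square_integrable (fun t => r * f t).
Proof.
move=> [mf f2]; split; first exact: measurable_funM.
have := rintegrableZ (r ^+ 2) measurableT f2; congr (_.-integrable _ _).
by apply/funext => t /=; rewrite exprMn.
Qed.

Lemma quat_mull_square_integrable (p : quat R) (f : R -> quat R) :
  all_components square_integrable f -> all_components square_integrable (fun t => p * f t).
Proof.
move=> [f0 f1 f2 f3].
have comb (a b c d : R) (g : R -> R) :
    (forall t, g t = a * (@qre R \o f) t + b * (@qi R \o f) t + c * (@qj R \o f) t + d * (@qk R \o f) t) ->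
    square_integrable g.
  move=> gE; have -> : g = (fun t => a * (@qre R \o f) t + b * (@qi R \o f) t + c * (@qj R \o f) t + d * (@qk R \o f) t).
    exact/funext.
  apply: square_integrableD (square_integrableZ d f3); apply: square_integrableD (square_integrableZ c f2).
  exact: square_integrableD (square_integrableZ a f0) (square_integrableZ b f1).
split.
- apply: (comb (qre p) (- qi p) (- qj p) (- qk p)) => t /=; ring.
- apply: (comb (qi p) (qre p) (- qk p) (qj p)) => t /=; ring.
- apply: (comb (qj p) (qk p) (qre p) (- qi p)) => t /=; ring.
- apply: (comb (qk p) (- qj p) (qi p) (qre p)) => t /=; ring.
Qed.

Lemma quat_norm_sq (q : quat R) :
  quat_norm q ^+ 2 = qre q ^+ 2 + qi q ^+ 2 + qj q ^+ 2 + qk q ^+ 2.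
Proof. by rewrite sqr_sqrtr// !addr_ge0// sqr_ge0. Qed.

Lemma Lnorm2E (f : R -> R) :
  Lnorm mu 2%:E (fun t => (f t)%:E) = poweR (\int[mu]_t (f t ^+ 2)%:E)%E 2^-1.
Proof.
rewrite unlock; congr poweR; apply: eq_integral => t _.
by rewrite abse_EFin poweR_EFin powR_mulrn// real_normK ?num_real.
Qed.

Lemma quat_L2normE (f : R -> quat R) :
  quat_L2norm f = poweR (\int[mu]_t (quat_norm (f t) ^+ 2)%:E)%E 2^-1.
Proof. exact: Lnorm2E. Qed.

Lemma quat_L2_components (f : R -> quat R) : quat_L2 f -> all_components square_integrable f.
Proof.
move=> [[m0 m1 m2 m3]]; rewrite quat_L2normE => /lty_poweRy h.
have /h fin : 2^-1 != 0 :> R by rewrite invr_neq0.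
have sq (c : quat R -> R) : (forall q, c q ^+ 2 <= quat_norm q ^+ 2) ->
    measurable_fun setT ((c \o f) : measurableTypeR R -> R) -> square_integrable (c \o f).
  move=> cq mc; split => //; apply/integrableP; split.
    by apply/measurable_EFinP; exact: measurable_funX.
  apply: le_lt_trans fin; apply: ge0_le_integral => //.
  - by apply: measurableT_comp => //; apply/measurable_EFinP; exact: measurable_funX.
  - apply/measurable_EFinP; under eq_fun do rewrite quat_norm_sq.
    apply: measurable_funD; last exact: measurable_funX.
    apply: measurable_funD; last exact: measurable_funX.
    by apply: measurable_funD; exact: measurable_funX.
  - by move=> t _; rewrite lee_fin /= ger0_norm ?sqr_ge0.
by split; apply: sq => // q; rewrite quat_norm_sq; have := sqr_ge0 (qre q);
  have := sqr_ge0 (qi q); have := sqr_ge0 (qj q); have := sqr_ge0 (qk q); lra.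
Qed.

End square_integrable.

Section quat_integral_theory.
Context (R : realType) disp (T : measurableType disp) (m : {measure set T -> \bar R}).

Lemma quat_integralMl (p : quat R) (G : T -> quat R) : quat_integrable m setT G ->
  quat_integral m setT (fun t => p * G t) = p * quat_integral m setT G.
Proof.
move=> [g0 g1 g2 g3].
have comb (a b c d : R) (g : T -> R) :
    (forall t, g t = a * (@qre R \o G) t + b * (@qi R \o G) t + c * (@qj R \o G) t + d * (@qk R \o G) t) ->
    Rintegral m setT g = a * Rintegral m setT (@qre R \o G) + b * Rintegral m setT (@qi R \o G) +
      c * Rintegral m setT (@qj R \o G) + d * Rintegral m setT (@qk R \o G).
  move=> gE; have -> : g = (fun t => a * (@qre R \o G) t + b * (@qi R \o G) t + c * (@qj R \o G) t + d * (@qk R \o G) t).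
    exact/funext.
  have i0 := rintegrableZ a measurableT g0; have i1 := rintegrableZ b measurableT g1.
  have i2 := rintegrableZ c measurableT g2; have i3 := rintegrableZ d measurableT g3.
  have i01 := rintegrableD measurableT i0 i1; have i012 := rintegrableD measurableT i01 i2.
  by rewrite !RintegralD// !RintegralZl.
rewrite /quat_integral /componentwise; congr Quat => /=.
- rewrite (comb (qre p) (- qi p) (- qj p) (- qk p)) => [|t /=]; ring.
- rewrite (comb (qi p) (qre p) (- qk p) (qj p)) => [|t /=]; ring.
- rewrite (comb (qj p) (qk p) (qre p) (- qi p)) => [|t /=]; ring.
- rewrite (comb (qk p) (- qj p) (qi p) (qre p)) => [|t /=]; ring.
Qed.

Lemma quat_integralD (G G' : T -> quat R) : quat_integrable m setT G -> quat_integrable m setT G' ->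
  quat_integral m setT (fun t => G t + G' t) = quat_integral m setT G + quat_integral m setT G'.
Proof.
move=> [g0 g1 g2 g3] [h0 h1 h2 h3].
by rewrite /quat_integral /componentwise; congr Quat => /=; rewrite -RintegralD.
Qed.

Lemma eq_quat_integral (G G' : T -> quat R) : G =1 G' ->
  quat_integral m setT G = quat_integral m setT G'.
Proof. by move=> /funext ->. Qed.

End quat_integral_theory.

Section imaginary_unit.
Context (R : realType).
Variable I : quat R.
Hypothesis hI : I ^+ 2 = -1.

(** If the real part were nonzero, the imaginary components of [I ^+ 2 = -1] would make [I] real,
    and no real number has square -1. *)
Lemma qre_imaginary_unit : qre I = 0.
Proof.
move: hI; case: I => a b c d; rewrite expr2 => -[/= e0 e1 e2 e3].
have [//|a0] := eqVneq a 0.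
have z (x : R) : a * x + x * a = 0 -> x = 0.
  by rewrite (mulrC x) -mulr2n => /eqP; rewrite mulrn_eq0/= mulf_eq0 (negbTE a0)/= => /eqP.
have b0 : b = 0 by apply: z; move: e1; rewrite oppr0; lra.
have c0 : c = 0 by apply: z; move: e2; rewrite oppr0; lra.
have d0 : d = 0 by apply: z; move: e3; rewrite oppr0; lra.
by move: e0; rewrite b0 c0 d0; have := sqr_ge0 a; nra.
Qed.

Lemma quat_norm_imaginary_unit (x : R) : quat_norm (x *: I) = `|x|.
Proof.
rewrite -sqrtr_sqr; congr Num.sqrt; have := qre_imaginary_unit.
move: hI; case: I => a b c d; rewrite expr2 => -[/= e0 e1 e2 e3] a0.
rewrite a0 in e0 *; rewrite mulr0 expr0n /= add0r !exprMn -!mulrDr -[RHS]mulr1; congr (_ * _).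
lra.
Qed.

Lemma quat_im_slice (z : R[i]) : quat_im (slice I z) = complex.Im z *: I.
Proof.
have := qre_imaginary_unit; case: I => a b c d /= ->.
by rewrite /quat_im /slice /=; congr Quat => /=; rewrite ?mulr0 ?add0r.
Qed.

Lemma qre_slice (z : R[i]) : qre (slice I z) = complex.Re z.
Proof. by rewrite /slice /= qre_imaginary_unit mulr0 addr0 mulr1. Qed.

Lemma quat_conj_slice (z : R[i]) : quat_conj (slice I z) = slice I (conjc z).
Proof.
have := qre_imaginary_unit; case: z I => [x y] [a b c d] /= ->.
by rewrite /quat_conj /slice /=; congr Quat => /=; rewrite ?mulr0 ?add0r ?mulr1 ?mulNr.
Qed.

End imaginary_unit.

(** * Iterated slice derivatives of the Bargmann transform *)

Section bargmann_jets.
Context (R : realType).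
Local Notation mu := (lebesgue_R R).
Local Notation C := R[i].
Local Notation "x %:C" := (real_complex R x).
Variable I : quat R.
Hypothesis hI : I ^+ 2 = -1.
Variable phi : R -> quat R.
Hypothesis hphi : all_components (@square_integrable R) phi.
Local Notation slice := (slice I).

Let hIphi : all_components (@square_integrable R) (fun t => I * phi t).
Proof. exact: quat_mull_square_integrable. Qed.

Lemma slice_mul (z : C) (p : quat R) :
  slice z * p = complex.Re z *: p + complex.Im z *: (I * p).
Proof. by rewrite /slice mulrDl -!scalerAl mul1r. Qed.

(** The factor [c] sits inside the integral so as to collect both left scalars from the slice and
    the directions of successive derivatives. *)
Definition bargmann_jet m (c q : C) : quat R :=
  quat_integral mu setT (fun t => slice (c * hermite_kernel m q t) * phi t).

Lemma bargmann_jetE m c q : bargmann_jet m c q = Quat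
  (kernel_integral (@qre R \o phi) (fun t => qre (I * phi t)) m c q)
  (kernel_integral (@qi R \o phi) (fun t => qi (I * phi t)) m c q)
  (kernel_integral (@qj R \o phi) (fun t => qj (I * phi t)) m c q)
  (kernel_integral (@qk R \o phi) (fun t => qk (I * phi t)) m c q).
Proof.
rewrite /bargmann_jet /quat_integral /componentwise; congr Quat;
  by apply: eq_Rintegral => t _; rewrite /comp slice_mul.
Qed.

Lemma quat_integrable_jet m c q :
  quat_integrable mu setT (fun t => slice (c * hermite_kernel m q t) * phi t).
Proof.
have [[m0 i0] [m1 i1] [m2 i2] [m3 i3]] := hphi.
have [[n0 j0] [n1 j1] [n2 j2] [n3 j3]] := hIphi.
split; [move: (integrable_kernel_pairing m0 n0 i0 j0 m q c)|move: (integrable_kernel_pairing m1 n1 i1 j1 m q c)|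
        move: (integrable_kernel_pairing m2 n2 i2 j2 m q c)|move: (integrable_kernel_pairing m3 n3 i3 j3 m q c)];
  by congr (_.-integrable _ _); apply/funext => t; rewrite /comp slice_mul.
Qed.

Lemma bargmann_jet_mull m c d q : slice d * bargmann_jet m c q = bargmann_jet m (d * c) q.
Proof.
rewrite /bargmann_jet -quat_integralMl; last exact: quat_integrable_jet.
by apply: eq_quat_integral => t; rewrite mulrA -sliceM// mulrA.
Qed.

Lemma bargmann_jet_derive m c q d s :
  quat_derive (fun x => bargmann_jet m c (q + x%:C * d)) s = bargmann_jet m.+1 (c * d) (q + s%:C * d).
Proof.
have [[m0 i0] [m1 i1] [m2 i2] [m3 i3]] := hphi.
have [[n0 j0] [n1 j1] [n2 j2] [n3 j3]] := hIphi.
have -> : (fun x => bargmann_jet m c (q + x%:C * d)) = (fun x => Quat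
    (kernel_integral (@qre R \o phi) (fun t => qre (I * phi t)) m c (q + x%:C * d))
    (kernel_integral (@qi R \o phi) (fun t => qi (I * phi t)) m c (q + x%:C * d))
    (kernel_integral (@qj R \o phi) (fun t => qj (I * phi t)) m c (q + x%:C * d))
    (kernel_integral (@qk R \o phi) (fun t => qk (I * phi t)) m c (q + x%:C * d))).
  by apply/funext => x; exact: bargmann_jetE.
rewrite bargmann_jetE.
rewrite -(kernel_integral_derive m0 n0 i0 j0) -(kernel_integral_derive m1 n1 i1 j1).
by rewrite -(kernel_integral_derive m2 n2 i2 j2) -(kernel_integral_derive m3 n3 i3 j3).
Qed.

Lemma bargmann_slice q : bargmann phi (slice q) = bargmann_jet 0 (2 `^ (3 / 4))%:C q.
Proof.
have ii := quat_integrable_jet 0 1 q.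
transitivity (slice (2 `^ (3 / 4))%:C * bargmann_jet 0 1 q); last first.
  by rewrite bargmann_jet_mull mulr1.
rewrite /bargmann -mulr_algl -(slice_real I); congr (_ * _).
apply: eq_quat_integral => t; rewrite mul1r /hermite_kernel /= rmorph1 hornerC mul1r.
rewrite -(quat_exp_slice hI (kernel_phase q t)).
suff -> : slice (kernel_phase q t) =
  (2 * pi * Num.sqrt 2 * t) *: slice q - pi *: (slice q ^+ 2 + (t ^+ 2)%:A) by [].
rewrite /kernel_phase sliceD (sliceZ hI) -mulNr -rmorphN (sliceZ hI) sliceD (sliceX hI) slice_real.
by rewrite scaleNr.
Qed.

(** The lines along which [sderive] differentiates stay in the slice through the point, so knowing
    [f] on the slice of [I] is enough for an induction on [m]. *)
Lemma sderive_slice m c (f : quat R -> quat R) :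
  (forall q, f (slice q) = bargmann_jet m c q) ->
  forall q, sderive f (slice q) = bargmann_jet m.+1 c q.
Proof.
move=> fE q; rewrite /sderive quat_im_slice// qre_slice//.
have q_re (x : R) : x%:A = slice x%:C :> quat R by rewrite slice_real.
case: ifPn => [/eqP v0|v0].
  have Imq0 : complex.Im q = 0.
    by have := quat_norm_imaginary_unit hI (complex.Im q); rewrite v0 => /esym/eqP;
      rewrite /quat_norm /= !expr0n /= !addr0 sqrtr0 normr_eq0 => /eqP.
  have -> : (fun s => f s%:A) = (fun s => bargmann_jet m c (0 + s%:C * 1)).
    by apply/funext => s; rewrite q_re fE add0r mulr1.
  rewrite bargmann_jet_derive !mulr1 add0r; congr (bargmann_jet _ _ _).
  by rewrite [RHS]complexE Imq0 rmorph0 mulr0 addr0.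
rewrite quat_norm_imaginary_unit//.
have Imq0 : complex.Im q != 0 by apply: contraNneq v0 => ->; rewrite scale0r.
(* The unit used by [sderive] is [I] or [- I] according to the sign of [v]; [e] is the matching [i]
   or [- i]. *)
set v := complex.Im q in v0 Imq0 *; pose e : C := (0 +i* (`|v|^-1 * v))%C.
have -> : `|v|^-1 *: (v *: I) = slice e by rewrite /slice /= scale0r add0r scalerA.
have e2 : e * e = -1.
  apply/eqP; rewrite eq_complex /= !mul0r !mulr0 addr0 sub0r oppr0 eqxx andbT.
  rewrite eqr_opp mulrACA -!expr2 -[X in _ * X](real_normK (num_real v)) exprVn.
  by rewrite mulVf// expf_eq0/= normr_eq0.
have qE : (complex.Re q)%:C + `|v|%:C * e = q.
  rewrite [RHS]complexE; congr (_ + _); apply/eqP; rewrite eq_complex /=.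
  by rewrite !mul0r !mulr0 !subr0 !mul1r addr0 add0r mulVKf ?normr_eq0// !eqxx.
have -> : (fun s => f (s%:A + `|v| *: slice e)) =
    (fun s => bargmann_jet m c (`|v|%:C * e + s%:C * 1)).
  by apply/funext => s; rewrite q_re -sliceZ// -sliceD fE mulr1 addrC.
have -> : (fun s => f ((complex.Re q)%:A + s *: slice e)) =
    (fun s => bargmann_jet m c ((complex.Re q)%:C + s%:C * e)).
  by apply/funext => s; rewrite q_re -sliceZ// -sliceD fE.
rewrite !bargmann_jet_derive !mulr1 (addrC (_ * e)) qE bargmann_jet_mull.
(* The chain rule gives one factor [e], left multiplication by the unit a second one. As
   [e * e = -1], the two terms of [sderive] coincide and the factor one half restores a single
   jet. *)
rewrite (_ : e * (c * e) = (-1)%:C * c); last by rewrite mulrCA e2 rmorphN rmorph1 mulrC.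
rewrite -bargmann_jet_mull slice_real mulr_algl scaleN1r opprK.
rewrite -[X in X + X]scale1r -scalerDl scalerA.
by rewrite mulVf ?scale1r// pnatr_eq0.
Qed.

Lemma iter_sderive_bargmann m q :
  iter m (@sderive R) (bargmann phi) (slice q) = bargmann_jet m (2 `^ (3 / 4))%:C q.
Proof.
elim: m q => [|m IH] q; first exact: bargmann_slice.
by rewrite iterS; exact: sderive_slice.
Qed.

End bargmann_jets.
(** * Hermite polynomials and the window *)

Section hermite_polynomials.
Context (R : realType).
Local Notation mu := (@lebesgue_measure R).
Implicit Types (c : R) (p : {poly R}).

(** The Appell property: differentiation lowers the index by one. It drives both the addition
    formula and the norm computation. *)
Lemma deriv_hermite_poly c m :
  (hermite_poly c m.+1)^`() = (- (c * m.+1%:R))%:P * hermite_poly c m.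
Proof.
elim: m => [|m IH].
  by rewrite /= (derivC 1) sub0r !mulr1 derivN derivZ derivX alg_polyC polyCN.
have h : hermite_poly c m.+1 = (hermite_poly c m)^`() - c%:P * ('X * hermite_poly c m).
  by rewrite mul_polyC.
have -> : hermite_poly c m.+2 = (hermite_poly c m.+1)^`() - c%:P * ('X * hermite_poly c m.+1).
  by rewrite mul_polyC.
have -> : - (c * m.+2%:R) = - (c * m.+1%:R) - c by rewrite -[m.+2]addn1 natrD; ring.
rewrite derivB !derivM derivC derivX IH derivM derivC polyCB [in RHS]mulrBl.
by rewrite [X in _ = _ * X - _]h; ring.
Qed.

Lemma size_hermite_poly c m : (size (hermite_poly c m) <= m.+1)%N.
Proof.
elim: m => [|m IH]; first by rewrite size_poly1.
rewrite [hermite_poly c m.+1]/=; apply: (leq_trans (size_polyD _ _)); rewrite geq_max size_polyN; apply/andP; split.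
  by apply: (leq_trans (size_poly _ _)); rewrite (leq_trans (leq_pred _))// (leq_trans IH).
apply: (leq_trans (size_scale_leq _ _)); apply: (leq_trans (size_polyMleq _ _)).
by rewrite size_polyX.
Qed.

Lemma nderivn_hermite_poly c m k : (k <= m)%N ->
  (hermite_poly c m)^`N(k) = ('C(m, k)%:R * (- c) ^+ k)%:P * hermite_poly c (m - k).
Proof.
move=> km; have k0 : (k`!%:R : R) != 0 by rewrite pnatr_eq0 -lt0n fact_gt0.
have h : (hermite_poly c m)^`(k) = ((m ^_ k)%:R * (- c) ^+ k)%:P * hermite_poly c (m - k).
  elim: k km {k0} => [|k IH] km; first by rewrite derivn0 ffactn0 expr0 mulr1 subn0 mul1r.
  rewrite derivnS IH 1?ltnW// -[(m - k)%N]prednK ?subn_gt0// -subnS derivM derivC mul0r add0r.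
  rewrite deriv_hermite_poly mulrA -polyCM ffactnSr subnS prednK ?subn_gt0// natrM exprS.
  by congr (_%:P * _); ring.
apply: (@mulfI _ k`!%:R); first by rewrite -polyC_natr polyC_eq0.
rewrite mulr_natl -nderivn_def h mulrA -polyC_natr -polyCM mulrA -natrM mulnC.
by rewrite bin_ffact.
Qed.

Local Notation "x %:C" := (real_complex R x).

(** Taylor expansion at [w]: by the Appell property the divided derivatives are multiples of lower
    Hermite polynomials. With [c = 2 pi] and [h] the conjugate of [q], the left side is the sum
    defining the true polyanalytic transform. *)
Lemma hermite_poly_addition c n (w h : R[i]) :
  \sum_(k < n.+1) 'C(n, k)%:R * (- c%:C * h) ^+ k * (map_poly (real_complex R) (hermite_poly c (n - k))).[w] =
  (map_poly (real_complex R) (hermite_poly c n)).[w + h].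
Proof.
rewrite (@nderiv_taylor_wide _ n.+1); last 2 first.
- exact: mulrC.
- by rewrite size_map_poly size_hermite_poly.
apply: eq_bigr => k _; rewrite nderivn_map nderivn_hermite_poly ?leq_ord//.
have -> : (map_poly (real_complex R) (('C(n, k)%:R * (- c) ^+ k)%:P * hermite_poly c (n - k))).[w] =
    'C(n, k)%:R * (- c%:C) ^+ k * (map_poly (real_complex R) (hermite_poly c (n - k))).[w].
  by rewrite rmorphM /= map_polyC hornerM hornerC /= rmorphM rmorphXn rmorphN rmorph_nat.
rewrite exprMn.
by rewrite -!mulrA; congr (_ * (_ * _)); rewrite mulrC.
Qed.

(** Reconciles the parameter [2 * pi] of the Bargmann kernel with the [4 * pi] of the window, taking
    [r = Num.sqrt 2]. *)
Lemma hermite_poly_scale (r c : R) m u :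
  (hermite_poly (c * r ^+ 2) m).[u] = r ^+ m * (hermite_poly c m).[r * u].
Proof.
suff -> : hermite_poly (c * r ^+ 2) m = (r ^+ m)%:P * (hermite_poly c m \Po (r *: 'X)).
  by rewrite hornerM hornerC horner_comp hornerZ hornerX.
elim: m => [|m IH]; first by rewrite expr0 mul1r comp_polyC.
rewrite [hermite_poly _ m.+1]/= IH derivM derivC mul0r add0r deriv_comp derivZ derivX.
rewrite [hermite_poly _ m.+1]/= rmorphB /= comp_polyZ comp_polyM comp_polyX -!mul_polyC !exprS expr0 !polyCM !polyC_exp.
ring.
Qed.

Lemma derive1n_gauss (c : R) n (t : R) :
  derive1n n (fun s : R => expR (- (c * s ^+ 2))) t =
  (hermite_poly (2 * c) n).[t] * expR (- (c * t ^+ 2)).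
Proof.
elim: n t => [|n IH] t; first by rewrite /= hornerC mul1r.
rewrite derive1nS (_ : derive1n n _ = (fun s => (hermite_poly (2 * c) n).[s] * expR (- (c * s ^+ 2)))); last exact/funext.
by rewrite derive1E; have d1 := is_derive_poly_gauss (hermite_poly (2 * c) n) c t; rewrite derive_val.
Qed.

(** For consecutive polynomials [p], [q], the derivative of [p * q] times the Gaussian is
    [q ^+ 2 - 2 a (n + 1) p ^+ 2] times the Gaussian. Its integral vanishes, which is the recursion
    for the norms. *)
Lemma Rintegral_hermite_sq (a : R) n : 0 < a ->
  \int[mu]_x ((hermite_poly (2 * a) n).[x] ^+ 2 * expR (- (a * x ^+ 2))) =
  (2 * a) ^+ n * n`!%:R * (Num.sqrt (a / pi))^-1.
Proof.
move=> a0; elim: n => [|n IH].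
  rewrite expr0 fact0 !mul1r.
  rewrite (_ : _^-1 = fine (Num.sqrt (a / pi))^-1%:E)//; congr fine.
  rewrite -(integral_expR_sq 0 a0); apply: eq_integral => x _.
  by rewrite /= hornerC expr1n mul1r subr0.
pose p := hermite_poly (2 * a) n; pose q := hermite_poly (2 * a) n.+1.
have qE : q = p^`() - (2 * a) *: ('X * p) by [].
have q' : q^`() = (- (2 * a * n.+1%:R))%:P * p by exact: deriv_hermite_poly.
have h : \int[mu]_x (q.[x] ^+ 2 * expR (- (a * x ^+ 2)) + (- (2 * a * n.+1%:R)) * (p.[x] ^+ 2 * expR (- (a * x ^+ 2)))) = 0.
  rewrite -(Rintegral_poly_gauss_deriv (p * q) a0); apply: eq_Rintegral => x _.
  move: qE q'; move: p q => u v vE v'.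
  have vx : v.[x] = u^`().[x] - 2 * a * (x * u.[x]).
    by rewrite vE !(hornerD, hornerN, hornerM, hornerC, hornerZ, hornerX).
  rewrite derivM v' !(hornerD, hornerN, hornerM, hornerC, hornerZ, hornerX) vx /=.
  by move: (u.[x]) (u^`().[x]) (expR _) => A B E; ring.
have iq : mu.-integrable setT (EFin \o (fun x => q.[x] ^+ 2 * expR (- (a * x ^+ 2)))).
  have := integrable_poly_gauss (q ^+ 2) a0; congr (_.-integrable _ _).
  by apply/funext => x /=; rewrite horner_exp.
have ip : mu.-integrable setT (EFin \o (fun x => p.[x] ^+ 2 * expR (- (a * x ^+ 2)))).
  have := integrable_poly_gauss (p ^+ 2) a0; congr (_.-integrable _ _).
  by apply/funext => x /=; rewrite horner_exp.
move: h; rewrite RintegralD//; last exact: (rintegrableZ _ measurableT ip).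
rewrite RintegralZl// IH -/q => /eqP; rewrite addr_eq0 => /eqP ->.
rewrite exprS factS natrM; ring.
Qed.

End hermite_polynomials.

Section gaussian_window.
Context (R : realType).
Local Notation mu := (@lebesgue_measure R).

Lemma poly_gauss_lipschitz (p : {poly R}) (a K : R) :
  (forall x, `|(p^`() - (2 * a) *: ('X * p)).[x] * expR (- (a * x ^+ 2))| <= K) ->
  forall x y, `|p.[x] * expR (- (a * x ^+ 2)) - p.[y] * expR (- (a * y ^+ 2))| <= K * `|x - y|.
Proof.
move=> Kb x y; wlog xy : x y / x <= y => [h|].
  by have [/h//|/ltW /h] := leP x y; rewrite (distrC x) (distrC (p.[x] * _)).
have [c _ h] := @MVT_segment R (fun x => p.[x] * expR (- (a * x ^+ 2)))
  (fun x => (p^`() - (2 * a) *: ('X * p)).[x] * expR (- (a * x ^+ 2))) x y xy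
  (fun z _ => is_derive_poly_gauss p a z) (continuous_subspaceT (@continuous_poly_gauss R p a)).
by rewrite distrC h normrM (distrC x) ler_wpM2r.
Qed.

(** Only the normalization has to be assumed. Half of the Gaussian absorbs the polynomial, and the
    same bound for the derivative supplies the Lipschitz constant. *)
Lemma poly_gauss_window (p : {poly R}) (a : R) : 0 < a ->
  (\int[mu]_x ((p.[x] * expR (- (a * x ^+ 2))) ^+ 2)%:E = 1)%E ->
  exists M L K, window (fun x => p.[x] * expR (- (a * x ^+ 2))) M L K.
Proof.
move=> a0 p1; have a20 : 0 < a / 2 by rewrite divr_gt0.
have bnd (q : {poly R}) : exists C : R, [/\ 0 <= C,
    forall x, `|q.[x] * expR (- (a * x ^+ 2))| <= C * expR (- (a / 2 * x ^+ 2)) &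
    forall x, `|q.[x] * expR (- (a * x ^+ 2))| <= C].
  have [C [C0 CP]] := poly_gauss_bound q a0.
  have h (x : R) : `|q.[x] * expR (- (a * x ^+ 2))| <= C * expR (- (a / 2 * x ^+ 2)).
    by rewrite normrM (ger0_norm (expR_ge0 _)).
  exists C; split => // x; apply: le_trans (h x) _.
  have e : expR (- (a / 2 * x ^+ 2)) <= expR 0.
    by rewrite ler_expR oppr_le0 mulr_ge0 ?sqr_ge0 ?(ltW a20).
  by rewrite expR0 in e; rewrite ler_piMr.
have [C [C0 C1 C2]] := bnd p.
have [K [_ _ KP]] := bnd (p^`() - (2 * a) *: ('X * p)).
have cpsi : continuous (fun x => p.[x] * expR (- (a * x ^+ 2))) by exact: continuous_poly_gauss.
pose L1 := C * (Num.sqrt (a / 2 / pi))^-1; pose L2 := C ^+ 2 * (Num.sqrt (a / pi))^-1.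
have L10 : 0 <= L1 by rewrite mulr_ge0 ?invr_ge0 ?sqrtr_ge0.
have L20 : 0 <= L2 by rewrite mulr_ge0 ?invr_ge0 ?sqrtr_ge0 ?sqr_ge0.
have mcomp (g : R -> R) : measurable_fun setT g ->
    measurable_fun setT (fun x => p.[g x] * expR (- (a * g x ^+ 2))).
  move=> mg; exact: (measurableT_comp (continuous_measurable_fun cpsi) mg).
exists C, (L1 + L2), K; split.
- exact: cpsi.
- exact: C2.
- exact: poly_gauss_lipschitz.
- move=> y; rewrite -p1.
  apply: (integral_shift y (F := fun x => (p.[x] * expR (- (a * x ^+ 2))) ^+ 2)) => x.
    by apply: cvgM; exact: cpsi.
  exact: sqr_ge0.
- move=> y; apply: (@le_trans _ _ L1%:E); last by rewrite lee_fin lerDl.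
  rewrite /L1 EFinM -(integral_expR_sq y a20) -ge0_integralZl//; last first.
    apply/measurable_EFinP; apply: (measurableT_comp (continuous_measurable_fun (@continuous_expR_sq R (a / 2)))).
    exact: measurable_funB.
  apply: ge0_le_integral => //.
  + apply/measurable_EFinP; apply: measurableT_comp => //; apply: mcomp; exact: measurable_funB.
  + apply/measurable_EFinP; apply: measurable_funM => //.
    apply: (measurableT_comp (continuous_measurable_fun (@continuous_expR_sq R (a / 2)))).
    exact: measurable_funB.
  + by move=> x _; rewrite -EFinM lee_fin C1.
- move=> x; apply: (@le_trans _ _ L2%:E); last by rewrite lee_fin lerDr.
  rewrite /L2 EFinM -(integral_expR_sq x a0) -ge0_integralZl//; last 2 first.
  + apply/measurable_EFinP; apply: (measurableT_comp (continuous_measurable_fun (@continuous_expR_sq R a))).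
    exact: measurable_funB.
  + by rewrite lee_fin sqr_ge0.
  apply: ge0_le_integral => //.
  + by move=> t _; rewrite lee_fin sqr_ge0.
  + apply/measurable_EFinP; apply: measurable_funX; apply: mcomp; exact: measurable_funB.
  + apply/measurable_EFinP; apply: measurable_funM => //.
    apply: (measurableT_comp (continuous_measurable_fun (@continuous_expR_sq R a))).
    exact: measurable_funB.
  + move=> t _; rewrite -EFinM lee_fin -(real_normK (num_real (_ * _))).
    apply: (@le_trans _ _ ((C * expR (- (a / 2 * (x - t) ^+ 2))) ^+ 2)).
      by rewrite ler_pXn2r ?nnegrE ?mulr_ge0 ?expR_ge0.
    rewrite exprMn [expR _ ^+ 2]expr2 -expRD -opprD -mulrDl -splitr.
    by rewrite -[in leRHS](opprB x) sqrrN.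
Qed.

Lemma hermite_wE n (t : R) :
  hermite_w n t = (-1) ^+ n * (hermite_poly (4 * pi) n).[t] * expR (- (pi * t ^+ 2)).
Proof.
rewrite /hermite_w derive1n_gauss (_ : 2 * (2 * pi) = 4 * pi); last by ring.
rewrite -!mulrA; congr (_ * _); rewrite mulrCA -expRD; congr (_ * expR _); ring.
Qed.

Lemma hermite_w_norm n : Lnorm (lebesgue_R R) 2%:E (fun s => (hermite_w n s)%:E) =
  (Num.sqrt ((4 * pi) ^+ n * n`!%:R * (Num.sqrt 2)^-1))%:E.
Proof.
have p20 : 0 < 2 * pi :> R by rewrite mulr_gt0// pi_gt0.
have -> : (4 * pi) ^+ n * n`!%:R * (Num.sqrt 2)^-1 =
    \int[mu]_x ((hermite_poly (4 * pi) n).[x] ^+ 2 * expR (- (2 * pi * x ^+ 2))).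
  have := Rintegral_hermite_sq n p20; rewrite (_ : 2 * (2 * pi) = 4 * pi); last by ring.
  by move=> ->; rewrite mulfK// gt_eqF// pi_gt0.
have i := integrable_poly_gauss ((hermite_poly (4 * pi) n) ^+ 2) p20.
rewrite Lnorm2E (_ : integral _ _ _ = (\int[mu]_x ((hermite_poly (4 * pi) n).[x] ^+ 2 *
    expR (- (2 * pi * x ^+ 2))))%:E); last first.
  rewrite Rintegral_EFin//; last first.
    by move: i; congr (_.-integrable _ _); apply/funext => x /=; rewrite horner_exp.
  apply: eq_integral => x _; congr EFin; rewrite hermite_wE !exprMn sqrr_sign mul1r.
  congr (_ * _); rewrite expr2 -expRD; congr expR; ring.
by rewrite poweR12_sqrt// lee_fin; apply: Rintegral_ge0 => x _; rewrite mulr_ge0 ?sqr_ge0 ?expR_ge0.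
Qed.

Definition psi_poly n : {poly R} :=
  ((-1) ^+ n / Num.sqrt ((4 * pi) ^+ n * n`!%:R * (Num.sqrt 2)^-1)) *: hermite_poly (4 * pi) n.

Lemma hermite_psiE n : hermite_psi n = fun t : R => (psi_poly n).[t] * expR (- (pi * t ^+ 2)).
Proof.
apply/funext => t; rewrite /hermite_psi hermite_w_norm hermite_wE /psi_poly hornerZ /=.
by rewrite -!mulrA; congr (_ * _); rewrite mulrA mulrC.
Qed.

Lemma hermite_psi_window n : exists M L K, window (@hermite_psi R n) M L K.
Proof.
rewrite hermite_psiE; apply: poly_gauss_window; first exact: pi_gt0.
pose N : R := (4 * pi) ^+ n * n`!%:R * (Num.sqrt 2)^-1.
have N0 : 0 < N.
  by rewrite !mulr_gt0 ?exprn_gt0 ?mulr_gt0 ?invr_gt0 ?sqrtr_gt0 ?pi_gt0// ltr0n fact_gt0.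
have p20 : 0 < 2 * pi :> R by rewrite mulr_gt0// pi_gt0.
have i := integrable_poly_gauss ((hermite_poly (4 * pi) n) ^+ 2) p20.
pose f (x : R) := (hermite_poly (4 * pi) n ^+ 2).[x] * expR (- (2 * pi * x ^+ 2)).
have fi : \int[mu]_x f x = N.
  have := Rintegral_hermite_sq n p20; rewrite (_ : 2 * (2 * pi) = 4 * pi); last by ring.
  by rewrite mulfK ?gt_eqF ?pi_gt0// -/N => <-; apply: eq_Rintegral => x _; rewrite /f horner_exp.
have iN : mu.-integrable setT (EFin \o (fun x => N^-1 * f x)) by exact: rintegrableZ.
transitivity (\int[mu]_x (N^-1 * f x)%:E)%E; last first.
  by rewrite -(Rintegral_EFin iN)// RintegralZl// fi mulVf// gt_eqF.
apply: eq_integral => x _; congr EFin.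
rewrite /psi_poly -/N hornerZ !exprMn sqrr_sign mul1r exprVn sqr_sqrtr ?(ltW N0)// -mulrA /f horner_exp.
congr (_ * (_ * _)); rewrite expr2 -expRD; congr expR; ring.
Qed.

End gaussian_window.
(** * The true-poly QSTFT as a short-time Fourier transform *)

Section quat_integral_sums.
Context (R : realType) disp (T : measurableType disp) (m : {measure set T -> \bar R}).

Lemma quat_integrableD (G G' : T -> quat R) : quat_integrable m setT G -> quat_integrable m setT G' ->
  quat_integrable m setT (fun t => G t + G' t).
Proof. by move=> [? ? ? ?] [? ? ? ?]; split; apply: rintegrableD. Qed.

Lemma quat_integral_sum n (G : nat -> T -> quat R) : (forall k, quat_integrable m setT (G k)) ->
  quat_integrable m setT (fun t => \sum_(k < n) G k t) /\
  quat_integral m setT (fun t => \sum_(k < n) G k t) = \sum_(k < n) quat_integral m setT (G k).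
Proof.
move=> Gi; elim: n => [|n [IH1 IH2]].
  split.
    rewrite (_ : (fun t => _) = fun=> 0); last by apply/funext => t; rewrite big_ord0.
    by split; exact: integrable0.
  rewrite big_ord0 (_ : (fun t => _) = fun=> 0); last by apply/funext => t; rewrite big_ord0.
  by rewrite /quat_integral /componentwise; congr Quat;
    by rewrite /Rintegral (eq_integral (fun=> 0%E))// integral0.
have -> : (fun t => \sum_(k < n.+1) G k t) = (fun t => \sum_(k < n) G k t + G n t).
  by apply/funext => t; rewrite big_ord_recr.
split; first exact: quat_integrableD.
by rewrite quat_integralD// IH2 big_ord_recr.
Qed.

End quat_integral_sums.

Section complex_exponential.
Context (R : realType).
Local Notation "x %:C" := (real_complex R x).

Lemma cexpD (z w : R[i]) : cexp (z + w) = cexp z * cexp w.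
Proof.
rewrite /cexp ReD ImD expRD cosD sinD; apply/eqP; rewrite eq_complex /=.
by apply/andP; split; apply/eqP; ring.
Qed.

Lemma cexp_real (x : R) : cexp x%:C = (expR x)%:C.
Proof. by rewrite /cexp /= cos0 sin0 mulr1 mulr0. Qed.

End complex_exponential.

Lemma bargmann_constant_arith (R : realType) (P t f s : R) : P != 0 -> t != 0 -> f != 0 -> s != 0 ->
  1 / (P * f) * (2 * s) = 2 * t / (t * P * f / s).
Proof. by move=> P0 t0 f0 s0; field; rewrite P0 t0 f0 s0. Qed.

Section qstft.
Context (R : realType).
Local Notation mu := (lebesgue_R R).
Local Notation C := R[i].
Local Notation "x %:C" := (real_complex R x).
Variable I : quat R.
Hypothesis hI : I ^+ 2 = -1.
Variable phi : R -> quat R.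
Hypothesis hphi : all_components (@square_integrable R) phi.
Local Notation slice := (slice I).

Let cN n : R := (-1) ^+ n * Num.sqrt (1 / ((2 * pi) ^+ n * n`!%:R)).

Let full_kernel n (q : C) (t : R) : C := (cN n * 2 `^ (3 / 4))%:C *
  ((map_poly (real_complex R) (hermite_poly (2 * pi) n)).[q + conjc q - (Num.sqrt 2 * t)%:C] *
   cexp (kernel_phase q t)).

Lemma slice_sum n (F : 'I_n -> C) : slice (\sum_(k < n) F k) = \sum_(k < n) slice (F k).
Proof. by apply: (big_morph slice); [exact: sliceD|rewrite slice_real scale0r]. Qed.

Lemma true_poly_bargmann_slice n (q : C) :
  quat_integrable mu setT (fun t => slice (full_kernel n q t) * phi t) /\
  true_poly_bargmann n phi (slice q) = quat_integral mu setT (fun t => slice (full_kernel n q t) * phi t).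
Proof.
pose z k : C := (cN n)%:C * ('C(n, k)%:R * (- (2 * pi)%:C * conjc q) ^+ k * (2 `^ (3 / 4))%:C).
pose G k t : quat R := slice (z k * hermite_kernel (n - k) q t) * phi t.
have Gi k : quat_integrable mu setT (G k) by exact: quat_integrable_jet.
have [S1 S2] := quat_integral_sum n.+1 Gi.
have GE : (fun t => \sum_(k < n.+1) G k t) = (fun t => slice (full_kernel n q t) * phi t).
  apply/funext => t; rewrite -mulr_suml -slice_sum; congr (slice _ * _).
  rewrite /full_kernel (_ : q + conjc q - _ = (q - (Num.sqrt 2 * t)%:C) + conjc q); last by rewrite addrAC.
  rewrite -hermite_poly_addition mulr_suml mulr_sumr; apply: eq_bigr => k _.
  by rewrite /z /hermite_kernel (rmorphM _ (cN n)) /=; ring.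
rewrite GE in S1 S2; split => //; rewrite S2 /true_poly_bargmann -/(cN n).
rewrite scaler_sumr; apply: eq_bigr => k _.
rewrite iter_sderive_bargmann// quat_conj_slice//.
rewrite (_ : _ ^+ k = slice ((- (2 * pi)%:C * conjc q) ^+ k)); last first.
  by rewrite -rmorphN sliceX// sliceZ.
rewrite -sliceZ// bargmann_jet_mull// -mulr_algl -(slice_real I) bargmann_jet_mull//.
rewrite /bargmann_jet; apply: eq_quat_integral => t.
by rewrite /G /z rmorph_nat.
Qed.

Lemma quat_norm_slice (z : C) : quat_norm (slice z) ^+ 2 = complex.Re z ^+ 2 + complex.Im z ^+ 2.
Proof.
have r0 := qre_imaginary_unit hI.
have := quat_norm_imaginary_unit hI 1; rewrite scale1r normr1 => /(congr1 (fun x => x ^+ 2)).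
rewrite !quat_norm_sq expr1n r0 expr0n add0r /=.
rewrite !mulr0 !mulr1 !add0r r0 mulr0 addr0 !exprMn => e.
rewrite -[X in _ = _ + X]mulr1 -[X in _ = _ + _ * X]e; ring.
Qed.

(** Apart from the sign [(-1) ^+ n] both sides are nonnegative, so their squares are compared.
    [Num.sqrt 2 ^+ n] is consumed by [hermite_poly_scale], the quotient normalizes [hermite_psi],
    and one [Num.sqrt 2] remains. *)
Lemma bargmann_constant n : cN n * 2 `^ (3 / 4) =
  Num.sqrt 2 * ((-1) ^+ n / Num.sqrt ((4 * pi) ^+ n * n`!%:R * (Num.sqrt 2)^-1)) * Num.sqrt 2 ^+ n :> R.
Proof.
have p0 := pi_gt0 R.
set F : R := n`!%:R; have F0 : 0 < F by rewrite ltr0n fact_gt0.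
have s0 : 0 < Num.sqrt 2 :> R by rewrite sqrtr_gt0.
have s2 : Num.sqrt 2 ^+ 2 = 2 :> R by rewrite sqr_sqrtr.
have A0 : 0 < (2 * pi) ^+ n * F by rewrite mulr_gt0// exprn_gt0// mulr_gt0.
have B0 : 0 < (4 * pi) ^+ n * F * (Num.sqrt 2)^-1 by rewrite !mulr_gt0// ?exprn_gt0 ?mulr_gt0 ?invr_gt0.
have k2 : (2 `^ (3 / 4)) ^+ 2 = 2 * Num.sqrt 2 :> R.
  rewrite -powR_mulrn ?powR_ge0// -powRrM (_ : 3 / 4 * 2 = 1 + 2^-1); last by field.
  by rewrite powRD ?pnatr_eq0 ?implybT// powRr1// -powR12_sqrt.
rewrite (_ : _ * (_ / _) * _ = (-1) ^+ n * (Num.sqrt 2 * Num.sqrt 2 ^+ n *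
  (Num.sqrt ((4 * pi) ^+ n * F * (Num.sqrt 2)^-1))^-1)); last by ring.
rewrite /cN -[LHS]mulrA; apply: (congr1 (fun u => (-1) ^+ n * u)).
apply: (@pexpIrn _ 2) => //; rewrite ?nnegrE ?mulr_ge0 ?sqrtr_ge0 ?powR_ge0 ?exprn_ge0 ?invr_ge0 ?sqrtr_ge0//.
rewrite [LHS]exprMn k2 (sqr_sqrtr (divr_ge0 ler01 (ltW A0))).
rewrite [RHS]exprMn [(_ * Num.sqrt 2 ^+ n) ^+ 2]exprMn s2 exprVn (sqr_sqrtr (ltW B0)).
rewrite -[Num.sqrt 2 ^+ n ^+ 2]exprM mulnC exprM s2.
rewrite (_ : 4 * pi = 2 * (2 * pi)); last by ring.
rewrite [(2 * (2 * pi)) ^+ n]exprMn -/F.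
have t0 : 2 ^+ n != 0 :> R by rewrite expf_neq0// pnatr_eq0.
have Pn0 : (2 * pi) ^+ n != 0 :> R by rewrite expf_neq0// gt_eqF// mulr_gt0.
by apply: bargmann_constant_arith => //; rewrite gt_eqF.
Qed.

Lemma true_poly_QSTFTE n x w : true_poly_QSTFT I n phi x w =
  quat_integral mu setT (fun t =>
    slice ((Num.sqrt 2 * hermite_psi n (x - t))%:C * cexp (0 +i* (- (2 * pi * w * t)))%C) * phi t).
Proof.
have s0 : 0 < Num.sqrt 2 :> R by rewrite sqrtr_gt0.
have s2 : Num.sqrt 2 ^+ 2 = 2 :> R by rewrite sqr_sqrtr.
(* The transform is evaluated at the conjugate point divided by [sqrt 2]. Then [q + conjc q] is the
   real number [sqrt 2 * x], so the polynomial is evaluated at [sqrt 2 * (x - t)]. *)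
pose q : C := ((Num.sqrt 2)^-1)%:C * (x -i* w)%C.
have xw : x%:A + w *: I = slice (x +i* w)%C by [].
have [iB eB] := true_poly_bargmann_slice n q.
rewrite /true_poly_QSTFT xw quat_conj_slice// -sliceZ// -/q eB.
have -> : (- (pi * x * w)) *: I = slice (0 +i* (- (pi * x * w)))%C.
  by rewrite /slice /= scale0r add0r.
rewrite quat_exp_slice// quat_norm_slice mulr_algr -mulr_algl -(slice_real I) mulrA -sliceM//.
rewrite -quat_integralMl//; apply: eq_quat_integral => t.
rewrite mulrA -sliceM//; congr (slice _ * _).
rewrite /full_kernel bargmann_constant hermite_psiE /psi_poly hornerZ.
have wE : q + conjc q - (Num.sqrt 2 * t)%:C = (Num.sqrt 2 * (x - t))%:C.
  have si : (Num.sqrt 2)^-1 = Num.sqrt 2 / 2 :> R.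
    have s'0 : Num.sqrt 2 != 0 :> R by rewrite gt_eqF.
    by apply: (mulfI s'0); rewrite mulfV// mulrA -expr2 s2 mulfV.
  by apply/eqP; rewrite eq_complex /q /= si; apply/andP; split; apply/eqP; field.
rewrite wE horner_map /= -cexp_real.
(* Expanding [q ^+ 2], the terms in [w ^+ 2] and in [x * w] cancel against the weight and the chirp.
   What remains is the Gaussian of the window and the Fourier phase. *)
have phaseE : (- ((x ^+ 2 + w ^+ 2) * pi / 2))%:C + (0 +i* (- (pi * x * w)))%C + kernel_phase q t =
   (- (pi * (x - t) ^+ 2))%:C + (0 +i* (- (2 * pi * w * t)))%C.
  have q1 : (2 * pi * Num.sqrt 2 * t)%:C * q = (2 * pi * t)%:C * (x -i* w)%C.
    rewrite /q mulrA -rmorphM /= (mulrAC _ (Num.sqrt 2)) -(mulrA (2 * pi * t)).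
    by rewrite mulfV ?mulr1// gt_eqF.
  have q2 : q ^+ 2 = (2^-1)%:C * (x -i* w)%C ^+ 2 by rewrite /q exprMn -rmorphXn /= exprVn s2.
  rewrite /kernel_phase q1 q2 expr2; move: (@pi R) => P.
  by apply/eqP; rewrite eq_complex /=; apply/andP; split; apply/eqP; field.
have -> : (4 * pi : R) = 2 * pi * Num.sqrt 2 ^+ 2 by rewrite s2; ring.
rewrite hermite_poly_scale.
rewrite mulrC -[LHS]mulrA.
have E : cexp (kernel_phase q t) *
    (cexp (- ((x ^+ 2 + w ^+ 2) * pi / 2))%:C * cexp (0 +i* (- (pi * x * w)))%C) =
    (expR (- (pi * (x - t) ^+ 2)))%:C * cexp (0 +i* (- (2 * pi * w * t)))%C.
  by rewrite -cexp_real -!cexpD -phaseE; congr cexp; ring.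
rewrite -[X in _ * X]mulrA E; set e := cexp _.
by rewrite !mulrA -!rmorphM /=; congr (_%:C * _); ring.
Qed.

End qstft.

(** * Real components of the synthesis integrand *)

Section synthesis.
Context (R : realType).
Local Notation mu := (lebesgue_R R).
Local Notation "x %:C" := (real_complex R x).
Variable I : quat R.
Hypothesis hI : I ^+ 2 = -1.
Variable phi : R -> quat R.
Hypothesis hphi : all_components (@square_integrable R) phi.
Variable n : nat.
Variables M L K : R.
Hypothesis wpsi : window (@hermite_psi R n) M L K.
Local Notation slice := (slice I).
Local Notation psi := (@hermite_psi R n).

Lemma pairing_stft (a b : R -> R) (x w : R) : square_integrable a -> square_integrable b ->
  let F (t : R) : R[i] := (Num.sqrt 2 * psi (x - t))%:C * cexp (0 +i* (- (2 * pi * w * t)))%C in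
  mu.-integrable setT (EFin \o (fun t => pairing a b (F t) t)) /\
  \int[mu]_t pairing a b (F t) t = Num.sqrt 2 * stft_re psi a b (x, w).
Proof.
move=> [ma a2] [mb b2] F.
have la := integrable_localized wpsi ma a2 x; have lb := integrable_localized wpsi mb b2 x.
have ia := integrable_cosM la w; have ib := integrable_sinM lb w.
have iB := rintegrableB measurableT ia ib.
have FE : (fun t => pairing a b (F t) t) = (fun t => Num.sqrt 2 *
    (cos (2 * pi * w * t) * (psi (x - t) * a t) - sin (2 * pi * w * t) * (psi (x - t) * b t))).
  apply/funext => t; rewrite /pairing /F /cexp /= expR0 cosN sinN; ring.
rewrite FE; split; first exact: rintegrableZ.
by rewrite RintegralZl// RintegralB.
Qed.

Let hIphi : all_components (@square_integrable R) (fun t => I * phi t).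
Proof. exact: quat_mull_square_integrable. Qed.

Let V := true_poly_QSTFT I n phi.
Let F (x w t : R) : R[i] := (Num.sqrt 2 * psi (x - t))%:C * cexp (0 +i* (- (2 * pi * w * t)))%C.

Let Fint x w : quat_integrable mu setT (fun t => slice (F x w t) * phi t).
Proof.
have [h0 h1 h2 h3] := hphi; have [k0 k1 k2 k3] := hIphi.
have p0 := proj1 (pairing_stft x w h0 k0); have p1 := proj1 (pairing_stft x w h1 k1).
have p2 := proj1 (pairing_stft x w h2 k2); have p3 := proj1 (pairing_stft x w h3 k3).
split; [move: p0|move: p1|move: p2|move: p3];
  by congr (_.-integrable _ _); apply/funext => t; rewrite /comp slice_mul.
Qed.

(** Left multiplication by the synthesis phase involves the component of [V] and that of [I * V];
    these are [stft_re] and [stft_im] up to [Num.sqrt 2]. Keeping [c] abstract treats the four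
    components at once. *)
Lemma component_synthesis (c : quat R -> R) (y : R) (z : R * R) :
  (forall (r : R) p q, c (r *: p + q) = r * c p + c q) ->
  square_integrable (c \o phi) -> square_integrable (fun t => c (I * phi t)) ->
  (forall G : R -> quat R, c (quat_integral mu setT G) = \int[mu]_t c (G t)) ->
  c (synthesis_integrand I n phi y z) =
  Num.sqrt 2 * resynth psi (c \o phi) (fun t => c (I * phi t)) y z.
Proof.
case: z => x w cl ha hb cint.
have c0 : c 0 = 0 by have := cl 1 0 0; rewrite scale1r addr0 mul1r; lra.
have cZ (r : R) p : c (r *: p) = r * c p by rewrite -[r *: p]addr0 cl c0 addr0.
have cslice (u : R[i]) p : c (slice u * p) = complex.Re u * c p + complex.Im u * c (I * p).
  by rewrite slice_mul cl cZ.
have VE : V x w = quat_integral mu setT (fun t => slice (F x w t) * phi t).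
  exact: true_poly_QSTFTE.
have cV : c (V x w) = Num.sqrt 2 * stft_re psi (c \o phi) (fun t => c (I * phi t)) (x, w).
  rewrite VE cint; have [_ <-] := pairing_stft x w ha hb.
  by apply: eq_Rintegral => t _; rewrite cslice.
(* [I * (I * phi) = - phi], so in the pair for [I * V] the companion of [I * phi] is [- phi]. *)
have hna : square_integrable (fun t => - 1 * (c \o phi) t) by exact: square_integrableZ.
have cIV : c (I * V x w) = Num.sqrt 2 * stft_im psi (c \o phi) (fun t => c (I * phi t)) (x, w).
  rewrite VE -quat_integralMl// cint.
  transitivity (\int[mu]_t pairing (fun t => c (I * phi t)) (fun t => - 1 * (c \o phi) t) (F x w t) t).
    apply: eq_Rintegral => t _; rewrite mulrA.
    have -> : I * slice (F x w t) = slice (F x w t) * I.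
      by rewrite /slice mulrDl mulrDr -scalerAl -!scalerAr mul1r mulr1 -scalerAl.
    rewrite -mulrA cslice /pairing mulrA -expr2 hI; congr (_ + _ * _).
    by rewrite [-1 * phi t]mulN1r -scaleN1r cZ.
  have [_ ->] := pairing_stft x w hb hna; congr (_ * _).
  rewrite /stft_re /stft_im; congr (_ + _); rewrite /sstft /fsin /=.
  have [ma a2] := ha; have la := integrable_localized wpsi ma a2 x; have ia := integrable_sinM la w.
  transitivity (- (-1 * \int[mu]_t (sin (2 * pi * w * t) * (psi (x - t) * (c \o phi) t)))).
    congr (- _); rewrite -RintegralZl//; apply: eq_Rintegral => t _ /=.
    by rewrite mulN1r !mulrN mulN1r.
  by rewrite mulN1r opprK.
rewrite /synthesis_integrand -/V mulr_algr cZ.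
have -> : (2 * pi * w * y) *: I = slice (0 +i* (2 * pi * w * y))%C.
  by rewrite /slice /= scale0r add0r.
rewrite quat_exp_slice// cslice cV cIV /cexp /= expR0 !mul1r /resynth /synth /=.
ring.
Qed.

End synthesis.

Section component_reconstruction.
Context (R : realType).
Local Notation mu := (lebesgue_R R).
Local Notation mu2 := (lebesgue_R2 R).
Variables (psi : R -> R) (M L K : R).
Hypothesis wpsi : window psi M L K.
Variables a b : R -> R.
Hypotheses (ha : square_integrable a) (hb : square_integrable b).
Variable S : R -> R * R -> R.
Hypothesis SE : forall y z, S y z = Num.sqrt 2 * resynth psi a b y z.

Let ma := proj1 ha.
Let mb := proj1 hb.
Let a2 := proj2 ha.
Let b2 := proj2 hb.

Let sqrt20 : Num.sqrt 2 != 0 :> R.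
Proof. by rewrite gt_eqF// sqrtr_gt0. Qed.

Let S_resynth (A : set (plane R)) y : measurable A ->
  mu2.-integrable A (EFin \o S y) -> (leb2 R).-integrable A (EFin \o resynth psi a b y).
Proof.
(* The two product measures are convertible; the restatement switches to the one with the
   sigma-finite instance. *)
move=> mA Si; have Si' : (leb2 R).-integrable A (EFin \o S y) by [].
have := rintegrableZ (Num.sqrt 2)^-1 mA Si'; congr (_.-integrable _ _).
by apply/funext => z /=; rewrite SE mulKf.
Qed.

Let int_S (A : set (plane R)) y : measurable A ->
  (leb2 R).-integrable A (EFin \o resynth psi a b y) ->
  1 / Num.sqrt 2 * \int[mu2]_(z in A) S y z = \int[leb2 R]_(z in A) resynth psi a b y z.
Proof.
move=> mA Hi; transitivity (1 / Num.sqrt 2 * \int[leb2 R]_(z in A) (Num.sqrt 2 * resynth psi a b y z)).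
  by congr (_ * _); apply: eq_Rintegral => z _.
by rewrite RintegralZl// mulrA div1r mulVf// mul1r.
Qed.

Lemma component_integrable (A : set (plane R)) y :
  measurable A -> (mu2 A < +oo)%E -> mu2.-integrable A (EFin \o S y).
Proof.
move=> mA Afin; have Afin' : (leb2 R A < +oo)%E by [].
have i := resynth_integrable_finite wpsi ma mb a2 b2 y mA Afin'.
have : (leb2 R).-integrable A (EFin \o S y).
  have := rintegrableZ (Num.sqrt 2) mA i; congr (_.-integrable _ _).
  by apply/funext => z /=; rewrite SE.
by [].
Qed.

Lemma component_oscillation : {ae mu, forall y, small_oscillation a y}.
Proof.
have [N [mN N0 NP]] := lebesgue_differentiation (locally_integrable_sq ma a2).
exists N; split => // y /= ny; apply: NP => /= ly; apply: ny.
exact: lebesgue_pt_small_oscillation.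
Qed.

Let err (A : nat -> set (plane R)) m y : R :=
  a y - 1 / Num.sqrt 2 * \int[mu2]_(z in A m) S y z.

Lemma component_L2_cvg (A : nat -> set (plane R)) :
  (forall m, measurable (A m)) -> (forall m, A m `<=` A m.+1) -> \bigcup_m A m = setT ->
  (forall m y, mu2.-integrable (A m) (EFin \o S y)) ->
  (forall m, measurable_fun setT (err A m)) /\
  (\int[mu]_y (err A m y ^+ 2)%:E)%E @[m --> \oo] --> 0%E.
Proof.
move=> mA Aincr Acov AS.
have Hi m y := S_resynth (mA m) (AS m y).
have errE m : err A m = (fun y => a y - \int[leb2 R]_(z in A m) resynth psi a b y z).
  by apply/funext => y; rewrite /err int_S.
split.
  move=> m; rewrite errE; exact: (measurable_resynth_part wpsi ma mb (mA m)).
under eq_fun do rewrite errE.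
exact: (resynth_L2_cvg wpsi ma mb a2 b2 mA Aincr Acov Hi component_oscillation).
Qed.

Lemma component_pointwise y : small_oscillation a y ->
  mu2.-integrable setT (EFin \o S y) -> a y = 1 / Num.sqrt 2 * \int[mu2]_z S y z.
Proof.
move=> osc Si; have Hi := S_resynth measurableT Si.
by rewrite int_S//; exact: (resynth_pointwise wpsi ma mb a2 b2 osc Hi).
Qed.

End component_reconstruction.

(** * From real components back to quaternions *)

Lemma cvg_poweR_half (R : realType) (u : nat -> \bar R) : (forall m, (0 <= u m)%E) ->
  u m @[m --> \oo] --> 0%E -> poweR (u m) 2^-1 @[m --> \oo] --> 0%E.
Proof.
move=> u0 uc.
have -> : (fun m => poweR (u m) 2^-1) = (fun m => sqrte (u m)).
  by apply/funext => m; rewrite poweR12_sqrt.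
move/fine_cvgP : uc => [ufin uc].
apply/fine_cvgP; split.
  by apply: filterS ufin => m; have := u0 m; case: (u m).
rewrite [X in X @ _ --> _](_ : _ = (fun m => Num.sqrt (fine (u m)))).
  rewrite -(@sqrtr0 R); apply: continuous_cvg; [exact: sqrt_continuous|exact: uc].
apply/funext => m /=; have := u0 m; case: (u m) => //= _; by rewrite sqrtr0.
Qed.

Lemma quat_norm_ge_component (R : realType) (q : quat R) :
  [/\ `|qre q| <= quat_norm q, `|qi q| <= quat_norm q, `|qj q| <= quat_norm q & `|qk q| <= quat_norm q].
Proof.
have h (x : R) : x ^+ 2 <= quat_norm q ^+ 2 -> `|x| <= quat_norm q.
  by rewrite -(real_normK (num_real x)) ler_pXn2r ?nnegrE ?sqrtr_ge0.
have a := sqr_ge0 (qre q); have b := sqr_ge0 (qi q); have c := sqr_ge0 (qj q); have d := sqr_ge0 (qk q).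
by split; apply: h; rewrite quat_norm_sq; lra.
Qed.

Lemma cvg_component (R : realType) (phi : R -> quat R) (c : quat R -> R) (y : R) :
  (forall p q, c (p - q) = c p - c q) -> (forall q, `|c q| <= quat_norm q) ->
  quat_norm (phi t - phi y) @[t --> y] --> (0 : R) -> {for y, continuous (c \o phi)}.
Proof.
move=> cB cn h; apply/cvgrPdist_le => /= e e0.
move/cvgrPdist_le : h => /(_ e e0); apply: filterS => t /=.
rewrite sub0r normrN ger0_norm ?sqrtr_ge0// => ht.
by rewrite distrC -cB; apply: le_trans (cn _) ht.
Qed.

Lemma integral_quat_norm_sq (R : realType) (f : R -> quat R) :
  all_components (fun g => measurable_fun setT (g : measurableTypeR R -> R)) f ->
  (\int[lebesgue_R R]_y (quat_norm (f y) ^+ 2)%:E =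
   \int[lebesgue_R R]_y (qre (f y) ^+ 2)%:E + \int[lebesgue_R R]_y (qi (f y) ^+ 2)%:E +
   \int[lebesgue_R R]_y (qj (f y) ^+ 2)%:E + \int[lebesgue_R R]_y (qk (f y) ^+ 2)%:E)%E.
Proof.
move=> [m0 m1 m2 m3].
have ms (g : R -> R) : measurable_fun setT (g : measurableTypeR R -> R) ->
    measurable_fun setT (fun y => (g y ^+ 2)%:E).
  by move=> mg; apply/measurable_EFinP; exact: measurable_funX.
have g0 (x : R) : (0 <= (x ^+ 2)%:E)%E by rewrite lee_fin sqr_ge0.
rewrite -ge0_integralD//; [|exact: ms m0|exact: ms m1].
rewrite -ge0_integralD//; last 3 first.
- by move=> y _; exact: adde_ge0.
- by apply: emeasurable_funD; [exact: ms m0|exact: ms m1].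
- exact: ms m2.
rewrite -ge0_integralD//; last 3 first.
- by move=> y _; rewrite !adde_ge0.
- by apply: emeasurable_funD; [apply: emeasurable_funD; [exact: ms m0|exact: ms m1]|exact: ms m2].
- exact: ms m3.
by apply: eq_integral => y _; rewrite quat_norm_sq.
Qed.

Theorem theorem6p11 (R : realType) (I : quat R) (hI : I ^+ 2 = -1)
    (n : nat) (phi : R -> quat R) (hphi : quat_L2 phi) :
  [/\ (* the integrand is integrable on every set of finite measure *)
      forall (A : set (measurableTypeR R * measurableTypeR R)%type) (y : R),
        measurable A -> (lebesgue_R2 R A < +oo)%E ->
        quat_integrable (lebesgue_R2 R) A (synthesis_integrand I n phi y),
      (* the reconstruction integral over R^2 equals phi as an L^2-valued
         improper integral *)
      forall K : nat -> set (measurableTypeR R * measurableTypeR R)%type,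
        (forall m, measurable (K m)) ->
        (forall m, K m `<=` K m.+1) ->
        \bigcup_m K m = setT ->
        (forall m y, quat_integrable (lebesgue_R2 R) (K m) (synthesis_integrand I n phi y)) ->
        quat_L2norm (fun y => phi y - reconstruction I n phi (K m) y)
          @[m --> \oo] --> 0%E,
      (* equality of the two sides at almost every point, resp. at every point
         of continuity of phi, at which the integral over R^2 exists *)
      {ae lebesgue_R R, forall y : R,
        quat_integrable (lebesgue_R2 R) setT (synthesis_integrand I n phi y) ->
        phi y = reconstruction I n phi setT y}
    & forall y : R,
        quat_norm (phi t - phi y) @[t --> y] --> (0 : R) ->
        quat_integrable (lebesgue_R2 R) setT (synthesis_integrand I n phi y) ->
        phi y = reconstruction I n phi setT y ].
Proof.
have hc := quat_L2_components hphi.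
have [h0 h1 h2 h3] := hc.
have [k0 k1 k2 k3] := quat_mull_square_integrable I hc.
have [M [L [K wpsi]]] := hermite_psi_window R n.
pose S := synthesis_integrand I n phi.
have S0 y z := component_synthesis hI hc wpsi y z (fun r p q => erefl) h0 k0 (fun G => erefl).
have S1 y z := component_synthesis hI hc wpsi y z (fun r p q => erefl) h1 k1 (fun G => erefl).
have S2 y z := component_synthesis hI hc wpsi y z (fun r p q => erefl) h2 k2 (fun G => erefl).
have S3 y z := component_synthesis hI hc wpsi y z (fun r p q => erefl) h3 k3 (fun G => erefl).
(* Common to the two pointwise clauses, which differ only in how small oscillation at [y] is
   obtained: from Lebesgue differentiation or from continuity. *)
have pointwise y : small_oscillation (@qre R \o phi) y -> small_oscillation (@qi R \o phi) y ->
    small_oscillation (@qj R \o phi) y -> small_oscillation (@qk R \o phi) y ->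
    quat_integrable (lebesgue_R2 R) setT (S y) -> phi y = reconstruction I n phi setT y.
  move=> o0 o1 o2 o3 [i0 i1 i2 i3].
  have e0 := component_pointwise wpsi h0 k0 S0 o0 i0.
  have e1 := component_pointwise wpsi h1 k1 S1 o1 i1.
  have e2 := component_pointwise wpsi h2 k2 S2 o2 i2.
  have e3 := component_pointwise wpsi h3 k3 S3 o3 i3.
  rewrite (_ : phi y = Quat ((@qre R \o phi) y) ((@qi R \o phi) y) ((@qj R \o phi) y) ((@qk R \o phi) y)).
    by rewrite e0 e1 e2 e3.
  by rewrite /=; case: (phi y).
split.
- move=> A y mA Afin; split.
  + exact: (component_integrable wpsi h0 k0 S0 y mA Afin).
  + exact: (component_integrable wpsi h1 k1 S1 y mA Afin).
  + exact: (component_integrable wpsi h2 k2 S2 y mA Afin).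
  + exact: (component_integrable wpsi h3 k3 S3 y mA Afin).
- move=> A mA Aincr Acov Ai.
  have i0 m y : (lebesgue_R2 R).-integrable (A m) (EFin \o (@qre R \o S y)) by have [] := Ai m y.
  have i1 m y : (lebesgue_R2 R).-integrable (A m) (EFin \o (@qi R \o S y)) by have [] := Ai m y.
  have i2 m y : (lebesgue_R2 R).-integrable (A m) (EFin \o (@qj R \o S y)) by have [] := Ai m y.
  have i3 m y : (lebesgue_R2 R).-integrable (A m) (EFin \o (@qk R \o S y)) by have [] := Ai m y.
  have [m0 c0] := component_L2_cvg wpsi h0 k0 S0 mA Aincr Acov i0.
  have [m1 c1] := component_L2_cvg wpsi h1 k1 S1 mA Aincr Acov i1.
  have [m2 c2] := component_L2_cvg wpsi h2 k2 S2 mA Aincr Acov i2.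
  have [m3 c3] := component_L2_cvg wpsi h3 k3 S3 mA Aincr Acov i3.
  under eq_fun do rewrite quat_L2normE.
  apply: cvg_poweR_half.
    by move=> m; apply: integral_ge0 => y _; rewrite lee_fin sqr_ge0.
  have cD (u v : nat -> \bar R) : u m @[m --> \oo] --> 0%E -> v m @[m --> \oo] --> 0%E ->
      (u m + v m)%E @[m --> \oo] --> 0%E.
    by move=> cu cv; rewrite -(adde0 0%E); exact: cvgeD.
  have := cD _ _ (cD _ _ (cD _ _ c0 c1) c2) c3.
  apply: cvg_trans; apply: near_eq_cvg; apply: nearW => m.
  by rewrite [RHS]integral_quat_norm_sq//; split; [exact: m0|exact: m1|exact: m2|exact: m3].
- have o0 := component_oscillation h0; have o1 := component_oscillation h1.
  have o2 := component_oscillation h2; have o3 := component_oscillation h3.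
  have FF : Filter (nbhs (almost_everywhere (lebesgue_R R))) by exact: ae_filter_ringOfSetsType.
  apply: (filterS _ (filterI (filterI o0 o1) (filterI o2 o3))) => y [[? ?] [? ?]]; exact: pointwise.
- move=> y cy; have b (q : quat R) := quat_norm_ge_component q.
  apply: pointwise.
  + apply: continuous_small_oscillation; first exact: (proj1 h0).
    by apply: (cvg_component _ _ cy) => // q; have [] := b q.
  + apply: continuous_small_oscillation; first exact: (proj1 h1).
    by apply: (cvg_component _ _ cy) => // q; have [] := b q.
  + apply: continuous_small_oscillation; first exact: (proj1 h2).
    by apply: (cvg_component _ _ cy) => // q; have [] := b q.
  + apply: continuous_small_oscillation; first exact: (proj1 h3).
    by apply: (cvg_component _ _ cy) => // q; have [] := b q.
Qed.
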